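(* Let $\rho_0$ satisfy the density assumption of the context. For each $\mathbf k=(k_1,k_2)\in(L^{-1}\mathbb Z)^2\setminus\{0\}$ there exists an infinite sequence ($n\ge1$) of normal modes $$e^{\lambda_n(\mathbf k)t}V_n(\mathbf k,x)=e^{\lambda_n(\mathbf k)t}\big(\zeta_n(\mathbf k,x),u_n(\mathbf k,x),q_n(\mathbf k,x),\eta_n(\mathbf k,x_h)\big)$$ to the linearized equations $$\begin{cases}\partial_t\zeta+\rho_0'u_3=0&\text{in }\Omega,\\ \rho_0\partial_tu+\nabla q-\mu\Delta u+g\zeta e_3=0&\text{in }\Omega,\\ \operatorname{div}u=0&\text{in }\Omega,\\ \partial_t\eta=u_3&\text{on }\Gamma,\\ ((q-g\rho_+\eta)\mathrm{Id}-\mu\mathbb Su)e_3=0&\text{on }\Gamma,\end{cases}$$ such that $\zeta_n\in H^\infty(\Omega)$, $u_n\in(H^\infty(\Omega))^3$ and $q_n\in H^\infty(\Omega)$. Here $\{\lambda_n(\mathbf k)\}_{n\ge1}$ is the infinite sequence of characteristic values, decreasing to $0$, defined in the context, and the modes have the horizontal dependence described in the context.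
   Context: Constants $g,\mu,L,a>0$. $\mathbf T^2=(\mathbb R/2\pi L\mathbb Z)^2$, $\Omega=\mathbf T^2\times(-\infty,0)$, $\Gamma=\mathbf T^2\times\{0\}$, $x=(x_h,x_3)$, $e_3=(0,0,1)^T$, $\mathbb Su=\nabla u+\nabla u^T$, $H^\infty=\bigcap_sH^s$. Density assumption: $\rho_0$ is smooth on $(-\infty,0]$, $\rho_0'\ge0$, $\operatorname{supp}\rho_0'=[-a,0]$, $\rho_0=\rho_->0$ on $(-\infty,-a]$, $\rho_0(0)=\rho_+$. A normal mode is a nontrivial solution of the form $e^{\lambda t}V(x)$ with $\lambda>0$; with $V=(\zeta,u,q,\eta)$ sought in the form $u_1=\sin(\mathbf k\cdot x_h)\psi(x_3)$, $u_2=\sin(\mathbf k\cdot x_h)\varphi(x_3)$, $u_3=\cos(\mathbf k\cdot x_h)\phi(x_3)$, $q=\cos(\mathbf k\cdot x_h)\pi(x_3)$, $\zeta=-\lambda^{-1}\rho_0'u_3$, $\eta=\lambda^{-1}u_3|_\Gamma$, with $\psi,\varphi,\phi,\pi\to0$ at $-\infty$. With $k=|\mathbf k|$, a characteristic value is $\lambda$ with $\operatorname{Re}\lambda>0$ such that there is a nontrivial $\phi\in H^4((-\infty,0))$ with $\lambda^2(k^2\rho_0\phi-(\rho_0\phi')')+\lambda\mu(\phi^{(4)}-2k^2\phi''+k^4\phi)=gk^2\rho_0'\phi$ on $(-\infty,0)$, $k^2\phi(0)+\phi''(0)=0$, $-\lambda\mu\phi'''(0)+(3\lambda\mu k^2+\lambda^2\rho_+)\phi'(0)+gk^2\rho_+\phi(0)=0$,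 $\phi(x_3)\to0$ as $x_3\to-\infty$. For each $\mathbf k$ the characteristic values are positive reals and form an infinite sequence decreasing to $0$. *)

(* Defs.v *)
From HB Require Import structures.
From mathcomp Require Import all_boot all_order all_algebra.
From mathcomp Require Import complex.
From mathcomp Require Import all_classical all_reals all_analysis.

Set Implicit Arguments.
Unset Strict Implicit.
Unset Printing Implicit Defensive.

Import Order.TTheory GRing.Theory Num.Theory.
Import numFieldNormedType.Exports.

Local Open Scope classical_set_scope.
Local Open Scope ring_scope.

(* A function on a set such as (-oo, 0] or Omega is represented by a total
   function of which only the values on that set matter; boundary values are
   one-sided limits. *)

Section Density.
Context {R : realType}.
Implicit Types rho : R -> R.

(* C^oo on (-oo, 0]: smooth inside, with all derivatives continuous up to 0. *)
Definition smooth_halfline rho : Prop :=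
  (forall n (x : R), x < 0 -> derivable (derive1n n rho) x 1) /\
  (forall n, cvg (derive1n n rho x @[x --> 0^'-])) /\
  rho x @[x --> 0^'-] --> rho 0.

(* rho' is only evaluated inside (-oo, 0): its one-sided value at 0 changes
   neither its sign condition nor its support, by continuity. *)
Record density_assumption (a rho_minus rho_plus : R) (rho : R -> R) : Prop :=
  DensityAssumption {
  density_smooth : smooth_halfline rho ;
  density_incr : forall x : R, x < 0 -> 0 <= derive1 rho x ;
  density_supp :
    closure [set x | x < 0 /\ derive1 rho x != 0] = `[- a, 0]%classic ;
  density_minus_gt0 : 0 < rho_minus ;
  density_minus : forall x : R, x <= - a -> rho x = rho_minus ;
  density_plus : rho 0 = rho_plus
}.

End Density.

Section SquareIntegrable.
Context {d : measure_display} {T : measurableType d} {R : realType}.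

Definition L2 (m : {measure set T -> \bar R}) (D : set T) (f : T -> R) : Prop :=
  measurable_fun D f /\ m.-integrable D (fun x => ((f x) ^+ 2)%:E).

End SquareIntegrable.

Section CharacteristicValues.
Context {R : realType}.
Local Notation leb := (@lebesgue_measure R).

Definition test_halfline (theta : R -> R) : Prop :=
  (forall n x, derivable (derive1n n theta) x 1) /\
  exists b c : R, c < 0 /\ forall x, theta x != 0 -> b <= x <= c.

(* g is the weak derivative of f on (-oo, 0), both being square integrable. *)
Definition weak_derivative (f g : R -> R) : Prop :=
  [/\ L2 leb `]-oo, 0[ f, L2 leb `]-oo, 0[ g &
   forall theta, test_halfline theta ->
     \int[leb]_(x in `]-oo, 0[) (f x * derive1 theta x) =
     - \int[leb]_(x in `]-oo, 0[) (g x * theta x)].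

Definition cweak_derivative (f g : R -> R[i]) : Prop :=
  weak_derivative (fun x => complex.Re (f x)) (fun x => complex.Re (g x)) /\
  weak_derivative (fun x => complex.Im (f x)) (fun x => complex.Im (g x)).

Definition ccontinuous_halfline (f : R -> R[i]) : Prop :=
  {within `]-oo, 0], continuous (fun x => complex.Re (f x))} /\
  {within `]-oo, 0], continuous (fun x => complex.Im (f x))}.

(* w 0 belongs to H^m((-oo, 0)) with weak derivatives w 1, ..., w m; those of
   order < m are the representatives continuous up to 0, so that their values
   at 0 are the traces. *)
Definition sobolev_jet (m : nat) (w : nat -> R -> R[i]) : Prop :=
  forall j, (j < m)%N ->
    cweak_derivative (w j) (w j.+1) /\ ccontinuous_halfline (w j).

(* The norm of R * R is the sup norm, not the Euclidean one. *)
Definition wavenumber (k : R * R) : R := Num.sqrt (k.1 ^+ 2 + k.2 ^+ 2).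

Local Notation "r %:C" := (real_complex R r).

(* [w j] is the j-th derivative of phi, and [flux] is (rho0 phi')'. *)
Definition characteristic_value (g mu rho_plus : R) (rho0 : R -> R)
    (k : R * R) (lam : R[i]) : Prop :=
  let kk : R[i] := (wavenumber k)%:C in
  0 < complex.Re lam /\
  exists (phi : R -> R[i]) (w : nat -> R -> R[i]) (flux : R -> R[i]),
    [/\ w 0%N = phi, sobolev_jet 4 w &
        cweak_derivative (fun x => (rho0 x)%:C * w 1%N x) flux] /\
    (exists x : R, x < 0 /\ phi x != 0) /\
    {ae leb, forall x : R, x < 0 ->
       lam ^+ 2 * (kk ^+ 2 * (rho0 x)%:C * phi x - flux x)
       + lam * mu%:C * (w 4%N x - 2 * kk ^+ 2 * w 2%N x + kk ^+ 4 * phi x)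
       = g%:C * kk ^+ 2 * (derive1 rho0 x)%:C * phi x} /\
    kk ^+ 2 * phi 0 + w 2%N 0 = 0 /\
    - (lam * mu%:C * w 3%N 0)
      + (3 * lam * mu%:C * kk ^+ 2 + lam ^+ 2 * rho_plus%:C) * w 1%N 0
      + g%:C * kk ^+ 2 * rho_plus%:C * phi 0 = 0 /\
    (complex.Re (phi x) @[x --> -oo] --> (0 : R)) /\
    (complex.Im (phi x) @[x --> -oo] --> (0 : R)).

(* lam lists all characteristic values, in decreasing order, and tends to 0;
   the n-th one (n >= 1) of the usual indexing is lam n.-1. *)
Definition characteristic_sequence (g mu rho_plus : R) (rho0 : R -> R)
    (k : R * R) (lam : R^nat) : Prop :=
  [/\ forall n, 0 < lam n,
      forall n, lam n.+1 < lam n,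
      lam @ \oo --> (0 : R) &
      forall z : R[i], characteristic_value g mu rho_plus rho0 k z <->
        exists n, z = (lam n)%:C].

End CharacteristicValues.

Section Fields.
Context {R : realType}.

(* x = (x_h, x_3) with x_h = x.1 and x_3 = x.2.  The torus is represented by
   2 pi L-periodicity in the two components of x_h. *)
Definition Omega : set (R * R * R) := [set x | x.2 < 0].

Definition edir (i : 'I_3) : R * R * R :=
  ((i == 0)%:R, (i == 1)%:R, (i == 2)%:R).

Definition pdiff (i : 'I_3) (f : R * R * R -> R) : R * R * R -> R :=
  fun x => 'D_(edir i) f x.

Definition pdiffs (l : seq 'I_3) (f : R * R * R -> R) : R * R * R -> R :=
  foldr pdiff f l.

Definition shift_h (L : R) (m1 m2 : int) (xh : R * R) : R * R :=
  (xh.1 + m1%:~R * (2 * pi * L), xh.2 + m2%:~R * (2 * pi * L)).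

Definition periodic_h (L : R) (f : R * R -> R) : Prop :=
  forall m1 m2 xh, f (shift_h L m1 m2 xh) = f xh.

Definition periodic_on (L : R) (D : set (R * R * R)) (f : R * R * R -> R) :
    Prop :=
  forall m1 m2 x, D x -> f (shift_h L m1 m2 x.1, x.2) = f x.

(* Smooth in Omega, every derivative having a limit on x_3 = 0. *)
Definition smooth_Omega (f : R * R * R -> R) : Prop :=
  forall l : seq 'I_3,
    (forall x, Omega x -> differentiable (pdiffs l f) x) /\
    (forall xh, cvg (pdiffs l f (xh, z) @[z --> 0^'-])).

Definition cell (L : R) : set (R * R * R) :=
  [set x | [/\ 0 <= x.1.1 <= 2 * pi * L, 0 <= x.1.2 <= 2 * pi * L & x.2 < 0]].

Local Notation leb3 :=
  ((@lebesgue_measure R \x @lebesgue_measure R) \x @lebesgue_measure R)%E.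

(* C_c^oo(Omega): compactly supported on the torus times (-oo, 0). *)
Definition test_Omega (L : R) (theta : R * R * R -> R) : Prop :=
  [/\ forall (l : seq 'I_3) x, differentiable (pdiffs l theta) x,
      periodic_on L setT theta &
      exists b c : R, c < 0 /\ forall x, theta x != 0 -> b <= x.2 <= c].

Definition weak_pdiffs (L : R) (l : seq 'I_3) (f h : R * R * R -> R) : Prop :=
  [/\ L2 leb3 (cell L) f, L2 leb3 (cell L) h &
   forall theta, test_Omega L theta ->
     \int[leb3]_(x in cell L) (f x * pdiffs l theta x) =
     (-1) ^+ size l * \int[leb3]_(x in cell L) (h x * theta x)].

Definition sobolev (L : R) (m : nat) (f : R * R * R -> R) : Prop :=
  periodic_on L Omega f /\
  forall l : seq 'I_3, (size l <= m)%N -> exists h, weak_pdiffs L l f h.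

Definition Hinfty (L : R) (f : R * R * R -> R) : Prop :=
  forall m, sobolev L m f.

Definition vcomp (u : R * R * R -> 'cV[R]_3) (i : 'I_3) : R * R * R -> R :=
  fun x => u x i 0.

Definition grad (q : R * R * R -> R) (x : R * R * R) : 'cV[R]_3 :=
  \col_i pdiff i q x.

Definition div (u : R * R * R -> 'cV[R]_3) (x : R * R * R) : R :=
  \sum_(i < 3) pdiff i (vcomp u i) x.

Definition laplacian (u : R * R * R -> 'cV[R]_3) (x : R * R * R) : 'cV[R]_3 :=
  \col_i \sum_(j < 3) pdiff j (pdiff j (vcomp u i)) x.

Definition jacobian (u : R * R * R -> 'cV[R]_3) (x : R * R * R) : 'M[R]_3 :=
  \matrix_(i, j) pdiff j (vcomp u i) x.

Definition strain (u : R * R * R -> 'cV[R]_3) (x : R * R * R) : 'M[R]_3 :=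
  jacobian u x + (jacobian u x)^T.

Definition e3 : 'cV[R]_3 := delta_mx 2 0.

(* Space-time scalar field, regular enough for the equations to make classical
   sense up to the boundary. *)
Definition regular_field (L : R) (f : R -> R * R * R -> R) : Prop :=
  [/\ forall t, smooth_Omega (f t), forall t, periodic_on L Omega (f t) &
      forall t x, Omega x -> derivable (fun s => f s x) t 1].

Definition linearized_solution (g mu L rho_plus : R) (rho0 : R -> R)
    (zeta : R -> R * R * R -> R) (u : R -> R * R * R -> 'cV[R]_3)
    (q : R -> R * R * R -> R) (eta : R -> R * R -> R) : Prop :=
  [/\ regular_field L zeta,
      forall i, regular_field L (fun t => vcomp (u t) i),
      regular_field L q,
      forall t, periodic_h L (eta t) &
      forall (t : R) xh, derivable (fun s => eta s xh) t 1] /\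
  [/\ forall t x, Omega x ->
        derive1 (fun s => zeta s x) t + derive1 rho0 x.2 * vcomp (u t) 2 x = 0,
      forall t x, Omega x ->
        rho0 x.2 *: (\col_i derive1 (fun s => vcomp (u s) i x) t) + grad (q t) x
        - mu *: laplacian (u t) x + (g * zeta t x) *: e3 = 0,
      forall t x, Omega x -> div (u t) x = 0,
      forall t xh,
        vcomp (u t) 2 (xh, z) @[z --> 0^'-] --> derive1 (fun s => eta s xh) t &
      forall t xh,
        ((q t (xh, z) - g * rho_plus * eta t xh)%:M
          - mu *: strain (u t) (xh, z)) *m e3 @[z --> 0^'-] --> (0 : 'cV[R]_3)].

Record fields : Type := Fields {
  f_zeta : R * R * R -> R ;
  f_u : R * R * R -> 'cV[R]_3 ;
  f_q : R * R * R -> R ;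
  f_eta : R * R -> R
}.

Definition nontrivial (V : fields) : Prop :=
  ~ ((forall x, Omega x -> [/\ f_zeta V x = 0, f_u V x = 0 & f_q V x = 0]) /\
     (forall xh, f_eta V xh = 0)).

Definition normal_mode (g mu L rho_plus : R) (rho0 : R -> R) (lam : R)
    (V : fields) : Prop :=
  [/\ 0 < lam, nontrivial V &
      linearized_solution g mu L rho_plus rho0
        (fun t x => expR (lam * t) * f_zeta V x)
        (fun t x => expR (lam * t) *: f_u V x)
        (fun t x => expR (lam * t) * f_q V x)
        (fun t xh => expR (lam * t) * f_eta V xh)].

Definition phase (k xh : R * R) : R := k.1 * xh.1 + k.2 * xh.2.

(* eta = u_3 / lam on x_3 = 0 is read as a limit. *)
Definition horizontal_form (rho0 : R -> R) (k : R * R) (lam : R) (V : fields) :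
    Prop :=
  exists psi vphi phi varpi : R -> R,
    [/\ psi x @[x --> -oo] --> (0 : R), vphi x @[x --> -oo] --> (0 : R),
        phi x @[x --> -oo] --> (0 : R) & varpi x @[x --> -oo] --> (0 : R)] /\
    (forall x, Omega x ->
      [/\ vcomp (f_u V) 0 x = sin (phase k x.1) * psi x.2,
          vcomp (f_u V) 1 x = sin (phase k x.1) * vphi x.2,
          vcomp (f_u V) 2 x = cos (phase k x.1) * phi x.2,
          f_q V x = cos (phase k x.1) * varpi x.2 &
          f_zeta V x = - (lam^-1 * derive1 rho0 x.2 * vcomp (f_u V) 2 x)]) /\
    (forall xh,
      lam^-1 * vcomp (f_u V) 2 (xh, z) @[z --> 0^'-] --> f_eta V xh).

(* k ranges over (L^-1 Z)^2. *)
Definition frequency (L : R) (k : R * R) : Prop :=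
  exists m1 m2 : int, k = (L^-1 * m1%:~R, L^-1 * m2%:~R).

End Fields.
Arguments fields R : clear implicits.

(* Main.v *)
Require Import Defs.
From HB Require Import structures.
From mathcomp Require Import all_boot all_order all_algebra.
From mathcomp Require Import complex ring lra.
From mathcomp Require Import all_classical all_reals all_analysis.
From mathcomp Require Import measurable_realfun.

Set Implicit Arguments.
Unset Strict Implicit.
Unset Printing Implicit Defensive.

Import Order.TTheory GRing.Theory Num.Theory.
Import numFieldNormedType.Exports.

Local Open Scope classical_set_scope.
Local Open Scope ring_scope.

(** On [-a, 0] the eigenvalue equation is the Euler-Lagrange equation of a
quadratic form [Qform lam] in (phi, phi'): on the half-line below -a the density
is constant, the decaying solutions are explicit, and their energy is a form in
the boundary values phi(-a), phi'(-a).  Let the index of [lam] be the largest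
dimension of a space on which [Qform lam] is negative definite.

- The index is finite, locally uniformly in lam > 0: a function vanishing on a
  fine mesh satisfies a Poincare inequality, so the form is nonnegative on it.
- It is unbounded as lam tends to 0: use disjoint bumps where rho0' > 0.
- If L is characteristic and l < L, the index of l exceeds that of L, because the
  eigenfunction can be added to a negative space of L.
- If L is not characteristic, replacing each u of a negative space by u - e v,
  where v solves the boundary value problem at L with source rho0' u, yields a
  space on which the form is still negative slightly beyond L.

The third point makes the characteristic values above any positive number
finitely many; by the fourth, an upper bound of the parameters of large index can
be attained only at a characteristic value, so they accumulate at 0.

A complex characteristic value with a nonzero imaginary part is excluded by the
monotonicity of the imaginary part of p . conj y, for the position y = (phi, phi')
and its momentum p: it vanishes at 0 and is integrable at -oo.  The equation has
constant coefficients below -a, so the eigenfunction and all its derivatives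
decay exponentially there, and the modes are in H^oo. *)

(** The parameter enters the equation quadratically and, through the decay rate below -a, also under
    a square root, so its values are not the spectrum of one fixed operator. Counting negative
    directions of [Qform lam] replaces a spectral theorem and needs only finite-dimensional spaces.
    Two scaling facts drive the count: [Pform lam] divided by [lam] is nondecreasing in [lam], and
    divided by [lam ^+ 2] it is nonincreasing. The first keeps a form negative when the parameter
    decreases; the second limits the loss when it increases. Away from characteristic values this
    loss is compensated. With J the integral of rho0' u^2, Q(u - e v) = Q(u) - 2 e J + e^2 Q(v, v),
    and Q(v, v) is at most a multiple of J, so a suitable e gains e J. The equation is put in
    Hamiltonian form because the coefficients then involve only rho0 and rho0', the boundary
    conditions become linear relations between position and momentum, and the fourth derivative, at
    first only weak, disappears. *)

(** * Calculus on the real line *)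

Section Derivatives.
Context {R : realType}.
Implicit Types (f g : R -> R) (x a b : R).

Lemma der_eq f x a b : is_derive x 1 f a -> a = b -> is_derive x 1 f b.
Proof. by move=> + <-. Qed.

Lemma der_cst a x : is_derive x 1 (fun=> a) 0.
Proof. exact: is_derive_cst. Qed.

Lemma der_id x : is_derive x 1 (fun y : R => y) 1.
Proof. exact: is_derive_id. Qed.

Lemma derD f g x a b : is_derive x 1 f a -> is_derive x 1 g b ->
  is_derive x 1 (fun y => f y + g y) (a + b).
Proof. by move=> fa gb; exact: is_deriveD. Qed.

Lemma derN f x a : is_derive x 1 f a -> is_derive x 1 (fun y => - f y) (- a).
Proof. by move=> fa; exact: is_deriveN. Qed.

Lemma derB f g x a b : is_derive x 1 f a -> is_derive x 1 g b ->
  is_derive x 1 (fun y => f y - g y) (a - b).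
Proof. by move=> fa gb; exact: is_deriveB. Qed.

Lemma derM f g x a b : is_derive x 1 f a -> is_derive x 1 g b ->
  is_derive x 1 (fun y => f y * g y) (a * g x + f x * b).
Proof.
move=> fa gb; apply: der_eq (is_deriveM fa gb) _.
by rewrite /GRing.scale/= addrC (mulrC (g x)).
Qed.

Lemma derZ c f x a : is_derive x 1 f a -> is_derive x 1 (fun y => c * f y) (c * a).
Proof.
by move=> fa; apply: der_eq (derM (der_cst c x) fa) _; rewrite mul0r add0r.
Qed.

Lemma der_sum n (F : 'I_n -> R -> R) (dF : 'I_n -> R) x :
  (forall i, is_derive x 1 (F i) (dF i)) ->
  is_derive x 1 (fun y => \sum_i F i y) (\sum_i dF i).
Proof.
move=> H; have := is_derive_sum H.
suff -> : (\sum_i F i) = (fun y => \sum_i F i y) by [].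
by apply/funext => y; rewrite fct_sumE.
Qed.

Lemma der_comp f g x a b : is_derive (g x) 1 f a -> is_derive x 1 g b ->
  is_derive x 1 (fun y => f (g y)) (a * b).
Proof. by move=> fa gb; exact: is_derive1_comp. Qed.

Lemma der_expR c x : is_derive x 1 (fun y => expR (c * y)) (c * expR (c * x)).
Proof.
have h := derZ c (der_id x).
by apply: der_eq (der_comp (is_derive_expR (c * x)) h) _; rewrite mulr1 mulrC.
Qed.

Lemma der_continuous f x a : is_derive x 1 f a -> {for x, continuous f}.
Proof.
by move=> [fx _]; apply: differentiable_continuous; exact/derivable1_diffP.
Qed.

Lemma der_near f g x a : is_derive x 1 f a -> (\near x, f x = g x) ->
  is_derive x 1 g a.
Proof. by move=> fa fg; apply: near_eq_is_derive fa => //; rewrite oner_eq0. Qed.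

Lemma der_unique f x a b : is_derive x 1 f a -> is_derive x 1 f b -> a = b.
Proof. by move=> fa fb; rewrite -(@derive_val _ _ _ _ _ _ _ fa) (@derive_val _ _ _ _ _ _ _ fb). Qed.

Lemma der1E f x a : is_derive x 1 f a -> derive1 f x = a.
Proof. by move=> fa; rewrite derive1E (@derive_val _ _ _ _ _ _ _ fa). Qed.

Lemma derivable_der f x : derivable f x 1 -> is_derive x 1 f (derive1 f x).
Proof. by move=> fx; rewrite derive1E; exact: derivableP. Qed.

Lemma der_within f f' p q : (forall x, p <= x <= q -> is_derive x 1 f (f' x)) ->
  {within `[p, q], continuous f}.
Proof.
move=> h; apply: derivable_within_continuous => x; rewrite in_itv/= => /h [].
by [].
Qed.

Lemma ndecr_der f f' p q : p <= q ->
  (forall x, p <= x <= q -> is_derive x 1 f (f' x)) ->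
  (forall x, p <= x <= q -> 0 <= f' x) -> f p <= f q.
Proof.
move=> pq df f'0.
have df' x : x \in `]p, q[%R -> is_derive x 1 f (f' x).
  by rewrite in_itv/= => /andP[/ltW px /ltW xq]; apply: df; rewrite px xq.
have [c] := MVT_segment pq df' (der_within df).
rewrite in_itv/= => /f'0 h E; rewrite -subr_ge0 E mulr_ge0// subr_ge0//.
Qed.

Lemma eq_der0 f f' p q : p <= q ->
  (forall x, p <= x <= q -> is_derive x 1 f (f' x)) ->
  (forall x, p <= x <= q -> f' x = 0) -> f p = f q.
Proof.
move=> pq df f'0; apply/le_anti/andP; split.
  by apply: (ndecr_der pq df) => x /f'0 ->.
rewrite -lerN2; apply: (ndecr_der pq (f := fun y => - f y) (f' := fun y => - f' y)).
  by move=> x /df; exact: derN.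
by move=> x /f'0 ->; rewrite oppr0.
Qed.

Lemma nincr_der f f' p q : p <= q ->
  (forall x, p <= x <= q -> is_derive x 1 f (f' x)) ->
  (forall x, p <= x <= q -> f' x <= 0) -> f q <= f p.
Proof.
move=> pq df f'0; rewrite -lerN2.
apply: (ndecr_der pq (f := fun y => - f y) (f' := fun y => - f' y)).
  by move=> x /df; exact: derN.
by move=> x /f'0; rewrite oppr_ge0.
Qed.

End Derivatives.

Section Primitives.
Context {R : realType}.
Implicit Types (f g F : R -> R) (x a b : R).
Local Notation leb := (@lebesgue_measure R).

Lemma continuous_integrable_seg f p q : continuous f ->
  leb.-integrable `[p, q] (EFin \o f).
Proof.
move=> cf; apply: continuous_compact_integrable; first exact: segment_compact.
exact: continuous_subspaceT.
Qed.

Lemma primitive_right f p : continuous f ->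
  exists F, forall x, p < x -> is_derive x 1 F (f x).
Proof.
move=> cf; exists (fun x => \int[leb]_(t in `[p, x]) f t) => x px.
have [dF <-] := @continuous_FTC1_closed R f p x (x + 1) (ltac:(by rewrite ltrDl))
  (continuous_integrable_seg _ _ cf) px (cf x).
by rewrite derive1E; exact: derivableP.
Qed.

(* Two one-sided primitives, one of them of [y |-> - f (- y)], agree up to a constant near 0. *)
Lemma primitive_ex f x0 : continuous f ->
  exists F, F x0 = 0 /\ forall x, is_derive x 1 F (f x).
Proof.
move=> cf.
have [F1 dF1] := primitive_right (x0 - 1) cf.
have [|F2 dF2] := @primitive_right (fun y => - f (- y)) (- x0 - 1).
  move=> y; apply: continuousN; apply: (@continuous_comp _ _ _ -%R f).
    exact: opp_continuous.
  exact: cf.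
have dG x : x < x0 + 1 -> is_derive x 1 (fun y => F2 (- y)) (f x).
  move=> xx0; have h : - x0 - 1 < - x by lra.
  apply: der_eq (der_comp (dF2 _ h) (derN (der_id x))) _.
  by rewrite opprK mulrN1 opprK.
pose F x := if x < x0 + 2^-1 then F2 (- x) - F2 (- x0) else F1 x - F1 x0.
have eqF x : x0 - 1 < x < x0 + 1 -> F1 x - F1 x0 = F2 (- x) - F2 (- x0).
  move=> /andP[h1 h2].
  have E : forall p q, x0 - 1 < p -> p <= q -> q < x0 + 1 -> F1 p - F2 (- p) = F1 q - F2 (- q).
    move=> p q h3 pq h4; apply: (@eq_der0 _ (fun y => F1 y - F2 (- y)) (fun y => f y - f y) _ _ pq).
      move=> y /andP[py yq]; apply: derB; first by apply: dF1; lra.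
      by apply: dG; lra.
    by move=> y _; rewrite subrr.
  have [xx|xx] := leP x x0.
    have := E x x0 h1 xx ltac:(lra); lra.
  have := E x0 x ltac:(lra) (ltW xx) h2; lra.
exists F; split; first by rewrite /F ltrDl invr_gt0 ltr0n subrr.
move=> x; have [xx|xx] := ltP x (x0 + 3^-1).
  have : is_derive x 1 (fun y => F2 (- y) - F2 (- x0)) (f x - 0).
    by apply: derB; apply: dG; lra.
  rewrite subr0 => /der_near; apply; near=> y; rewrite /F ifT//.
  have : y < x0 + 3^-1 by near: y; exact: lt_nbhsl.
  lra.
have : is_derive x 1 (fun y => F1 y - F1 x0) (f x - 0).
  by apply: derB; apply: dF1; lra.
rewrite subr0 => /der_near; apply; near=> y; rewrite /F; case: ifPn => // h.
apply: eqF; apply/andP; split; last lra.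
have : x0 < y by near: y; apply: lt_nbhsr; lra.
lra.
Unshelve. all: by end_near. Qed.

End Primitives.

Section Primitive.
Context {R : realType}.
Implicit Types f g : R -> R.

(** A primitive differentiable on the whole line, at [x0] and on both sides of it, so that solutions
    of differential equations can start at an interior point. *)
Definition prim (x0 : R) f : R -> R :=
  if pselect (continuous f) is left cf then projT1 (cid (primitive_ex x0 cf)) else f.

Lemma prim0 (x0 : R) f : continuous f -> prim x0 f x0 = 0.
Proof. by move=> cf; rewrite /prim; case: pselect => // c; case: cid => F []. Qed.

Lemma der_prim (x0 : R) f (x : R) : continuous f -> is_derive x 1 (prim x0 f) (f x).
Proof. by move=> cf; rewrite /prim; case: pselect => // c; case: cid => F []. Qed.

Lemma prim_continuous (x0 : R) f : continuous f -> continuous (prim x0 f).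
Proof. by move=> cf x; apply: der_continuous (der_prim x0 x cf). Qed.

End Primitive.

Section ContinuousFun.
Context {R : realType}.
Implicit Types f g : R -> R.

Lemma ctD f g : continuous f -> continuous g -> continuous (fun x => f x + g x).
Proof. by move=> cf cg x; apply: cvgD; [exact: cf|exact: cg]. Qed.

Lemma ctB f g : continuous f -> continuous g -> continuous (fun x => f x - g x).
Proof. by move=> cf cg x; apply: cvgB; [exact: cf|exact: cg]. Qed.

Lemma ctM f g : continuous f -> continuous g -> continuous (fun x => f x * g x).
Proof. by move=> cf cg x; apply: cvgM; [exact: cf|exact: cg]. Qed.

Lemma ct_cst (c : R) : continuous (fun _ : R => c).
Proof. by move=> x; exact: cvg_cst. Qed.

Lemma ct_sum n (F : 'I_n -> R -> R) : (forall i, continuous (F i)) ->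
  continuous (fun x => \sum_i F i x).
Proof.
move=> cF; elim: n F cF => [F _|n IH F cF].
  by move=> x; under eq_fun do rewrite big_ord0; exact: cvg_cst.
under eq_fun do rewrite big_ord_recl.
by apply: ctD => //; apply: IH.
Qed.

Lemma ctX f n : continuous f -> continuous (fun x => f x ^+ n).
Proof.
move=> cf; elim: n => [|n IH]; first exact: ct_cst.
by under eq_fun do rewrite exprS; exact: ctM.
Qed.

End ContinuousFun.

(** * Linear differential systems *)

Section LinearODE.
Context {R : realType}.

Lemma pow2_arbitrarily_small (C e : R) : 0 < e -> exists m, C * 2^-1 ^+ m <= e.
Proof.
move=> e0; have := truncnS_gt (C / e); move: (_.+1) => m h; exists m.
rewrite exprVn ler_pdivrMr ?exprn_gt0//.
rewrite ltr_pdivrMr// in h; apply: (le_trans (ltW h)); rewrite mulrC ler_pM2l//.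
by rewrite -natrX ler_nat ltnW// ltn_expl.
Qed.

(** The intervals of radius [2 * C * 2^-1 ^+ n] around [u n] are nested, so the supremum of their
    left ends belongs to all of them. The explicit rate gives locally uniform convergence of the
    Picard iterates. *)
Lemma geometric_limit (u : nat -> R) (C : R) :
  (forall n, `|u n.+1 - u n| <= C * 2^-1 ^+ n) ->
  exists l, forall n, `|l - u n| <= 2 * C * 2^-1 ^+ n.
Proof.
move=> hu.
pose lo n := u n - 2 * C * 2^-1 ^+ n; pose hi n := u n + 2 * C * 2^-1 ^+ n.
have loS n : lo n <= lo n.+1.
  by have := hu n; rewrite /lo ler_norml exprS => /andP[h _]; lra.
have hiS n : hi n.+1 <= hi n.
  by have := hu n; rewrite /hi ler_norml exprS => /andP[_ h]; lra.
have lohi n m : lo n <= hi m.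
  have C0 p : 0 <= C * 2^-1 ^+ p by exact: le_trans (hu p).
  have l1 : lo n <= lo (maxn n m).
    by have /nondecreasing_seqP := loS; apply; exact: leq_maxl.
  have h1 : hi (maxn n m) <= hi m.
    by have /nonincreasing_seqP := hiS; apply; exact: leq_maxr.
  apply: le_trans l1 (le_trans _ h1); have := C0 (maxn n m); rewrite /lo /hi; lra.
exists (sup (range lo)) => n; rewrite ler_norml.
have h1 : lo n <= sup (range lo).
  apply: ub_le_sup; last by exists n.
  by exists (hi 0) => _ [p _ <-].
have h2 : sup (range lo) <= hi n.
  by apply: ge_sup; [exists (lo 0); exists 0%N|move=> _ [p _ <-]].
by move: h1 h2; rewrite /lo /hi => h1 h2; apply/andP; split; lra.
Qed.

(** Integration gains a factor [kap^-1] in the norm weighted by exp(kap |x - x0|). With such a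
    weight Picard iteration contracts on the whole line at once, without gluing local solutions. *)
Lemma primitive_exp_bound (kap d x0 : R) (f F : R -> R) :
  (forall x : R, is_derive x 1 F (f x)) -> F x0 = 0 ->
  0 <= d -> 0 < kap ->
  (forall t, `|f t| <= kap * d * expR (kap * `|t - x0|)) ->
  forall x, `|F x| <= d * expR (kap * `|x - x0|).
Proof.
move=> dF F0 d0 k0 fb x.
suff H : forall (f F : R -> R), (forall x : R, is_derive x 1 F (f x)) -> F x0 = 0 ->
   (forall t, `|f t| <= kap * d * expR (kap * `|t - x0|)) ->
   F x <= d * expR (kap * `|x - x0|).
  rewrite ler_norml lerNl; apply/andP; split; last exact: (H f).
  apply: (H (fun y => - f y) (fun y => - F y)).
  - by rewrite F0 oppr0.
  - by move=> t; rewrite normrN.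
move=> {}f {}F {}dF {}F0 {}fb.
have [xx|xx] := leP x0 x.
- pose G t := d * expR (kap * (t - x0)) - F t.
  have dG (t : R) : is_derive t 1 G (d * (kap * expR (kap * (t - x0))) - f t).
    apply: derB => //; apply: derZ.
    apply: der_eq (der_comp (is_derive_expR _) (derZ kap (derB (der_id t) (der_cst x0 t)))) _.
    by rewrite subr0 mulr1 mulrC.
  have : G x0 <= G x.
    apply: (ndecr_der xx (fun t _ => dG t)) => t /andP[tx _].
    have := fb t; rewrite ler_norml => /andP[_].
    by rewrite ger0_norm ?subr_ge0//; lra.
  rewrite /G subrr mulr0 expR0 F0 ger0_norm ?subr_ge0//; lra.
- pose G t := d * expR (kap * (x0 - t)) - F t.
  have dG (t : R) : is_derive t 1 G (- d * (kap * expR (kap * (x0 - t))) - f t).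
    apply: derB => //.
    apply: der_eq (derZ d (der_comp (is_derive_expR _) (derZ kap (derB (der_cst x0 t) (der_id t))))) _.
    by ring.
  have : G x0 <= G x.
    apply: (nincr_der (ltW xx) (fun t _ => dG t)) => t /andP[_ tx].
    have := fb t; rewrite ler_norml => /andP[+ _].
    by rewrite distrC ger0_norm ?subr_ge0//; lra.
  rewrite /G subrr mulr0 expR0 F0 distrC ger0_norm ?subr_ge0//; last exact: ltW.
  lra.
Qed.

Variables (n : nat) (A : 'I_n -> 'I_n -> R -> R) (K : R).
Hypothesis cA : forall i j, continuous (A i j).
Hypothesis bA : forall i j x, `|A i j x| <= K.

Lemma lin_comb_bound (y : 'I_n -> R) (M : R) i x : (forall j, `|y j| <= M) ->
  `|\sum_j A i j x * y j| <= n%:R * K * M.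
Proof.
move=> yM; apply: le_trans (ler_norm_sum _ _ _) _.
have -> : n%:R * K * M = \sum_(j < n) K * M.
  by rewrite sumr_const card_ord -[RHS]mulr_natl mulrA.
by apply: ler_sum => j _; rewrite normrM ler_pM.
Qed.

Lemma lin_ode_ex (b : 'I_n -> R -> R) (B x0 : R) (y0 : 'I_n -> R) :
  (forall i, continuous (b i)) -> (forall i x, `|b i x| <= B) ->
  exists Y : 'I_n -> R -> R, (forall i, Y i x0 = y0 i) /\
    forall (i : 'I_n) (x : R), is_derive x 1 (Y i) (\sum_j A i j x * Y j x + b i x).
Proof.
move=> cb bb.
have [n0|n1] := posnP n.
  by exists (fun i _ => 0); split; move=> i; exfalso; move: i; rewrite n0 => -[].
pose i0 : 'I_n := Ordinal n1.
have K0 : 0 <= K by exact: le_trans (bA i0 i0 0).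
have B0 : 0 <= B by exact: le_trans (bb i0 0).
pose rhs (Y : 'I_n -> R -> R) i t := \sum_j A i j t * Y j t + b i t.
pose U := fix U m := if m is m'.+1 then
    fun i t => y0 i + prim x0 (rhs (U m') i) t else fun i (_ : R) => y0 i.
have crhs Y : (forall i, continuous (Y i)) -> forall i, continuous (rhs Y i).
  by move=> cY i; apply: ctD => //; apply: ct_sum => j; exact: ctM.
have cU m : forall i, continuous (U m i).
  elim: m => [i|m IH i]; first exact: ct_cst.
  by apply: ctD; [exact: ct_cst|apply: prim_continuous; exact: crhs].
(* The rate exceeds twice the Lipschitz constant [n%:R * K], so every Picard step at least halves
   the weighted distance. *)
pose kap : R := 2 * (n%:R * K + 1).
have nK : 0 <= n%:R * K by rewrite mulr_ge0.
have kap0 : 0 < kap by rewrite /kap; lra.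
pose M := \sum_i `|y0 i|.
have M0 : 0 <= M by exact: sumr_ge0.
have yM i : `|y0 i| <= M by rewrite /M (bigD1 i)//= lerDl sumr_ge0.
have [d0 d00 d0E] : exists2 d0, 0 <= d0 & kap * d0 = n%:R * K * M + B.
  exists ((n%:R * K * M + B) / kap); last by rewrite mulrC divfK// gt_eqF.
  by rewrite divr_ge0 ?(ltW kap0)// addr_ge0// !mulr_ge0.
have E1 x : 1 <= expR (kap * `|x - x0|).
  by rewrite -expR0 ler_expR mulr_ge0// ltW.
have dU m i x : `|U m.+1 i x - U m i x| <= d0 * 2^-1 ^+ m * expR (kap * `|x - x0|).
  elim: m i x => [|m IH] i x.
    rewrite expr0 mulr1 /= addrAC subrr add0r.
    apply: (@primitive_exp_bound kap d0 x0 (rhs (U 0) i)) => //.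
    - by move=> y; apply: der_prim; exact: (crhs (U 0%N) (cU 0%N)).
    - by apply: prim0; exact: (crhs (U 0%N) (cU 0%N)).
    - move=> t; rewrite d0E.
      have h : `|rhs (U 0) i t| <= n%:R * K * M + B.
        apply: le_trans (ler_normD _ _) (lerD _ _) => //.
        exact: (lin_comb_bound i t yM).
      apply: (le_trans h); rewrite ler_peMr//.
      by rewrite addr_ge0// mulr_ge0.
  have -> : U m.+2 i x - U m.+1 i x =
      prim x0 (rhs (U m.+1) i) x - prim x0 (rhs (U m) i) x.
    by rewrite /=; ring.
  have d1 : 0 <= d0 * 2^-1 ^+ m by rewrite mulr_ge0// exprn_ge0// invr_ge0.
  apply: (@primitive_exp_bound kap (d0 * 2^-1 ^+ m.+1) x0
     (fun t => rhs (U m.+1) i t - rhs (U m) i t)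
     (fun x => prim x0 (rhs (U m.+1) i) x - prim x0 (rhs (U m) i) x)) => //.
  - by move=> t; apply: derB; apply: der_prim; exact: crhs.
  - by rewrite !prim0 ?subrr//; exact: crhs.
  - by rewrite exprSr mulrA mulr_ge0// invr_ge0.
  - move=> t; have -> : rhs (U m.+1) i t - rhs (U m) i t =
        \sum_j A i j t * (U m.+1 j t - U m j t).
      rewrite /rhs opprD addrACA subrr addr0 -sumrB.
      by apply: eq_bigr => j _; rewrite mulrBr.
    apply: le_trans (lin_comb_bound i t (fun j => IH j t)) _.
    rewrite exprSr (mulrA d0) (mulrA kap) (mulrA (n%:R * K)) ler_wpM2r ?expR_ge0//.
    rewrite /kap; move: d1; move: (d0 * _) => q q0; lra.
have [Y hY] : exists Y : 'I_n -> R -> R, forall i x m,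
    `|Y i x - U m i x| <= 2 * d0 * 2^-1 ^+ m * expR (kap * `|x - x0|).
  have h i x : exists l, forall m,
      `|l - U m i x| <= 2 * d0 * 2^-1 ^+ m * expR (kap * `|x - x0|).
    have [|l hl] := @geometric_limit (fun m => U m i x) (d0 * expR (kap * `|x - x0|)).
      by move=> m; apply: (le_trans (dU m i x)); rewrite mulrAC.
    by exists l => m; apply: (le_trans (hl m)); rewrite !mulrA mulrAC.
  exists (fun i x => projT1 (cid (h i x))) => i x m; exact: (projT2 (cid (h i x))).
have cY i : continuous (Y i).
  move=> x; apply/cvgrPdist_le => e e0.
  pose W := expR (kap * (`|x - x0| + 1)).
  have [m hm] := pow2_arbitrarily_small (2 * d0 * W) (ltac:(lra) : 0 < e / 3).
  have /cvgrPdist_le/(_ (e / 3))/(_ (ltac:(lra))) := cU m i x.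
  move=> nU; near=> y.
  have hUy : `|U m i x - U m i y| <= e / 3 by near: y.
  have yx : `|x - y| < 1 by near: y; apply: cvgr_dist_lt => //; exact: cvg_id.
  have hW z : `|z - x0| <= `|x - x0| + 1 -> `|Y i z - U m i z| <= e / 3.
    move=> hz; apply: (le_trans (hY i z m)); apply: le_trans hm.
    rewrite mulrAC ler_wpM2r ?exprn_ge0 ?invr_ge0// ler_wpM2l ?(mulr_ge0 _ d00)//.
    by rewrite ler_expR ler_pM2l.
  have h1 := hW x (ltac:(lra)).
  have h2 : `|y - x0| <= `|x - x0| + 1.
    have -> : y - x0 = (x - x0) - (x - y) by ring.
    by apply: le_trans (ler_normB _ _) _; rewrite lerD2l ltW.
  have {}h2 := hW y h2.
  have -> : Y i x - Y i y = (Y i x - U m i x) + (U m i x - U m i y) - (Y i y - U m i y) by ring.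
  apply: le_trans (ler_normB _ _) _; have := ler_normD (Y i x - U m i x) (U m i x - U m i y).
  lra.
have Yeq i x : Y i x = y0 i + prim x0 (rhs Y i) x.
  apply/eqP; rewrite -subr_eq0 -normr_le0; apply/ler_addgt0Pl => e e0; rewrite addr0.
  pose W := expR (kap * `|x - x0|).
  have [m hm] := pow2_arbitrarily_small (2 * (2 * d0 * W)) e0.
  have h1 := hY i x m.+1.
  have h2 : `|prim x0 (rhs Y i) x - prim x0 (rhs (U m) i) x| <= 2 * d0 * 2^-1 ^+ m.+1 * W.
    apply: (@primitive_exp_bound kap (2 * d0 * 2^-1 ^+ m.+1) x0
     (fun t => rhs Y i t - rhs (U m) i t)
     (fun x => prim x0 (rhs Y i) x - prim x0 (rhs (U m) i) x)) => //.
    - by move=> t; apply: derB; apply: der_prim; exact: crhs.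
    - by rewrite !prim0 ?subrr//; exact: crhs.
    - by rewrite !mulr_ge0// exprn_ge0// invr_ge0.
    - move=> t; have -> : rhs Y i t - rhs (U m) i t =
          \sum_j A i j t * (Y j t - U m j t).
        rewrite /rhs opprD addrACA subrr addr0 -sumrB.
        by apply: eq_bigr => j _; rewrite mulrBr.
      apply: le_trans (lin_comb_bound i t (fun j => hY j t m)) _.
      rewrite exprSr (mulrA (2 * d0)) (mulrA kap) (mulrA (n%:R * K)) ler_wpM2r ?expR_ge0//.
      have : 0 <= 2 * d0 * 2^-1 ^+ m by rewrite !mulr_ge0// exprn_ge0// invr_ge0.
      rewrite /kap; move: (2 * d0 * _) => q q0; lra.
  have -> : Y i x - (y0 i + prim x0 (rhs Y i) x) =
     (Y i x - U m.+1 i x) - (prim x0 (rhs Y i) x - prim x0 (rhs (U m) i) x).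
    by rewrite /=; ring.
  apply: le_trans (ler_normB _ _) _; move: h1 h2 hm; rewrite -/W exprS.
  lra.
exists Y; split => [i|i x].
  by rewrite Yeq prim0 ?addr0//; exact: crhs.
have -> : Y i = fun x => y0 i + prim x0 (rhs Y i) x by apply/funext => z; exact: Yeq.
have h := derD (der_cst (y0 i) x) (der_prim x0 x (crhs _ cY i)).
by rewrite add0r in h.
Unshelve. all: by end_near. Qed.

Lemma quadratic_form_bound (y : 'I_n -> R) x :
  `|\sum_i y i * \sum_j A i j x * y j| <= n%:R * K * \sum_i y i ^+ 2.
Proof.
have h : \sum_i \sum_j (K * (y i ^+ 2 + y j ^+ 2) / 2) = n%:R * K * \sum_i y i ^+ 2.
  have -> : \sum_i \sum_j (K * (y i ^+ 2 + y j ^+ 2) / 2) =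
     K / 2 * (\sum_(i < n) \sum_(j < n) y i ^+ 2 + \sum_(i < n) \sum_(j < n) y j ^+ 2).
    rewrite -big_split/= mulr_sumr; apply: eq_bigr => i _.
    rewrite -big_split/= mulr_sumr; apply: eq_bigr => j _; ring.
  rewrite [X in _ + X]sumr_const card_ord.
  under [X in X + _]eq_bigr do rewrite sumr_const card_ord -mulr_natl.
  rewrite -mulr_sumr -[(\sum__ _) *+ n]mulr_natl; by field.
rewrite -h; apply: le_trans (ler_norm_sum _ _ _) _; apply: ler_sum => i _.
rewrite mulr_sumr; apply: le_trans (ler_norm_sum _ _ _) _; apply: ler_sum => j _.
rewrite 2!normrM mulrCA -[X in _ <= X]mulrA.
apply: ler_pM; rewrite ?mulr_ge0//.
rewrite -(real_normK (num_real (y i))) -(real_normK (num_real (y j))).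
have := sqr_ge0 (`|y i| - `|y j|); nra.
Qed.

(** [W] is the integral of |b|^2, given by its derivative. By 2 Y b <= Y^2 + b^2 the energy |Y|^2
    grows at rate at most 2 n K + 1 apart from the source, which enters through its mean square, as
    [ham_bound] requires. *)
Lemma ode_gronwall (b : 'I_n -> R -> R) (Y : 'I_n -> R -> R) (W : R -> R) (p q : R) :
  p <= q ->
  (forall (i : 'I_n) (x : R), p <= x <= q ->
     is_derive x 1 (Y i) (\sum_j A i j x * Y j x + b i x)) ->
  (forall x : R, p <= x <= q -> is_derive x 1 W (\sum_i b i x ^+ 2)) -> W p = 0 ->
  \sum_i Y i q ^+ 2 <=
    expR ((2 * (n%:R * K) + 1) * (q - p)) * (\sum_i Y i p ^+ 2 + W q).
Proof.
move=> pq dY dW W0; set kap := 2 * _ + 1.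
have [n0|n1] := posnP n.
  have hW : W q = 0.
    rewrite -W0; apply/esym/(eq_der0 pq dW) => x _.
    by apply: big1 => i _; exfalso; move: i; rewrite n0 => -[].
  rewrite hW big1 ?mulr_ge0 ?expR_ge0 ?addr_ge0 ?sumr_ge0//.
    by move=> i _; exact: sqr_ge0.
  by move=> i _; exfalso; move: i; rewrite n0 => -[].
have K0 : 0 <= K by exact: le_trans (bA (Ordinal n1) (Ordinal n1) 0).
have kap0 : 0 <= kap by rewrite /kap addr_ge0// !mulr_ge0.
pose E x := \sum_i Y i x ^+ 2.
pose dE x := \sum_i 2 * (Y i x * (\sum_j A i j x * Y j x + b i x)).
have DE (x : R) : p <= x <= q -> is_derive x 1 E (dE x).
  move=> xpq; apply: der_sum => i.
  have -> : (fun y => Y i y ^+ 2) = (fun y => Y i y * Y i y).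
    by apply/funext => y; rewrite expr2.
  by apply: der_eq (derM (dY i x xpq) (dY i x xpq)) _; ring.
have dEle x : dE x <= kap * E x + \sum_i b i x ^+ 2.
  have -> : dE x = 2 * (\sum_i Y i x * \sum_j A i j x * Y j x) + \sum_i 2 * (Y i x * b i x).
    rewrite mulr_sumr -big_split/=; apply: eq_bigr => i _; ring.
  have h1 := ler_normlW (quadratic_form_bound (Y ^~ x) x).
  have h2 : \sum_i 2 * (Y i x * b i x) <= E x + \sum_i b i x ^+ 2.
    rewrite /E -big_split/=; apply: ler_sum => i _.
    by have := sqr_ge0 (Y i x - b i x); nra.
  rewrite /kap; rewrite -/(E x) in h1; lra.
pose G x := expR (- kap * (x - p)) * E x - W x.
have dG (x : R) : p <= x <= q -> is_derive x 1 G
    (expR (- kap * (x - p)) * (dE x - kap * E x) - \sum_i b i x ^+ 2).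
  move=> xpq; apply: derB; last exact: dW.
  have h := derM (der_comp (is_derive_expR _) (derZ (- kap) (derB (der_id x) (der_cst p x)))) (DE x xpq).
  by apply: der_eq h _; ring.
have : G q <= G p.
  apply: (nincr_der pq dG) => x /andP[px _].
  have h1 : expR (- kap * (x - p)) * (dE x - kap * E x) <=
            expR (- kap * (x - p)) * \sum_i b i x ^+ 2.
    by rewrite ler_wpM2l ?expR_ge0//; have := dEle x; lra.
  have h2 : expR (- kap * (x - p)) * \sum_i b i x ^+ 2 <= \sum_i b i x ^+ 2.
    rewrite ler_piMl//; first by apply: sumr_ge0 => i _; exact: sqr_ge0.
    by rewrite expR_le1 mulNr oppr_le0 mulr_ge0// subr_ge0.
  lra.
rewrite /G subrr mulr0 expR0 mul1r W0 subr0 lerBlDr -/(E p) -/(E q) => h.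
have -> : E q = expR (kap * (q - p)) * (expR (- kap * (q - p)) * E q).
  by rewrite mulrA mulNr expRxMexpNx_1 mul1r.
by rewrite ler_wpM2l ?expR_ge0.
Qed.

(** Stated on a segment because weak eigenfunctions are known to solve the system only at negative
    points. *)
Lemma ode_unique_on (Y : 'I_n -> R -> R) (p q x0 : R) : p <= x0 <= q ->
  (forall (i : 'I_n) (x : R), p <= x <= q ->
    is_derive x 1 (Y i) (\sum_j A i j x * Y j x)) ->
  (forall i, Y i x0 = 0) -> forall i x, p <= x <= q -> Y i x = 0.
Proof.
move=> /andP[px0 x0q] dY Y0 i x /andP[px xq].
have K0 : 0 <= K by exact: le_trans (bA i i 0).
suff : \sum_i Y i x ^+ 2 <= 0.
  rewrite (bigD1 i)//= => h; apply/eqP; rewrite -sqrf_eq0 -[_ == _]andbT.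
  have h' : 0 <= \sum_(i0 < n | i0 != i) Y i0 x ^+ 2.
    by apply: sumr_ge0 => j _; exact: sqr_ge0.
  by rewrite andbT eq_le sqr_ge0 andbT; lra.
have S0 : \sum_i Y i x0 ^+ 2 = 0 by apply: big1 => j _; rewrite Y0 expr0n.
have [xx|xx] := leP x0 x.
  have := @ode_gronwall (fun _ _ => 0) Y (fun=> 0) x0 x xx.
  rewrite S0 addr0 mulr0; apply => //.
    move=> j y /andP[y1 y2]; rewrite addr0; apply: dY.
    by rewrite (le_trans px0 y1) (le_trans y2 xq).
  by move=> y _; rewrite big1 => [|j _]; [exact: der_cst|rewrite expr0n].
(* [ode_gronwall] runs forward only; to the left of [x0] the energy times exp(kap y) is
   nondecreasing and vanishes at [x0]. *)
pose kap := 2 * (n%:R * K).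
pose E x := \sum_i Y i x ^+ 2.
pose G y := expR (kap * y) * E y.
have dG (y : R) : p <= y <= q -> is_derive y 1 G
    (expR (kap * y) * (kap * E y + \sum_i 2 * (Y i y * (\sum_j A i j y * Y j y)))).
  move=> ypq.
  have DE : is_derive y 1 E (\sum_i 2 * (Y i y * (\sum_j A i j y * Y j y))).
    apply: der_sum => j.
    have -> : (fun y => Y j y ^+ 2) = (fun y => Y j y * Y j y).
      by apply/funext => z; rewrite expr2.
    by apply: der_eq (derM (dY j y ypq) (dY j y ypq)) _; ring.
  by apply: der_eq (derM (der_expR kap y) DE) _; ring.
have : G x <= G x0.
  apply: (ndecr_der (ltW xx) (f' := fun y => expR (kap * y) *
      (kap * E y + \sum_i 2 * (Y i y * (\sum_j A i j y * Y j y))))).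
    by move=> y /andP[y1 y2]; apply: dG; rewrite (le_trans px y1) (le_trans y2 x0q).
  move=> y _; rewrite mulr_ge0 ?expR_ge0// -mulr_sumr.
  have := quadratic_form_bound (Y ^~ y) y; rewrite ler_norml => /andP[h _].
  rewrite /kap /E; lra.
by rewrite /G {2}/E S0 mulr0 pmulr_rle0 ?expR_gt0.
Qed.

Lemma ode_unique (Y : 'I_n -> R -> R) (x0 : R) :
  (forall (i : 'I_n) (x : R), is_derive x 1 (Y i) (\sum_j A i j x * Y j x)) ->
  (forall i, Y i x0 = 0) -> forall i x, Y i x = 0.
Proof.
move=> dY Y0 i x.
apply: (@ode_unique_on Y (Num.min x x0) (Num.max x x0) x0) => //.
  by rewrite ge_min le_max !lexx !orbT.
by rewrite ge_min le_max !lexx.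
Qed.

End LinearODE.

(** * Smooth bumps *)

Section FlatFunctions.
Context {R : realType}.
Implicit Types (x y p q : R) (f : R -> R).

(** The classical flat function at [j = 0]; the power of the inverse is an index so that the family
    is closed under differentiation, up to linear combinations. *)
Definition flat (j : nat) (x : R) : R :=
  if 0 < x then x^-1 ^+ j * expR (- x^-1) else 0.

Lemma flat_le0 j x : x <= 0 -> flat j x = 0.
Proof. by move=> x0; rewrite /flat ltNge x0. Qed.

Lemma flat_gt0 x : 0 < x -> 0 < flat 0 x.
Proof. by move=> x0; rewrite /flat x0 expr0 mul1r expR_gt0. Qed.

Lemma flat_ge0 j x : 0 <= flat j x.
Proof.
rewrite /flat; case: ifPn => // x0.
by rewrite mulr_ge0 ?expR_ge0// exprn_ge0// invr_ge0 ltW.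
Qed.

(** From exp(1/x) >= (1/x)^(j+1) / (j+1)!. The spare power of x gives continuity at 0, hence
    differentiability there, since the difference quotient of [flat j] at 0 is [flat j.+1]. *)
Lemma flat_bound j x : `|flat j x| <= (j.+1)`!%:R * `|x|.
Proof.
rewrite ger0_norm ?flat_ge0// /flat; case: ifPn => x0; last by rewrite mulr_ge0.
rewrite (ger0_norm (ltW x0)) expRN.
have h := @expR_ge1Dxn R x^-1 j (ltac:(by rewrite invr_ge0 ltW)).
rewrite ler_pdivrMr ?expR_gt0//.
have F0 : (0 : R) < (j.+1)`!%:R by rewrite ltr0n fact_gt0.
have -> : x^-1 ^+ j = (j.+1)`!%:R * x * (x^-1 ^+ j.+1 / (j.+1)`!%:R).
  by rewrite exprS; field; rewrite !gt_eqF//.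
rewrite ler_wpM2l ?mulr_ge0 ?(ltW x0) ?(ltW F0)//; lra.
Qed.

Lemma flat_continuous0 j : {for 0, continuous (flat j)}.
Proof.
apply/(@cvgrPdist_le _ _ _ (nbhs (0 : R))) => e e0; rewrite (flat_le0 j (lexx 0)).
have F0 : (0 : R) < (j.+1)`!%:R by rewrite ltr0n fact_gt0.
apply: filterS (nbhs0_le (divr_gt0 e0 F0)) => y hy.
rewrite sub0r normrN; apply: (le_trans (flat_bound j y)).
by rewrite mulrC -ler_pdivlMr.
Qed.

Lemma der_flat j x : is_derive x 1 (flat j) (flat j.+2 x - j%:R * flat j.+1 x).
Proof.
have [x0|x0|->] := ltrgtP x 0.
- rewrite !flat_le0 ?ltW// mulr0 subr0.
  apply: (der_near (der_cst 0 x)); near=> y; rewrite flat_le0//.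
  by apply: ltW; near: y; exact: lt_nbhsl.
- have dV : is_derive x 1 (fun y : R => y^-1) (- x ^- 2).
    by apply: der_eq (is_deriveV (lt0r_neq0 x0) (der_id x)) _; rewrite /GRing.scale/= mulr1.
  have dX : is_derive x 1 (fun y : R => y^-1 ^+ j) (- j%:R * x^-1 ^+ j.+1).
    have h := @der_comp R (fun z => z ^+ j) _ _ (j%:R * x^-1 ^+ j.-1) _ _ dV.
    have h' : is_derive x^-1 1 (fun z : R => z ^+ j) (j%:R * x^-1 ^+ j.-1).
      have := @exp_derive R j x^-1 1; have := @exprn_derivable R j x^-1 1.
      move=> /derivableP h0 h1; apply: der_eq h0 _; rewrite h1.
      by rewrite /GRing.scale/= mulr1.
    apply: der_eq (h h') _; case: j {h h'} => [|j]; first by rewrite !mul0r oppr0 mul0r.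
    by rewrite /= -exprVn !exprS; ring.
  have h := derM dX (der_comp (is_derive_expR _) (derN dV)).
  have E : - j%:R * x^-1 ^+ j.+1 * expR (- x^-1) + x^-1 ^+ j * (expR (- x^-1) * - - x ^- 2) =
    flat j.+2 x - j%:R * flat j.+1 x.
    by rewrite /flat x0 opprK -exprVn !exprS; ring.
  apply: (der_near (der_eq h E)); near=> y; rewrite /flat ifT//.
  by near: y; exact: lt_nbhsr.
- rewrite !(flat_le0 _ (lexx 0)) mulr0 subr0; apply/is_derive1_caratheodory.
  exists (flat j.+1); split; last by rewrite flat_le0.
    move=> z; rewrite (flat_le0 j (lexx 0)) !subr0 /flat; case: ifPn => z0; last by rewrite mul0r.
    by rewrite exprS; field; rewrite gt_eqF.
  exact: flat_continuous0.
Unshelve. all: by end_near. Qed.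

(** Derivatives are witnesses here, so the closure properties follow by induction without computing
    an iterated derivative; [smooth_derive1n] translates back. *)
Fixpoint nsmooth (n : nat) f : Prop := if n is n'.+1 then
  exists f', (forall x : R, is_derive x 1 f (f' x)) /\ nsmooth n' f' else True.

Definition smooth f := forall n, nsmooth n f.

Lemma nsmoothW n f : nsmooth n.+1 f -> nsmooth n f.
Proof.
elim: n f => // n IH f [f' [df sf']]; exists f'; split => //.
exact: IH.
Qed.

Lemma nsmoothD n f g : nsmooth n f -> nsmooth n g -> nsmooth n (fun x => f x + g x).
Proof.
elim: n f g => // n IH f g [f' [df sf]] [g' [dg sg]].
exists (fun x => f' x + g' x); split; last exact: IH.
by move=> x; exact: derD.
Qed.

Lemma nsmoothZ n c f : nsmooth n f -> nsmooth n (fun x => c * f x).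
Proof.
elim: n f => // n IH f [f' [df sf]].
exists (fun x => c * f' x); split; last exact: IH.
by move=> x; exact: derZ.
Qed.

Lemma nsmoothM n f g : nsmooth n f -> nsmooth n g -> nsmooth n (fun x => f x * g x).
Proof.
elim: n f g => // n IH f g sf sg; case: (sf) => f' [df sf']; case: (sg) => g' [dg sg'].
exists (fun x => f' x * g x + f x * g' x); split; first by move=> x; exact: derM.
by apply: nsmoothD; apply: IH => //; exact: nsmoothW.
Qed.

Lemma nsmooth_affine n f c d : nsmooth n f -> nsmooth n (fun x => f (c * x + d)).
Proof.
elim: n f => // n IH f [f' [df sf]].
exists (fun x => c * f' (c * x + d)); split; last by apply: nsmoothZ; exact: IH.
move=> x; have h := derD (derZ c (der_id x)) (der_cst d x).
by apply: der_eq (der_comp (df _) h) _; rewrite mulr1 addr0 mulrC.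
Qed.

Lemma smooth_flat j : smooth (flat j).
Proof.
move=> n; elim: n j => // n IH j.
exists (fun x => flat j.+2 x + (- j%:R) * flat j.+1 x); split.
  by move=> x; apply: der_eq (der_flat j x) _; rewrite mulNr.
by apply: nsmoothD; [exact: IH|apply: nsmoothZ; exact: IH].
Qed.

Lemma smooth_derive1n f : smooth f -> forall n x, derivable (derive1n n f) x 1.
Proof.
move=> sf n x; elim: n f sf x => [|n IH] f sf x.
  by have [f' [df _]] := sf 1%N; have [] := df x.
rewrite derive1Sn; apply: IH => m; have [f' [df sf']] := sf m.+1.
suff -> : derive1 f = f' by [].
by apply/funext => y; exact: der1E.
Qed.

Lemma smooth_continuous f : smooth f -> continuous f.
Proof. by move=> /(_ 1%N)[f' [df _]] x; apply: der_continuous (df x). Qed.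

Definition hbump p q x := flat 0 (x - p) * flat 0 (q - x).

Lemma smooth_hbump p q : smooth (hbump p q).
Proof.
move=> n; apply: nsmoothM.
  have := nsmooth_affine 1 (- p) (@smooth_flat 0 n).
  by under eq_fun do rewrite mul1r.
have := nsmooth_affine (-1) q (@smooth_flat 0 n).
by under eq_fun do rewrite mulN1r addrC.
Qed.

Definition hbump1 p q x :=
  flat 2 (x - p) * flat 0 (q - x) - flat 0 (x - p) * flat 2 (q - x).

Definition hbump2 p q x := (flat 4 (x - p) - 2 * flat 3 (x - p)) * flat 0 (q - x)
  - 2 * (flat 2 (x - p) * flat 2 (q - x))
  + flat 0 (x - p) * (flat 4 (q - x) - 2 * flat 3 (q - x)).

Let der_flatl j p x : is_derive x 1 (fun y => flat j (y - p))
  (flat j.+2 (x - p) - j%:R * flat j.+1 (x - p)).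
Proof.
by apply: der_eq (der_comp (der_flat j _) (derB (der_id x) (der_cst p x))) _; ring.
Qed.

Let der_flatr j q x : is_derive x 1 (fun y => flat j (q - y))
  (- (flat j.+2 (q - x) - j%:R * flat j.+1 (q - x))).
Proof.
by apply: der_eq (der_comp (der_flat j _) (derB (der_cst q x) (der_id x))) _; ring.
Qed.

Lemma der_hbump p q x : is_derive x 1 (hbump p q) (hbump1 p q x).
Proof.
by apply: der_eq (derM (der_flatl 0 p x) (der_flatr 0 q x)) _; rewrite /hbump1; ring.
Qed.

Lemma der_hbump1 p q x : is_derive x 1 (hbump1 p q) (hbump2 p q x).
Proof.
apply: der_eq (derB (derM (der_flatl 2 p x) (der_flatr 0 q x))
  (derM (der_flatl 0 p x) (der_flatr 2 q x))) _; rewrite /hbump2; ring.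
Qed.

Lemma hbump2_continuous p q : continuous (hbump2 p q).
Proof.
have cl j : continuous (fun x : R => flat j (x - p)).
  by move=> x; apply: der_continuous (der_flatl j p x).
have cr j : continuous (fun x : R => flat j (q - x)).
  by move=> x; apply: der_continuous (der_flatr j q x).
apply: ctD; first apply: ctB.
- by apply: ctM => //; apply: ctB => //; apply: ctM => //; exact: ct_cst.
- by apply: ctM; [exact: ct_cst|exact: ctM].
- by apply: ctM => //; apply: ctB => //; apply: ctM => //; exact: ct_cst.
Qed.

Lemma hbump_gt0 p q x : p < x < q -> 0 < hbump p q x.
Proof. by move=> /andP[px xq]; rewrite mulr_gt0// flat_gt0// subr_gt0. Qed.

Lemma hbump_ge0 p q x : 0 <= hbump p q x.
Proof. by rewrite mulr_ge0// flat_ge0. Qed.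

Lemma hbump_out p q x : x <= p \/ q <= x -> hbump p q x = 0 /\ hbump1 p q x = 0.
Proof.
case=> h; [have {}h : x - p <= 0 by rewrite subr_le0|have {}h : q - x <= 0 by rewrite subr_le0];
by rewrite /hbump /hbump1 !(flat_le0 _ h) ?(mulr0,mul0r,subrr).
Qed.

End FlatFunctions.

(** * Integrals over a segment *)

Section Integral.
Context {R : realType}.
Variables (p q : R).
Hypothesis pq : p <= q.
Implicit Types f g F : R -> R.

(** An increment of a primitive: its properties then follow from monotonicity arguments alone.
    [Rint_seg] identifies it with the Lebesgue integral where weak derivatives require it. *)
Definition itg (p q : R) f : R := prim p f q.

Lemma itg_FTC f F : continuous f ->
  (forall x : R, p <= x <= q -> is_derive x 1 F (f x)) -> itg p q f = F q - F p.
Proof.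
move=> cf dF.
have : prim p f p - F p = prim p f q - F q.
  apply: (eq_der0 pq (f := fun x => prim p f x - F x) (f' := fun x => f x - f x)).
    by move=> x xpq; apply: derB; [exact: der_prim|exact: dF].
  by move=> x _; rewrite subrr.
rewrite /itg prim0// => h; lra.
Qed.

Lemma itg_ge0 f : continuous f -> (forall x, p <= x <= q -> 0 <= f x) -> 0 <= itg p q f.
Proof.
move=> cf f0; rewrite /itg -(prim0 p cf).
by apply: (ndecr_der pq (f' := f)) => // x _; exact: der_prim.
Qed.

Lemma itg_lin2 f g h (c d : R) : continuous f -> continuous g -> continuous h ->
  (forall x, p <= x <= q -> h x = c * f x + d * g x) ->
  itg p q h = c * itg p q f + d * itg p q g.
Proof.
move=> cf cg ch E.
have dF (x : R) : p <= x <= q ->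
    is_derive x 1 (fun x => c * prim p f x + d * prim p g x) (h x).
  by move=> /E ->; apply: derD; apply: derZ; exact: der_prim.
by have -> := itg_FTC ch dF; rewrite !prim0// !mulr0 addr0 subr0.
Qed.

Lemma itgZ c f : continuous f -> itg p q (fun x => c * f x) = c * itg p q f.
Proof.
move=> cf; rewrite (@itg_lin2 f f _ c 0)// ?mul0r ?addr0//.
  by apply: ctM => //; exact: ct_cst.
by move=> x _; rewrite mul0r addr0.
Qed.

Lemma itg_lin3 f g h k (b c d : R) : continuous f -> continuous g -> continuous h ->
  continuous k ->
  (forall x, p <= x <= q -> k x = b * f x + c * g x + d * h x) ->
  itg p q k = b * itg p q f + c * itg p q g + d * itg p q h.
Proof.
move=> cf cg ch ck E.
rewrite (@itg_lin2 (fun x => b * f x + c * g x) h k 1 d)//.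
- by rewrite mul1r (@itg_lin2 f g _ b c)//; apply: ctD; apply: ctM => //; exact: ct_cst.
- by apply: ctD; apply: ctM => //; exact: ct_cst.
- by move=> x /E ->; rewrite mul1r.
Qed.

Lemma eq_itg f g : continuous f -> continuous g ->
  (forall x, p <= x <= q -> f x = g x) -> itg p q f = itg p q g.
Proof.
move=> cf cg E; rewrite (@itg_lin2 g g f 1 0)// ?mul1r ?mul0r ?addr0//.
by move=> x /E ->; rewrite mul1r mul0r addr0.
Qed.

Lemma le_itg f g : continuous f -> continuous g ->
  (forall x, p <= x <= q -> f x <= g x) -> itg p q f <= itg p q g.
Proof.
move=> cf cg fg; rewrite -subr_ge0.
have -> : itg p q g - itg p q f = itg p q (fun x => g x - f x).
  have h := @itg_lin2 g f (fun x => g x - f x) 1 (-1) cg cf (ctB cg cf).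
  rewrite h ?mul1r ?mulN1r// => x _; by rewrite mul1r mulN1r.
by apply: itg_ge0; [exact: ctB|move=> x /fg; rewrite subr_ge0].
Qed.

Lemma itg_sum n (F : 'I_n -> R -> R) : (forall i, continuous (F i)) ->
  itg p q (fun x => \sum_i F i x) = \sum_i itg p q (F i).
Proof.
move=> cF; have cS : continuous (fun x => \sum_i F i x) by exact: ct_sum.
have dF (x : R) : p <= x <= q ->
    is_derive x 1 (fun x => \sum_i prim p (F i) x) (\sum_i F i x).
  by move=> _; apply: der_sum => i; exact: der_prim.
have -> := itg_FTC cS dF.
by rewrite -sumrB; apply: eq_bigr => i _; rewrite prim0// subr0.
Qed.

Lemma itg_gt0 f x0 : p < q -> continuous f -> (forall x, p <= x <= q -> 0 <= f x) ->
  p <= x0 <= q -> 0 < f x0 -> 0 < itg p q f.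
Proof.
move=> plq cf f0 x0pq fx0.
have /cvgrPdist_le/(_ (f x0 / 2) (ltac:(lra)))/nbhs_ballP[e /= e0 he] := cf x0.
have {}he y : `|x0 - y| < e -> f x0 / 2 <= f y.
  by move=> /he /=; rewrite ler_norml; lra.
pose x1 := Num.max p (x0 - e / 2); pose x2 := Num.min q (x0 + e / 2).
move/andP: x0pq => [px0 x0q].
have e20 : 0 < e / 2 by rewrite divr_gt0.
have p1 : p <= x1 by rewrite /x1 le_max lexx.
have q2 : x2 <= q by rewrite /x2 ge_min lexx.
have x1x0 : x1 <= x0 by rewrite /x1 ge_max px0/=; lra.
have x0x2 : x0 <= x2 by rewrite /x2 le_min x0q/=; lra.
have x12 : x1 < x2.
  rewrite /x1 /x2 lt_min !gt_max plq /=; apply/andP; split; first lra.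
  apply/andP; split; lra.
have l1 : x0 - e / 2 <= x1 by rewrite /x1 le_max lexx orbT.
have l2 : x2 <= x0 + e / 2 by rewrite /x2 ge_min lexx orbT.
have h1 : prim p f p <= prim p f x1.
  apply: (ndecr_der p1 (f' := f)); first by move=> x _; exact: der_prim.
  by move=> x /andP[? ?]; apply: f0; apply/andP; split=> //; lra.
have h2 : prim p f x2 <= prim p f q.
  apply: (ndecr_der q2 (f' := f)); first by move=> x _; exact: der_prim.
  by move=> x /andP[? ?]; apply: f0; apply/andP; split=> //; lra.
have h3 : prim p f x1 - f x0 / 2 * x1 <= prim p f x2 - f x0 / 2 * x2.
  apply: (ndecr_der (ltW x12) (f := fun x => prim p f x - f x0 / 2 * x)
     (f' := fun x => f x - f x0 / 2 * 1)).
    by move=> x _; apply: derB; exact: der_prim.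
  move=> x /andP[h h']; rewrite mulr1 subr_ge0; apply: he.
  by rewrite ltr_norml; apply/andP; split; lra.
move: h1; rewrite prim0// => h1.
have : 0 < f x0 / 2 * (x2 - x1) by rewrite mulr_gt0 ?subr_gt0//; lra.
rewrite /itg; lra.
Qed.

End Integral.

(** * The energy of the decaying half-line solutions *)

Section Quadratic.
Context {R : realType}.
Variables (k : R).
Hypothesis k0 : 0 < k.
Implicit Types m y z : R.

(* Polar form of the energy of the decaying solution of the constant
   coefficient equation on (-oo, -a], up to the factor lambda mu. *)
Definition halfline_form (m y z y' z' : R) : R :=
  k * m * (m + k) * (y * y') - k * (m - k) * (y * z' + z * y') + (m + k) * (z * z').

Lemma halfline_form_ge0 m y z : k <= m -> 0 <= halfline_form m y z y z.
Proof.
move=> km; have -> : halfline_form m y z y z =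
  (m - k) * (z - k * y) ^+ 2 + k * (m ^+ 2 + k ^+ 2) * y ^+ 2 + 2 * k * z ^+ 2.
  by rewrite /halfline_form; ring.
have h1 : 0 <= (m - k) * (z - k * y) ^+ 2 by rewrite mulr_ge0 ?subr_ge0 ?sqr_ge0.
have h2 : 0 <= k * (m ^+ 2 + k ^+ 2) * y ^+ 2.
  by rewrite mulr_ge0 ?sqr_ge0// mulr_ge0 ?(ltW k0)// addr_ge0 ?sqr_ge0.
have h3 : 0 <= 2 * k * z ^+ 2 by rewrite mulr_ge0 ?sqr_ge0// mulr_ge0 ?(ltW k0).
lra.
Qed.

Lemma halfline_form_le (m1 m2 y z : R) : k <= m1 -> m1 <= m2 ->
  halfline_form m1 y z y z <= halfline_form m2 y z y z.
Proof.
have kk := k0; move=> km1 m12; rewrite -subr_ge0.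
have -> : halfline_form m2 y z y z - halfline_form m1 y z y z =
  (m2 - m1) * ((z - k * y) ^+ 2 + k * (m1 + m2) * y ^+ 2).
  by rewrite /halfline_form; ring.
have h : 0 <= k * (m1 + m2) * y ^+ 2.
  apply: mulr_ge0; last exact: sqr_ge0.
  apply: mulr_ge0; lra.
apply: mulr_ge0; rewrite ?subr_ge0//.
by have := sqr_ge0 (z - k * y); lra.
Qed.

(** The energy grows at most like m^2. As the square of the decay rate is affine in the parameter,
    this becomes the growth bound needed for [Pform_scale]. *)
Lemma halfline_form_scale (m1 m2 y z : R) : k <= m1 -> m1 <= m2 ->
  m1 ^+ 2 * halfline_form m2 y z y z <= m2 ^+ 2 * halfline_form m1 y z y z.
Proof.
have kk := k0; move=> km1 m12; rewrite -subr_ge0.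
pose X : R := m1 * m2; pose T : R := k * (m1 + m2).
have -> : m2 ^+ 2 * halfline_form m1 y z y z - m1 ^+ 2 * halfline_form m2 y z y z =
  (m2 - m1) * (X * (k * y) ^+ 2 - 2 * (X - T) * ((k * y) * z) + (X + T) * z ^+ 2).
  by rewrite /halfline_form /X /T; ring.
have X0 : 0 < X by apply: mulr_gt0; lra.
have T0 : 0 < T by apply: mulr_gt0; lra.
have TX : T <= 2 * X.
  have h1 : k * m1 <= m2 * m1 by rewrite ler_wpM2r//; lra.
  have h2 : k * m2 <= m1 * m2 by rewrite ler_wpM2r//; lra.
  by rewrite /T /X; nra.
rewrite mulr_ge0 ?subr_ge0//; move: (k * y) => w.
(* Multiplication by the coefficient of z^2 completes the square; the remainder is T (3 X - T) w^2,
   nonnegative because T <= 2 X. *)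
rewrite -(pmulr_rge0 _ (addr_gt0 X0 T0)).
have -> : (X + T) * (X * w ^+ 2 - 2 * (X - T) * (w * z) + (X + T) * z ^+ 2) =
   ((X + T) * z - (X - T) * w) ^+ 2 + T * (3 * X - T) * w ^+ 2 by ring.
have h : 0 <= T * (3 * X - T) * w ^+ 2.
  apply: mulr_ge0; last exact: sqr_ge0.
  apply: mulr_ge0; first exact: ltW.
  rewrite subr_ge0; apply: (le_trans TX); rewrite ler_pM2r//; lra.
by have := sqr_ge0 ((X + T) * z - (X - T) * w); lra.
Qed.

End Quadratic.

(** * Enumeration of a set that can be listed downwards *)

Section Enumeration.
Context {R : realType}.

(** Every nonempty part of [S] has a greatest element, namely one that minimises [nu], so [S] can be
    listed from the top. An element below the whole list would have an index exceeding every
    [nu (lam n) >= n]. *)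
Lemma decreasing_enumeration (S : R -> Prop) (nu : R -> nat) :
  (forall x, S x -> 0 < x) ->
  (forall x y, S x -> S y -> x < y -> (nu y < nu x)%N) ->
  (forall d, 0 < d -> exists2 x, S x & x < d) ->
  exists lam : nat -> R, [/\ forall n, 0 < lam n, forall n, lam n.+1 < lam n,
    lam @ \oo --> (0 : R) & forall x, S x <-> exists n, x = lam n].
Proof.
move=> S0 Snu Ssmall.
have maxS (P : R -> Prop) : (exists2 x, S x & P x) ->
    exists2 x, S x /\ P x & forall y, S y -> P y -> y <= x.
  move=> [x Sx Px].
  have ex : exists n, `[< exists2 x, S x /\ P x & nu x = n >].
    by exists (nu x); apply/asboolP; exists x.
  case: (ex_minnP ex) => n /asboolP[z [Sz Pz] <-] zmin; exists z => // y Sy Py.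
  rewrite leNgt; apply/negP => zy.
  have := zmin (nu y) (ltac:(by apply/asboolP; exists y)).
  by rewrite leqNgt Snu.
have next l : 0 < l -> exists2 x, S x /\ x < l & forall y, S y -> y < l -> y <= x.
  by move=> l0; apply: maxS; have [x Sx xl] := Ssmall _ l0; exists x.
have [l0 [Sl0 _] l0max] := maxS (fun=> True)
  (ltac:(have [x Sx _] := Ssmall 1 ltr01; by exists x)).
pose nx l := if pselect (0 < l) is left h then projT1 (cid2 (next l h)) else l.
have nxP l : 0 < l -> [/\ S (nx l), nx l < l & forall y, S y -> y < l -> y <= nx l].
  by move=> h; rewrite /nx; case: pselect => // h'; case: cid2 => x [].
pose lam := fix lam n := if n is n'.+1 then nx (lam n') else l0.
have Slam n : S (lam n).
  elim: n => [//|n IH]; by have [] := nxP _ (S0 _ IH).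
have lamS n : lam n.+1 < lam n by have [] := nxP _ (S0 _ (Slam n)).
have enum x : S x -> exists n, x = lam n.
  move=> Sx; apply: contrapT => nex.
  have xl n : x < lam n.
    elim: n => [|n IH]; rewrite lt_neqAle; apply/andP; split.
    - by apply/eqP => E; apply: nex; exists 0%N.
    - exact: l0max.
    - by apply/eqP => E; apply: nex; exists n.+1.
    - by have [_ _] := nxP _ (S0 _ (Slam n)); exact.
  have nul n : (n <= nu (lam n))%N.
    by elim: n => // n IH; apply: (leq_ltn_trans IH); exact: Snu.
  by have := leq_ltn_trans (nul (nu x)) (Snu _ _ Sx (Slam _) (xl _)); rewrite ltnn.
exists lam; split => //.
- by move=> n; exact: S0.
- apply/cvgrPdist_lt => e e0; have [x Sx xe] := Ssmall _ e0; have [n xn] := enum _ Sx.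
  exists n => // m /= nm; rewrite sub0r normrN gtr0_norm ?S0//.
  apply: le_lt_trans xe; rewrite xn.
  by have /nonincreasing_seqP := (fun n => ltW (lamS n)); exact.
- by move=> x; split; [exact: enum|move=> [n ->]].
Qed.

End Enumeration.

Section Jets.
Context {R : realType}.

(** A C^2 function carried together with its derivatives: linear combinations are taken
    componentwise, and the forms read off second derivatives directly. *)
Definition jet (u : nat -> R -> R) : Prop :=
  [/\ forall x : R, is_derive x 1 (u 0%N) (u 1%N x),
      forall x : R, is_derive x 1 (u 1%N) (u 2%N x) & continuous (u 2%N)].

Definition lc (u : nat -> R -> R) (e : R) (v : nat -> R -> R) : nat -> R -> R :=
  fun j x => u j x + e * v j x.

Definition comb n (F : 'I_n -> nat -> R -> R) (c : 'I_n -> R) : nat -> R -> R :=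
  fun j x => \sum_i c i * F i j x.

Lemma jet_lc u e v : jet u -> jet v -> jet (lc u e v).
Proof.
move=> [u0 u1 u2] [v0 v1 v2]; split.
- by move=> x; apply: derD => //; exact: derZ.
- by move=> x; apply: derD => //; exact: derZ.
- by apply: ctD => //; apply: ctM => //; exact: ct_cst.
Qed.

Lemma jet_comb n (F : 'I_n -> nat -> R -> R) c : (forall i, jet (F i)) -> jet (comb F c).
Proof.
move=> jF; split.
- by move=> x; apply: der_sum => i; apply: derZ; have [] := jF i.
- by move=> x; apply: der_sum => i; apply: derZ; have [] := jF i.
- by apply: ct_sum => i; apply: ctM; [exact: ct_cst|have [] := jF i].
Qed.

Lemma jet0_continuous u : jet u -> continuous (u 0%N).
Proof. by move=> [u0 _ _] x; exact: der_continuous (u0 x). Qed.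

Lemma jet1_continuous u : jet u -> continuous (u 1%N).
Proof. by move=> [_ u1 _] x; exact: der_continuous (u1 x). Qed.

Lemma jet2_continuous u : jet u -> continuous (u 2%N).
Proof. by case. Qed.

End Jets.

(** * Quadratic forms and their index *)

Section Forms.
Context {R : realType}.
Variables (a g mu k rm rp S : R) (r s : R -> R).
Hypotheses (a_gt0 : 0 < a) (g_gt0 : 0 < g) (mu_gt0 : 0 < mu) (k_gt0 : 0 < k)
  (rm_gt0 : 0 < rm) (cr : continuous r) (cs : continuous s)
  (r_ge : forall x, rm <= r x) (r_le : forall x, r x <= rp)
  (s_ge0 : forall x, 0 <= s x) (s_le : forall x, s x <= S).
Local Notation I := (itg (- a) 0).
Implicit Types (u v w : nat -> R -> R) (lam e : R).

Let na0 : - a <= 0. Proof. by rewrite oppr_le0 ltW. Qed.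

Lemma rp_gt0 : 0 < rp.
Proof. exact: lt_le_trans rm_gt0 (le_trans (r_ge 0) (r_le 0)). Qed.

Definition decay (lam : R) : R := Num.sqrt (k ^+ 2 + lam * rm / mu).

Lemma decay_sqr lam : 0 < lam -> decay lam ^+ 2 = k ^+ 2 + lam * rm / mu.
Proof.
move=> l0; rewrite sqr_sqrtr// addr_ge0 ?sqr_ge0// divr_ge0 ?(ltW mu_gt0)//.
by rewrite mulr_ge0 ?ltW.
Qed.

Lemma decay_gt lam : 0 < lam -> k < decay lam.
Proof.
move=> l0; rewrite -(@ltr_pXn2r _ 2)// ?nnegrE ?sqrtr_ge0 ?(ltW k_gt0)//.
by rewrite decay_sqr// ltrDl divr_gt0// mulr_gt0.
Qed.

Lemma decay_le (l1 l2 : R) : 0 < l1 -> l1 <= l2 -> decay l1 <= decay l2.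
Proof.
move=> l10 l12; rewrite ler_wsqrtr// lerD2l ler_wpM2r ?invr_ge0 ?(ltW mu_gt0)//.
by rewrite ler_wpM2r// ltW.
Qed.

Definition dA u v x := r x * (k ^+ 2 * (u 0%N x * v 0%N x) + u 1%N x * v 1%N x).
(** Among the ways to write the fourth order operator as a form, this one has the stress conditions
    at 0 as its natural boundary conditions: it yields phi'' + k^2 phi against w' and 3 k^2 phi' -
    phi''' against w. *)
Definition dB u v x := mu * ((u 2%N x + k ^+ 2 * u 0%N x) * (v 2%N x + k ^+ 2 * v 0%N x)
   + 4 * k ^+ 2 * (u 1%N x * v 1%N x)).
Definition dC u v x := s x * (u 0%N x * v 0%N x).

Lemma dA_continuous u v : jet u -> jet v -> continuous (dA u v).
Proof.
move=> ju jv; apply: ctM => //; apply: ctD.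
  by apply: ctM; [exact: ct_cst|apply: ctM; exact: jet0_continuous].
by apply: ctM; exact: jet1_continuous.
Qed.

Lemma dB_continuous u v : jet u -> jet v -> continuous (dB u v).
Proof.
move=> ju jv; apply: ctM; first exact: ct_cst.
apply: ctD; last by apply: ctM; [exact: ct_cst|apply: ctM; exact: jet1_continuous].
by apply: ctM; apply: ctD; do ?exact: jet2_continuous;
  apply: ctM; do ?exact: ct_cst; exact: jet0_continuous.
Qed.

Lemma dC_continuous u v : jet u -> jet v -> continuous (dC u v).
Proof. by move=> ju jv; apply: ctM => //; apply: ctM; exact: jet0_continuous. Qed.

Definition hform (lam : R) u v :=
  halfline_form k (decay lam) (u 0%N (- a)) (u 1%N (- a)) (v 0%N (- a)) (v 1%N (- a)).

Definition Pform (lam : R) u v :=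
  lam ^+ 2 * I (dA u v) + lam * I (dB u v) + lam * mu * hform lam u v.

(** The free surface contributes with the sign opposite to that of the stratification, so only the
    interior term creates negative directions of [Qform]. *)
Definition Cform u v := g * k ^+ 2 * (I (dC u v) - rp * (u 0%N 0 * v 0%N 0)).

Definition Qform (lam : R) u v := Pform lam u v - Cform u v.

Lemma QformC lam u v : Qform lam u v = Qform lam v u.
Proof.
rewrite /Qform /Pform /Cform.
have -> : dA u v = dA v u by apply/funext => x; rewrite /dA; ring.
have -> : dB u v = dB v u by apply/funext => x; rewrite /dB; ring.
have -> : dC u v = dC v u by apply/funext => x; rewrite /dC; ring.
have -> : hform lam u v = hform lam v u by rewrite /hform /halfline_form; ring.
ring.
Qed.

Lemma dC_lc u e v : jet u -> jet v ->
  I (dC (lc u e v) (lc u e v)) = I (dC u u) + 2 * e * I (dC u v) + e ^+ 2 * I (dC v v).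
Proof.
move=> ju jv; have jl := jet_lc e ju jv.
rewrite (@itg_lin3 _ _ _ na0 (dC u u) (dC u v) (dC v v) _ 1 (2 * e) (e ^+ 2)) ?mul1r//;
  do ?exact: dC_continuous.
by move=> x _; rewrite /dC /lc; ring.
Qed.

Lemma Qform_lc lam u e v : jet u -> jet v ->
  Qform lam (lc u e v) (lc u e v) =
  Qform lam u u + 2 * e * Qform lam u v + e ^+ 2 * Qform lam v v.
Proof.
move=> ju jv; have jl := jet_lc e ju jv; rewrite /Qform /Pform /Cform dC_lc//.
rewrite (@itg_lin3 _ _ _ na0 (dA u u) (dA u v) (dA v v) _ 1 (2 * e) (e ^+ 2)) ?mul1r//;
  do ?exact: dA_continuous; last by move=> x _; rewrite /dA /lc; ring.
have EB x : - a <= x <= 0 -> dB (lc u e v) (lc u e v) x =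
    1 * dB u u x + 2 * e * dB u v x + e ^+ 2 * dB v v x.
  by move=> _; rewrite /dB /lc; ring.
rewrite (itg_lin3 na0 _ _ _ _ EB) ?mul1r; do ?exact: dB_continuous.
by rewrite /hform /halfline_form /lc; ring.
Qed.

Lemma Aform_ge0 u : jet u -> 0 <= I (dA u u).
Proof.
move=> ju; apply: itg_ge0 => //; first exact: dA_continuous.
move=> x _; have r0 := lt_le_trans rm_gt0 (r_ge x).
rewrite mulr_ge0 ?(ltW r0)// addr_ge0 -?expr2 ?sqr_ge0// mulr_ge0 ?sqr_ge0//.
Qed.

Lemma Bform_ge u : jet u ->
  4 * k ^+ 2 * mu * I (fun x => u 1%N x ^+ 2) <= I (dB u u).
Proof.
move=> ju; have c1 : continuous (fun x => u 1%N x ^+ 2).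
  by apply: ctX; exact: jet1_continuous.
rewrite -itgZ//; apply: le_itg => //; last 1 first.
- move=> x _; rewrite /dB -2!expr2.
  have := mulr_ge0 (ltW mu_gt0) (sqr_ge0 (u 2%N x + k ^+ 2 * u 0%N x)); lra.
- by apply: ctM => //; exact: ct_cst.
- exact: dB_continuous.
Qed.

Lemma Bform_ge0 u : jet u -> 0 <= I (dB u u).
Proof.
move=> ju; apply: le_trans (Bform_ge ju).
apply: mulr_ge0; first by rewrite mulr_ge0 ?(ltW mu_gt0)// mulr_ge0 ?sqr_ge0.
apply: itg_ge0 => //.
  by apply: ctX; exact: jet1_continuous.
by move=> x _; exact: sqr_ge0.
Qed.

Lemma hform_ge0 lam u : 0 < lam -> 0 <= hform lam u u.
Proof. by move=> l0; apply: halfline_form_ge0 => //; exact/ltW/decay_gt. Qed.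

Lemma dC_ge0 u : jet u -> 0 <= I (dC u u).
Proof.
move=> ju; apply: itg_ge0 => //; first exact: dC_continuous.
by move=> x _; rewrite mulr_ge0// -expr2 sqr_ge0.
Qed.

Lemma Cform_le u : Cform u u <= g * k ^+ 2 * I (dC u u).
Proof.
rewrite /Cform ler_pM2l ?mulr_gt0 ?exprn_gt0// gerDl oppr_le0.
by rewrite mulr_ge0 ?(ltW rp_gt0)// -expr2 sqr_ge0.
Qed.

Lemma Pform_ge0 lam u : 0 < lam -> jet u -> 0 <= Pform lam u u.
Proof.
move=> l0 ju; have l0' := ltW l0; rewrite /Pform !addr_ge0//.
- by rewrite mulr_ge0 ?sqr_ge0// Aform_ge0.
- by rewrite mulr_ge0// Bform_ge0.
- by rewrite mulr_ge0 ?hform_ge0// mulr_ge0// ltW.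
Qed.

Lemma Pform_gt0 lam u : 0 < lam -> jet u ->
  (u 0%N (- a) != 0) || (u 1%N (- a) != 0) -> 0 < Pform lam u u.
Proof.
move=> l0 ju nz; have l0' := ltW l0; rewrite /Pform -addrA ltr_wpDr//.
  by rewrite addr_ge0 ?mulr_ge0 ?Bform_ge0 ?hform_ge0// ltW.
rewrite mulr_gt0 ?exprn_gt0//; apply: (itg_gt0 (x0 := - a)) => //.
- by rewrite oppr_lt0.
- exact: dA_continuous.
- move=> x _; have r0 := lt_le_trans rm_gt0 (r_ge x).
  by rewrite mulr_ge0 ?(ltW r0)// addr_ge0 -?expr2 ?sqr_ge0// mulr_ge0 ?sqr_ge0.
- by rewrite lexx na0.
- rewrite mulr_gt0 ?(lt_le_trans rm_gt0 (r_ge _))// -2!expr2.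
  case/orP: nz => nz; [apply: ltr_wpDr|apply: ltr_wpDl].
  + exact: sqr_ge0.
  + by apply: mulr_gt0; [exact: exprn_gt0|rewrite exprn_even_gt0].
  + by rewrite mulr_ge0 ?sqr_ge0.
  + by rewrite exprn_even_gt0.
Qed.

(** Divided by lam^2, the first term is constant and the second decreases; for the third, energy
    over squared decay rate and squared decay rate over lam are both nonincreasing. This controls
    the form when the parameter moves up. *)
Lemma Pform_scale (l1 l2 : R) u : 0 < l1 -> l1 <= l2 -> jet u ->
  l1 ^+ 2 * Pform l2 u u <= l2 ^+ 2 * Pform l1 u u.
Proof.
move=> l10 l12 ju; have l20 := lt_le_trans l10 l12.
have hB := Bform_ge0 ju.
have hE : l1 * hform l2 u u <= l2 * hform l1 u u.
  have h1 := halfline_form_scale k_gt0 (u 0%N (- a)) (u 1%N (- a))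
    (ltW (decay_gt l10)) (decay_le l10 l12).
  have h2 : l1 * decay l2 ^+ 2 <= l2 * decay l1 ^+ 2.
    rewrite !decay_sqr// !mulrDr; apply: lerD.
      by rewrite ler_wpM2r ?sqr_ge0.
    by rewrite le_eqVlt; apply/orP; left; apply/eqP; ring.
  have h3 := hform_ge0 u l10; rewrite -/(hform l1 u u) -/(hform l2 u u) in h1.
  have d1 : 0 < decay l1 ^+ 2 by rewrite exprn_gt0// (lt_trans k_gt0)// decay_gt.
  rewrite -(ler_pM2l d1) mulrCA.
  apply: (le_trans (ler_wpM2l (ltW l10) h1)); rewrite mulrA.
  by apply: (le_trans (ler_wpM2r h3 h2)); rewrite mulrAC mulrCA mulrA mulrAC.
have l12' : 0 <= l1 * l2 * (l2 - l1) by rewrite mulr_ge0 ?subr_ge0// mulr_ge0 ?ltW.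
have hB' := mulr_ge0 l12' hB.
have hE' : 0 <= l1 * l2 * mu * (l2 * hform l1 u u - l1 * hform l2 u u).
  by rewrite mulr_ge0 ?subr_ge0// mulr_ge0 ?(ltW mu_gt0)// mulr_ge0 ?ltW.
rewrite -subr_ge0.
have -> : l2 ^+ 2 * Pform l1 u u - l1 ^+ 2 * Pform l2 u u =
  l1 * l2 * (l2 - l1) * I (dB u u) +
  l1 * l2 * mu * (l2 * hform l1 u u - l1 * hform l2 u u).
  by rewrite /Pform; ring.
exact: addr_ge0.
Qed.

(** Divided by lam, the terms are increasing, constant and, by [halfline_form_le], nondecreasing. A
    smaller parameter thus shrinks the form at least proportionally, while [Cform] does not
    change. *)
Lemma Pform_mono (l1 l2 : R) u : 0 < l1 -> l1 <= l2 -> jet u ->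
  l2 * Pform l1 u u <= l1 * Pform l2 u u.
Proof.
move=> l10 l12 ju; have l20 := lt_le_trans l10 l12.
have hE : hform l1 u u <= hform l2 u u.
  by apply: halfline_form_le => //; [exact/ltW/decay_gt|exact: decay_le].
rewrite -subr_ge0.
have -> : l1 * Pform l2 u u - l2 * Pform l1 u u =
  l1 * l2 * (l2 - l1) * I (dA u u) + l1 * l2 * mu * (hform l2 u u - hform l1 u u).
  by rewrite /Pform; ring.
by rewrite addr_ge0 ?mulr_ge0 ?subr_ge0 ?Aform_ge0// ltW.
Qed.

(** Negativity on all nontrivial combinations already forces the linear independence of the
    family. *)
Definition index_ge (lam : R) (n : nat) := exists F : 'I_n -> nat -> R -> R,
  (forall i, jet (F i)) /\
  forall c, (exists i, c i != 0) -> Qform lam (comb F c) (comb F c) < 0.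

(* Poincare by a multiplier: with t = (p + h - x) / (2 h^2) and f = u 0,
   f'^2 - f^2 / (4 h^2) >= (t f^2)' since t' + t^2 <= - 1 / (4 h^2). *)
Lemma poincare_piece (u : nat -> R -> R) (p h : R) : jet u -> 0 < h ->
  u 0%N p = 0 -> 0 <= itg p (p + h) (fun x => 4 * h ^+ 2 * u 1%N x ^+ 2 - u 0%N x ^+ 2).
Proof.
move=> ju h0 up; have [du _ _] := ju; set f := fun x : R => _.
have cf : continuous f.
  apply: ctB; last by apply: ctX; exact: jet0_continuous.
  by apply: ctM; [exact: ct_cst|apply: ctX; exact: jet1_continuous].
have pph : p <= p + h by rewrite lerDl ltW.
pose G x := prim p f x - 2 * ((p + h - x) * u 0%N x ^+ 2).
have dG (x : R) : is_derive x 1 G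
    (f x - 2 * (- u 0%N x ^+ 2 + (p + h - x) * (2 * (u 0%N x * u 1%N x)))).
  apply: derB; first exact: der_prim.
  apply: derZ; have d1 := derB (der_cst (p + h) x) (der_id x).
  have d2 : is_derive x 1 (fun y => u 0%N y ^+ 2) (2 * (u 0%N x * u 1%N x)).
    have -> : (fun y => u 0%N y ^+ 2) = (fun y => u 0%N y * u 0%N y).
      by apply/funext => y; rewrite expr2.
    by apply: der_eq (derM (du x) (du x)) _; ring.
  by apply: der_eq (derM d1 d2) _; ring.
have : G p <= G (p + h).
  apply: (ndecr_der pph (fun x _ => dG x)) => x /andP[px xp].
  set t := p + h - x; have t0 : 0 <= t by rewrite subr_ge0.
  have th : t <= h by rewrite /t; lra.
  have t2 : t ^+ 2 <= h ^+ 2 by rewrite !expr2 ler_pM.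
  have u2 := sqr_ge0 (u 0%N x).
  rewrite -(pmulr_rge0 _ (exprn_gt0 2 h0)) /f.
  set z := u 0%N x in u2 *; set y := u 1%N x.
  have -> : h ^+ 2 * (4 * h ^+ 2 * y ^+ 2 - z ^+ 2 - 2 * (- z ^+ 2 + t * (2 * (z * y)))) =
    (2 * h ^+ 2 * y - t * z) ^+ 2 + (h ^+ 2 - t ^+ 2) * z ^+ 2 by ring.
  by rewrite addr_ge0 ?sqr_ge0// mulr_ge0// subr_ge0.
by rewrite /G prim0// up /itg expr0n/= !mulr0 !subrr mul0r mulr0 !subr0.
Qed.

Lemma poincare_mesh u (N : nat) : jet u -> (0 < N)%N ->
  (forall j, (j < N)%N -> u 0%N (- a + j%:R * (a / N%:R)) = 0) ->
  0 <= I (fun x => 4 * (a / N%:R) ^+ 2 * u 1%N x ^+ 2 - u 0%N x ^+ 2).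
Proof.
move=> ju N0 hu; set h := a / N%:R; set f := fun x : R => _.
have h0 : 0 < h by rewrite divr_gt0// ltr0n.
have cf : continuous f.
  apply: ctB; last by apply: ctX; exact: jet0_continuous.
  by apply: ctM; [exact: ct_cst|apply: ctX; exact: jet1_continuous].
have H j : (j <= N)%N -> 0 <= prim (- a) f (- a + j%:R * h).
  elim: j => [_|j IH jN]; first by rewrite mul0r addr0 prim0.
  have := poincare_piece ju h0 (hu _ jN); rewrite -/f.
  have -> : - a + j%:R * h + h = - a + j.+1%:R * h by rewrite -natr1; ring.
  have jj : - a + j%:R * h <= - a + j.+1%:R * h.
    by rewrite lerD2l ler_pM2r// ler_nat.
  have -> := itg_FTC jj cf (fun x _ => der_prim (- a) x cf).
  by have := IH (ltnW jN); lra.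
have := H N (leqnn N).
have -> : N%:R * h = a by rewrite /h mulrC divfK// pnatr_eq0 -lt0n.
by rewrite addNr.
Qed.

(** For a function vanishing at the N nodes, the gravity term is at most 4 g k^2 S (a/N)^2 times the
    integral of u'^2 by Poincare, and the viscous term is at least 4 k^2 lam mu times it by
    [Bform_ge]; the hypothesis compares these two constants. *)
Lemma index_le (lam : R) (N n : nat) : (0 < N)%N -> 0 < lam ->
  g * S * (a / N%:R) ^+ 2 <= lam * mu -> index_ge lam n -> (n <= N)%N.
Proof.
move=> N0 l0 hN [F [jF FQ]]; rewrite leqNgt; apply/negP => Nn.
(* With more functions than nodes, the matrix of nodal values has a nonzero left kernel vector. *)
pose M : 'M[R]_(n, N) := \matrix_(i, j) F i 0%N (- a + j%:R * (a / N%:R)).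
have [c [cM c0]] : exists c : 'rV[R]_n, c *m M = 0 /\ c != 0.
  have : kermx M != 0.
    rewrite kermx_eq0 /row_free; apply/eqP => E.
    by have := rank_leq_col M; rewrite E leqNgt Nn.
  by case/rowV0Pn => c /sub_kermxP cM c0; exists c.
have [i ci] : exists i, c 0 i != 0.
  by have /rV0Pn := c0.
have := FQ (fun i => c 0 i) (ex_intro _ i ci).
set u := comb F _; apply/negP; rewrite -leNgt.
have ju : jet u by exact: jet_comb.
have hu j : (j < N)%N -> u 0%N (- a + j%:R * (a / N%:R)) = 0.
  move=> jN; move/matrixP/(_ 0 (Ordinal jN)): cM; rewrite !mxE => <-.
  by apply: eq_bigr => l _; rewrite mxE.
have := poincare_mesh ju N0 hu; set h := a / N%:R; set f := fun x : R => _ => hf.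
have c1 : continuous (fun x => u 1%N x ^+ 2) by apply: ctX; exact: jet1_continuous.
have c2 : continuous (fun x => u 0%N x ^+ 2) by apply: ctX; exact: jet0_continuous.
have fE : I f = 4 * h ^+ 2 * I (fun x => u 1%N x ^+ 2) - I (fun x => u 0%N x ^+ 2).
  rewrite (@itg_lin2 _ _ _ na0 (fun x => u 1%N x ^+ 2) (fun x => u 0%N x ^+ 2) _ (4 * h ^+ 2) (-1))//.
  - by rewrite mulN1r.
  - by apply: ctB => //; apply: ctM => //; exact: ct_cst.
  - by move=> x _; rewrite mulN1r.
have hC : I (dC u u) <= S * I (fun x => u 0%N x ^+ 2).
  rewrite -itgZ//; apply: le_itg => //; first exact: dC_continuous.
    by apply: ctM => //; exact: ct_cst.
  by move=> x _; rewrite /dC -expr2 ler_wpM2r ?sqr_ge0.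
have hB := Bform_ge ju; have hA := Aform_ge0 ju; have hE := hform_ge0 u l0.
have hCf := Cform_le u.
rewrite fE in hf; rewrite /Qform subr_ge0; apply: (le_trans hCf).
set J1 := I (fun x => u 1%N x ^+ 2) in hf hB; set J0 := I (fun x => u 0%N x ^+ 2) in hf hC.
have J10 : 0 <= J1 by apply: itg_ge0 => // x _; exact: sqr_ge0.
have S0 : 0 <= S by exact: le_trans (s_ge0 0) (s_le 0).
have gk0 : 0 < g * k ^+ 2 by rewrite mulr_gt0 ?exprn_gt0.
have step1 : g * k ^+ 2 * I (dC u u) <= g * k ^+ 2 * (S * (4 * h ^+ 2 * J1)).
  rewrite ler_pM2l//; apply: (le_trans hC); rewrite ler_wpM2l//; lra.
have step2 : g * k ^+ 2 * (S * (4 * h ^+ 2 * J1)) <= lam * (4 * k ^+ 2 * mu * J1).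
  have -> : g * k ^+ 2 * (S * (4 * h ^+ 2 * J1)) = (g * S * h ^+ 2) * (4 * k ^+ 2 * J1) by ring.
  have -> : lam * (4 * k ^+ 2 * mu * J1) = (lam * mu) * (4 * k ^+ 2 * J1) by ring.
  by rewrite ler_wpM2r// mulr_ge0// mulr_ge0// sqr_ge0.
have step3 : lam * (4 * k ^+ 2 * mu * J1) <= lam * I (dB u u) by rewrite ler_pM2l.
apply: (le_trans step1); apply: (le_trans step2); apply: (le_trans step3).
have h1 : 0 <= lam ^+ 2 * I (dA u u) by rewrite mulr_ge0 ?sqr_ge0.
have h2 : 0 <= lam * mu * hform lam u u by rewrite mulr_ge0// mulr_ge0 ?ltW.
rewrite /Pform; lra.
Qed.

Lemma sum_itg n (G : 'I_n -> R -> R) (d : 'I_n -> R) : (forall i, continuous (G i)) ->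
  \sum_i d i * I (G i) = I (fun x => \sum_i d i * G i x).
Proof.
move=> cG; rewrite itg_sum//; last by move=> i; apply: ctM => //; exact: ct_cst.
by apply: eq_bigr => i _; rewrite itgZ.
Qed.

(** On disjoint bumps the gravity form is diagonal with entries at least [kap], whereas the
    remaining terms carry a factor [lam]; a small [lam] lets gravity dominate on the whole span. *)
Lemma index_ge_exists (n : nat) :
  (forall p q : R, - a <= p -> p < q -> q <= 0 -> exists2 x, p < x < q & 0 < s x) ->
  exists2 lam, 0 < lam & index_ge lam n.
Proof.
move=> s_dense.
have [->|n0] := posnP n.
  exists 1; first exact: ltr01.
  by exists (fun _ _ _ => 0); split => [[]//|c [[]//]].
pose p (i : nat) : R := - a + i%:R * (a / n%:R).
have n0' : (0 : R) < n%:R by rewrite ltr0n.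
have pS i : p i < p i.+1.
  by rewrite /p ltrD2l ltr_pM2r ?divr_gt0// ltr_nat.
have p_ge i : - a <= p i by rewrite /p lerDl mulr_ge0 ?ler0n// divr_ge0 ?ler0n ?(ltW a_gt0).
have pn i : (i <= n)%N -> p i <= 0.
  move=> i_n; rewrite /p addrC subr_le0 mulrA ler_pdivrMr// mulrC ler_pM2l//.
  by rewrite ler_nat.
pose F (i : 'I_n) (j : nat) : R -> R :=
  if j is j'.+1 then (if j' is 0%N then hbump1 (p i) (p i.+1) else hbump2 (p i) (p i.+1))
  else hbump (p i) (p i.+1).
have jF i : jet (F i).
  by split; [move=> x; exact: der_hbump|move=> x; exact: der_hbump1|exact: hbump2_continuous].
have Fij (i j : 'I_n) x : i != j -> F i 0%N x * F j 0%N x = 0.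
  wlog ij : i j / (i < j)%N.
    move=> H ij; case: (ltngtP i j) => [h|h|h]; first exact: H.
      by rewrite mulrC; apply: H => //; rewrite eq_sym.
    by case/eqP: ij; exact: val_inj.
  move=> _; have pij : p i.+1 <= p j.
    by rewrite /p lerD2l ler_pM2r ?divr_gt0// ler_nat.
  have [xp|xp] := leP x (p j).
    by have [E _] := @hbump_out _ (p j) (p j.+1) x (or_introl xp); rewrite /F E mulr0.
  have [E _] := @hbump_out _ (p i) (p i.+1) x (or_intror (le_trans pij (ltW xp))).
  by rewrite /F E mul0r.
have Cpos i : 0 < I (dC (F i) (F i)).
  have [x /andP[x1 x2] sx] := s_dense _ _ (p_ge i) (pS i) (pn i.+1 (ltn_ord i)).
  apply: (itg_gt0 (x0 := x)) => //.
  - by rewrite oppr_lt0.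
  - exact: dC_continuous.
  - by move=> y _; rewrite mulr_ge0// -expr2 sqr_ge0.
  - rewrite (le_trans (p_ge i) (ltW x1))/=.
    exact: le_trans (ltW x2) (pn _ (ltn_ord i)).
  - by rewrite /dC mulr_gt0// mulr_gt0// hbump_gt0// x1 x2.
pose i0 := Ordinal n0.
pose kap := \big[Num.min/I (dC (F i0) (F i0))]_i I (dC (F i) (F i)).
have kap0 : 0 < kap.
  by rewrite /kap; elim/big_ind: _ => // x y x0 y0; rewrite lt_min x0 y0.
have kapi i : kap <= I (dC (F i) (F i)) by exact: bigmin_le_cond.
pose K := \sum_i (I (dA (F i) (F i)) + I (dB (F i) (F i))).
have Ki i : I (dA (F i) (F i)) + I (dB (F i) (F i)) <= K.
  rewrite /K (bigD1 i)//= lerDl sumr_ge0// => j _.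
  by rewrite addr_ge0 ?Aform_ge0 ?Bform_ge0.
have K0 : 0 <= K by rewrite sumr_ge0// => i _; rewrite addr_ge0 ?Aform_ge0 ?Bform_ge0.
pose D := n%:R * K + 1.
have D0 : 0 < D by rewrite ltr_wpDl// mulr_ge0// ler0n.
(* The bound 1 replaces lam^2 by lam; the other bound keeps the inertial and viscous terms below
   half of the gravity term. *)
pose lam := Num.min 1 (g * k ^+ 2 * kap / (2 * D)).
have gk0 : 0 < g * k ^+ 2 by rewrite mulr_gt0 ?exprn_gt0.
have lam0 : 0 < lam by rewrite lt_min ltr01/= divr_gt0 ?mulr_gt0.
exists lam => //; exists F; split => // c [i ci].
set u := comb F c; have ju : jet u by exact: jet_comb.
have sumc0 : 0 < \sum_i c i ^+ 2.
  rewrite (bigD1 i)//= ltr_wpDr ?exprn_even_gt0//.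
  by rewrite sumr_ge0// => j _; exact: sqr_ge0.
have sqsum (x : 'I_n -> R) : (\sum_i x i) ^+ 2 <= n%:R * \sum_i x i ^+ 2.
  have E1 : (\sum_i x i) ^+ 2 = \sum_i \sum_j x i * x j.
    by rewrite expr2 mulr_suml; apply: eq_bigr => l _; rewrite mulr_sumr.
  have E2 : n%:R * \sum_i x i ^+ 2 = \sum_i \sum_j (x i ^+ 2 + x j ^+ 2) / 2.
    have -> : \sum_i \sum_j (x i ^+ 2 + x j ^+ 2) / 2 =
        2^-1 * (\sum_(l < n) \sum_(j < n) x l ^+ 2 + \sum_(l < n) \sum_(j < n) x j ^+ 2).
      rewrite -big_split/= mulr_sumr; apply: eq_bigr => l _.
      by rewrite -big_split/= mulr_sumr; apply: eq_bigr => j _; rewrite mulrC.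
    rewrite [X in _ + X]sumr_const card_ord.
    under [X in X + _]eq_bigr do rewrite sumr_const card_ord -mulr_natl.
    by rewrite -mulr_sumr -[(\sum__ _) *+ n]mulr_natl; field.
  rewrite E1 E2; apply: ler_sum => l _; apply: ler_sum => j _.
  by have := sqr_ge0 (x l - x j); nra.
have uA : I (dA u u) <= n%:R * \sum_i c i ^+ 2 * I (dA (F i) (F i)).
  rewrite sum_itg; last by move=> l; exact: dA_continuous.
  rewrite -itgZ//; last first.
    by apply: ct_sum => l; apply: ctM; [exact: ct_cst|exact: dA_continuous].
  apply: le_itg => //; first exact: dA_continuous.
    apply: ctM; first exact: ct_cst.
    by apply: ct_sum => l; apply: ctM; [exact: ct_cst|exact: dA_continuous].
  move=> x _; rewrite /dA /u /comb -2!expr2.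
  have h0 := sqsum (fun l => c l * F l 0%N x); have h1 := sqsum (fun l => c l * F l 1%N x).
  have -> : n%:R * (\sum_l c l ^+ 2 * (r x * (k ^+ 2 * (F l 0%N x * F l 0%N x) + F l 1%N x * F l 1%N x))) =
   r x * (k ^+ 2 * (n%:R * \sum_l (c l * F l 0%N x) ^+ 2) + n%:R * \sum_l (c l * F l 1%N x) ^+ 2).
    rewrite !mulr_sumr -big_split/= mulr_sumr; apply: eq_bigr => l _; ring.
  apply: ler_wpM2l; first exact: le_trans (ltW rm_gt0) (r_ge x).
  by apply: lerD => //; apply: ler_wpM2l => //; exact: sqr_ge0.
have uB : I (dB u u) <= n%:R * \sum_i c i ^+ 2 * I (dB (F i) (F i)).
  rewrite sum_itg; last by move=> l; exact: dB_continuous.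
  rewrite -itgZ//; last first.
    by apply: ct_sum => l; apply: ctM; [exact: ct_cst|exact: dB_continuous].
  apply: le_itg => //; first exact: dB_continuous.
    apply: ctM; first exact: ct_cst.
    by apply: ct_sum => l; apply: ctM; [exact: ct_cst|exact: dB_continuous].
  move=> x _; rewrite /dB /u /comb -2!expr2.
  have h0 := sqsum (fun l => c l * (F l 2%N x + k ^+ 2 * F l 0%N x)).
  have h1 := sqsum (fun l => c l * F l 1%N x).
  have -> : \sum_l c l * F l 2%N x + k ^+ 2 * (\sum_l c l * F l 0%N x) =
     \sum_l c l * (F l 2%N x + k ^+ 2 * F l 0%N x).
    by rewrite mulr_sumr -big_split/=; apply: eq_bigr => l _; ring.
  have -> : n%:R * (\sum_l c l ^+ 2 * (mu * ((F l 2%N x + k ^+ 2 * F l 0%N x) * (F l 2%N x + k ^+ 2 * F l 0%N x) + 4 * k ^+ 2 * (F l 1%N x * F l 1%N x)))) =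
   mu * (n%:R * \sum_l (c l * (F l 2%N x + k ^+ 2 * F l 0%N x)) ^+ 2 + 4 * k ^+ 2 * (n%:R * \sum_l (c l * F l 1%N x) ^+ 2)).
    rewrite !mulr_sumr -big_split/= mulr_sumr; apply: eq_bigr => l _; ring.
  apply: ler_wpM2l; first exact: ltW.
  by apply: lerD => //; apply: ler_wpM2l => //; rewrite mulr_ge0 ?sqr_ge0.
have uC : kap * \sum_i c i ^+ 2 <= I (dC u u).
  have -> : I (dC u u) = \sum_i c i ^+ 2 * I (dC (F i) (F i)).
    rewrite sum_itg; last by move=> l; exact: dC_continuous.
    apply: eq_itg => //; first exact: dC_continuous.
      by apply: ct_sum => l; apply: ctM; [exact: ct_cst|exact: dC_continuous].
    move=> x _; rewrite /dC /u /comb mulr_suml mulr_sumr; apply: eq_bigr => l _.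
    rewrite mulr_sumr (bigD1 l)//= big1 ?addr0; first by ring.
    by move=> j jl; rewrite mulrACA Fij ?mulr0// eq_sym.
  by rewrite mulr_sumr; apply: ler_sum => l _; rewrite mulrC ler_wpM2l ?sqr_ge0.
(* The bumps are flat at both ends, so the half-line energy at -a and the surface term at 0
   vanish. *)
have ua : u 0%N (- a) = 0 /\ u 1%N (- a) = 0.
  by split; apply: big1 => l _; have [E0 E1] := @hbump_out _ (p l) (p l.+1) (- a) (or_introl (p_ge l));
    rewrite /F ?E0 ?E1 mulr0.
have u0 : u 0%N 0 = 0.
  by apply: big1 => l _; have [E0 _] := @hbump_out _ (p l) (p l.+1) 0 (or_intror (pn _ (ltn_ord l)));
    rewrite /F E0 mulr0.
have h0 : hform lam u u = 0.
  by rewrite /hform /halfline_form; case: ua => -> ->; ring.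
rewrite /Qform /Pform /Cform h0 u0 !mulr0 subr0 addr0 subr_lt0.
have lam1 : lam <= 1 by rewrite ge_min lexx.
have lam2 : lam <= g * k ^+ 2 * kap / (2 * D) by rewrite ge_min lexx orbT.
have uA0 := Aform_ge0 ju; have uB0 := Bform_ge0 ju.
have s1 : lam ^+ 2 * I (dA u u) <= lam * I (dA u u).
  by rewrite ler_wpM2r// expr2 ler_piMl// ltW.
have s2 : I (dA u u) + I (dB u u) <= n%:R * K * \sum_i c i ^+ 2.
  apply: (le_trans (lerD uA uB)); rewrite -mulrDr -mulrA ler_wpM2l ?ler0n//.
  rewrite -big_split/= mulr_sumr; apply: ler_sum => l _.
  by rewrite -mulrDr mulrC ler_wpM2r ?sqr_ge0.
apply: lt_le_trans (_ : g * k ^+ 2 * (kap * \sum_i c i ^+ 2) <= _); last by rewrite ler_pM2l.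
apply: le_lt_trans (_ : lam * (D * \sum_i c i ^+ 2) < _).
  apply: (le_trans (lerD s1 (lexx _))); rewrite -mulrDr ler_wpM2l ?(ltW lam0)//.
  apply: (le_trans s2); rewrite /D mulrDl mul1r lerDl ltW//.
rewrite !mulrA ltr_pM2r//; apply: (@le_lt_trans _ _ (g * k ^+ 2 * kap / (2 * D) * D)).
  by rewrite ler_pM2r.
have -> : g * k ^+ 2 * kap / (2 * D) * D = g * k ^+ 2 * kap / 2.
  by field; rewrite gt_eqF.
have : 0 < g * k ^+ 2 * kap by rewrite mulr_gt0.
lra.
Qed.

End Forms.

(** * The Hamiltonian system and its boundary value problem *)

Section Hamiltonian.
Context {R : realType}.
Variables (a g mu k rm rp S : R) (r s : R -> R).
Hypotheses (a_gt0 : 0 < a) (g_gt0 : 0 < g) (mu_gt0 : 0 < mu) (k_gt0 : 0 < k)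
  (rm_gt0 : 0 < rm) (cr : continuous r) (cs : continuous s)
  (r_ge : forall x, rm <= r x) (r_le : forall x, r x <= rp)
  (s_ge0 : forall x, 0 <= s x) (s_le : forall x, s x <= S).
Local Notation I := (itg (- a) 0).
Implicit Types (Y Z : nat -> R -> R) (lam e x : R) (h : R -> R).
Local Notation gam := (g * k ^+ 2).
Local Notation decay := (decay mu k rm).
Local Notation Qform := (Qform a g mu k rm rp r s).
Local Notation Pform := (Pform a mu k rm r).
Local Notation Cform := (Cform a g k rp s).
Local Notation index_ge := (index_ge a g mu k rm rp r s).

Let na0 : - a <= 0. Proof. by rewrite oppr_le0 ltW. Qed.

(* First order form of the equation: Y 0 = phi, Y 1 = phi', and Y 2, Y 3 are the
   momenta conjugate to phi and phi', that is
   Y 3 = lam mu (phi'' + k^2 phi), Y 2 = lam^2 r phi' + 3 lam mu k^2 phi' - lam mu phi'''. *)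
Definition ham lam h Y := forall x : R,
  [/\ is_derive x 1 (Y 0%N) (Y 1%N x),
      is_derive x 1 (Y 1%N) (Y 3%N x / (lam * mu) - k ^+ 2 * Y 0%N x),
      is_derive x 1 (Y 2%N)
        ((lam ^+ 2 * k ^+ 2 * r x - gam * s x) * Y 0%N x + k ^+ 2 * Y 3%N x - h x) &
      is_derive x 1 (Y 3%N)
        ((lam ^+ 2 * r x + 4 * lam * mu * k ^+ 2) * Y 1%N x - Y 2%N x)].

Definition coef lam (i j : nat) (x : R) : R := match i, j with
  | 0, 1 => 1 | 1, 0 => - k ^+ 2 | 1, 3 => (lam * mu)^-1
  | 2, 0 => lam ^+ 2 * k ^+ 2 * r x - gam * s x | 2, 3 => k ^+ 2
  | 3, 1 => lam ^+ 2 * r x + 4 * lam * mu * k ^+ 2 | 3, 2 => - 1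
  | _, _ => 0 end.

Lemma coef_continuous lam (i j : 'I_4) : continuous (coef lam i j).
Proof.
case: i => [[|[|[|[|//]]]] hi]; case: j => [[|[|[|[|//]]]] hj] /=; rewrite /coef; try exact: ct_cst.
- by apply: ctB; apply: ctM => //; exact: ct_cst.
- by apply: ctD; [apply: ctM => //|]; exact: ct_cst.
Qed.

Lemma coef_bounded lam : exists K, forall (i j : 'I_4) x, `|coef lam i j x| <= K.
Proof.
have rp0 : 0 <= rp by exact: le_trans (ltW rm_gt0) (le_trans (r_ge 0) (r_le 0)).
have r0 x : `|r x| <= rp by rewrite ger0_norm// (le_trans (ltW rm_gt0)).
have s0 x : `|s x| <= S by rewrite ger0_norm.
have S0 : 0 <= S by exact: le_trans (s_ge0 0) (s_le 0).
pose K1 := `|lam ^+ 2 * k ^+ 2| * rp + `|gam| * S.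
pose K2 := `|lam ^+ 2| * rp + `|4 * lam * mu * k ^+ 2|.
have K10 : 0 <= K1 by rewrite addr_ge0// mulr_ge0.
have K20 : 0 <= K2 by rewrite addr_ge0// mulr_ge0.
have k0 : 0 <= `|k ^+ 2| by [].
have l0 : 0 <= `|(lam * mu)^-1| by [].
exists (1 + `|k ^+ 2| + `|(lam * mu)^-1| + K1 + K2) => i j x.
have h1 : `|lam ^+ 2 * k ^+ 2 * r x - gam * s x| <= K1.
  apply: (le_trans (ler_normB _ _)); rewrite [`|_ * r x|]normrM [`|gam * s x|]normrM.
  by apply: lerD; apply: ler_wpM2l.
have h2 : `|lam ^+ 2 * r x + 4 * lam * mu * k ^+ 2| <= K2.
  apply: (le_trans (ler_normD _ _)); rewrite [`|_ * r x|]normrM lerD2r.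
  by apply: ler_wpM2l.
case: i => [[|[|[|[|//]]]] hi]; case: j => [[|[|[|[|//]]]] hj] /=;
  rewrite ?normr0 ?normr1 ?normrN ?normr1; lra.
Qed.

Lemma hamP lam h (Y : nat -> R -> R) : ham lam h Y <->
  forall (i : 'I_4) (x : R), is_derive x 1 (Y i)
    (\sum_(j < 4) coef lam i j x * Y j x + (if i == 2%N :> nat then - h x else 0)).
Proof.
split=> H.
  move=> [[|[|[|[|//]]]] hi] x; have [h0 h1 h2 h3] := H x;
  rewrite !big_ord_recl big_ord0 /=; [apply: der_eq h0 _|apply: der_eq h1 _|
    apply: der_eq h2 _|apply: der_eq h3 _]; rewrite /coef/=; ring.
move=> x; split.
- apply: der_eq (H ord0 x) _; rewrite !big_ord_recl big_ord0 /= /coef/=; ring.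
- apply: der_eq (H (@Ordinal 4 1 isT) x) _; rewrite !big_ord_recl big_ord0 /= /coef/=; ring.
- apply: der_eq (H (@Ordinal 4 2 isT) x) _; rewrite !big_ord_recl big_ord0 /= /coef/=; ring.
- apply: der_eq (H (@Ordinal 4 3 isT) x) _; rewrite !big_ord_recl big_ord0 /= /coef/=; ring.
Qed.

Lemma ham_ex lam h B x0 (y0 : nat -> R) : continuous h -> (forall x, `|h x| <= B) ->
  exists Y, (forall i, (i < 4)%N -> Y i x0 = y0 i) /\ ham lam h Y.
Proof.
move=> ch hB; have [K hK] := coef_bounded lam.
have B0 : 0 <= B by exact: le_trans (hB 0).
pose b (i : 'I_4) x := if i == 2%N :> nat then - h x else 0.
have cb i : continuous (b i).
  rewrite /b; case: (i == 2%N :> nat); last exact: ct_cst.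
  by move=> x; apply: continuousN; exact: ch.
have bB i x : `|b i x| <= B by rewrite /b; case: ifP => _; rewrite ?normrN ?normr0.
have [Y [Y0 dY]] := @lin_ode_ex R 4 (coef lam) K (@coef_continuous lam) hK b B x0 y0 cb bB.
exists (fun i => Y (inord i)); split.
  by move=> i i4; rewrite Y0 inordK.
apply/hamP => i x; rewrite inord_val; apply: der_eq (dY i x) _; congr (_ + _).
by apply: eq_bigr => j _; rewrite inord_val.
Qed.

Lemma ham_unique lam Y x0 : ham lam (fun=> 0) Y ->
  (forall i, (i < 4)%N -> Y i x0 = 0) -> forall i x, (i < 4)%N -> Y i x = 0.
Proof.
move=> /hamP hY Y0 i x i4; have [K hK] := coef_bounded lam.
have := @ode_unique R 4 (coef lam) K hK (fun i => Y i) x0 _ (fun i => Y0 i (ltn_ord i)) (Ordinal i4) x.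
apply => j y; apply: der_eq (hY j y) _.
by rewrite oppr0 if_same addr0.
Qed.

Lemma ham_bound lam : exists2 L, 0 <= L & forall h Y, continuous h -> ham lam h Y ->
  forall x, - a <= x <= 0 -> forall j, (j < 4)%N ->
  Y j x ^+ 2 <= L * (\sum_(i < 4) Y i (- a) ^+ 2 + I (fun x => h x ^+ 2)).
Proof.
have [K hK] := coef_bounded lam; pose kap := 2 * (4%:R * K) + 1.
have K0 : 0 <= K by exact: le_trans (hK ord0 ord0 0).
have kap0 : 0 <= kap by rewrite /kap; lra.
exists (expR (kap * a)); first exact: expR_ge0.
move=> h Y ch hY x /andP[ax x0] j j4.
have ch2 : continuous (fun x => h x ^+ 2) by exact: ctX.
pose b (i : 'I_4) x := if i == 2%N :> nat then - h x else 0.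
have sb y : \sum_(i < 4) b i y ^+ 2 = h y ^+ 2.
  by rewrite !big_ord_recl big_ord0 /b /= !expr0n/= sqrrN; ring.
have dW (y : R) : - a <= y <= x -> is_derive y 1 (prim (- a) (fun x => h x ^+ 2))
   (\sum_(i < 4) b i y ^+ 2).
  by move=> _; rewrite sb; exact: der_prim.
have /hamP hY' := hY.
have := @ode_gronwall R 4 (coef lam) K hK b (fun i => Y i) _ (- a) x ax
  (fun i y _ => hY' i y) dW (prim0 _ ch2).
set E0 := \sum_(i < 4) Y i (- a) ^+ 2 => hG.
have W0 : 0 <= prim (- a) (fun x => h x ^+ 2) x.
  by apply: (itg_ge0 ax) => // y _; exact: sqr_ge0.
have Wm : prim (- a) (fun x => h x ^+ 2) x <= I (fun x => h x ^+ 2).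
  apply: (ndecr_der x0 (f' := fun x => h x ^+ 2)); first by move=> y _; exact: der_prim.
  by move=> y _; exact: sqr_ge0.
have E00 : 0 <= E0 by rewrite sumr_ge0// => i _; exact: sqr_ge0.
have hj : Y j x ^+ 2 <= \sum_(i < 4) Y i x ^+ 2.
  by rewrite (bigD1 (Ordinal j4))//= lerDl sumr_ge0// => i _; exact: sqr_ge0.
apply: (le_trans hj); apply: (le_trans hG).
apply: ler_pM; rewrite ?expR_ge0 ?addr_ge0 ?lerD2l//.
by rewrite ler_expR ler_wpM2l//; lra.
Qed.

Lemma ham_lc lam h h' e Y Z : ham lam h Y -> ham lam h' Z ->
  ham lam (fun x => h x + e * h' x) (lc Y e Z).
Proof.
move=> hY hZ x; have [y0 y1 y2 y3] := hY x; have [z0 z1 z2 z3] := hZ x; split.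
- by apply: derD => //; exact: derZ.
- by apply: der_eq (derD y1 (derZ e z1)) _; rewrite /lc; ring.
- by apply: der_eq (derD y2 (derZ e z2)) _; rewrite /lc; ring.
- by apply: der_eq (derD y3 (derZ e z3)) _; rewrite /lc; ring.
Qed.

Lemma ham_comb n lam (h : 'I_n -> R -> R) (Y : 'I_n -> nat -> R -> R) c :
  (forall i, ham lam (h i) (Y i)) -> ham lam (fun x => \sum_i c i * h i x) (comb Y c).
Proof.
move=> hY x; split.
- by apply: der_sum => i; apply: derZ; have [] := hY i x.
- have h1 (i : 'I_n) := derZ (c i) (let: And4 _ y _ _ := hY i x in y).
  apply: der_eq (der_sum h1) _.
  by rewrite /comb mulr_suml mulr_sumr -sumrB; apply: eq_bigr => i _; ring.
- have h1 (i : 'I_n) := derZ (c i) (let: And4 _ _ y _ := hY i x in y).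
  apply: der_eq (der_sum h1) _.
  by rewrite /comb !mulr_sumr -big_split/= -sumrB; apply: eq_bigr => i _; ring.
- have h1 (i : 'I_n) := derZ (c i) (let: And4 _ _ _ y := hY i x in y).
  apply: der_eq (der_sum h1) _.
  by rewrite /comb !mulr_sumr -sumrB; apply: eq_bigr => i _; ring.
Qed.

(** The solutions below -a decaying at -oo are spanned by exp(k x) and exp(m x) with m =
    [decay lam]. Eliminating the two coefficients expresses the momenta by the positions; the result
    is lam mu times the partial derivatives of half of [halfline_form]. *)
Definition bc_left lam Y :=
  Y 2%N (- a) = lam * mu * (k * decay lam * (decay lam + k) * Y 0%N (- a)
    - k * (decay lam - k) * Y 1%N (- a)) /\
  Y 3%N (- a) = lam * mu * (- (k * (decay lam - k)) * Y 0%N (- a)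
    + (decay lam + k) * Y 1%N (- a)).

Definition bc_right Y := Y 3%N 0 = 0 /\ Y 2%N 0 + gam * rp * Y 0%N 0 = 0.

Lemma bc_left_lc lam Y e Z : bc_left lam Y -> bc_left lam Z -> bc_left lam (lc Y e Z).
Proof. by move=> [a1 a2] [b1 b2]; rewrite /bc_left /lc a1 a2 b1 b2; split; ring. Qed.

Lemma bc_left_comb n lam (Y : 'I_n -> nat -> R -> R) c :
  (forall i, bc_left lam (Y i)) -> bc_left lam (comb Y c).
Proof.
move=> hY; split; rewrite /comb.
  rewrite !mulr_sumr -sumrB mulr_sumr; apply: eq_bigr => i _.
  by have [-> _] := hY i; ring.
rewrite !mulr_sumr -big_split/= mulr_sumr; apply: eq_bigr => i _.
by have [_ ->] := hY i; ring.
Qed.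

Lemma bc_right_comb n (Y : 'I_n -> nat -> R -> R) c :
  (forall i, bc_right (Y i)) -> bc_right (comb Y c).
Proof.
move=> hY; split; rewrite /comb ?mulr_sumr -?big_split/=;
  apply: big1 => i _; have [E1 E2] := hY i; first by rewrite E1 mulr0.
by rewrite mulrCA -mulrDr E2 mulr0.
Qed.

(** Only index 2 differs from [Y], which stores a momentum there; the second derivative of phi is
    recovered from [Y 3]. *)
Definition jet_of lam Y : nat -> R -> R := fun j =>
  if j == 2%N then fun x => Y 3%N x / (lam * mu) - k ^+ 2 * Y 0%N x else Y j.

Lemma ham_continuous lam h Y j : (j < 4)%N -> ham lam h Y -> continuous (Y j).
Proof.
move=> j4 hY x; have [h0 h1 h2 h3] := hY x.
by case: j j4 => [|[|[|[|//]]]] _; apply: der_continuous; eassumption.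
Qed.

Lemma jet_of_jet lam h Y : ham lam h Y -> jet (jet_of lam Y).
Proof.
move=> hY; split=> [x|x|]; [by have [] := hY x|by have [] := hY x|].
apply: ctB; apply: ctM; do ?exact: ct_cst; exact: (ham_continuous _ hY).
Qed.

(** The derivative of [Y 2 * w 0 + Y 3 * w 1] is the density of the form minus [h * w 0]. After
    integration, [bc_left] turns the value at -a into [hform] and [bc_right] turns the value at 0
    into the surface term. *)
Lemma weak_form lam h Y (w : nat -> R -> R) : 0 < lam -> continuous h -> ham lam h Y ->
  bc_left lam Y -> bc_right Y -> jet w ->
  Qform lam (jet_of lam Y) w = I (fun x => h x * w 0%N x).
Proof.
move=> l0 ch hY [a1 a2] [b1 b2] jw; have ju := jet_of_jet hY; set u := jet_of lam Y.
have cA : continuous (dA k r u w) by exact: dA_continuous.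
have cB : continuous (dB mu k u w) by exact: dB_continuous.
have cC : continuous (dC s u w) by exact: dC_continuous.
have ch' : continuous (fun x => h x * w 0%N x) by apply: ctM => //; exact: jet0_continuous.
pose f x := lam ^+ 2 * dA k r u w x + lam * dB mu k u w x
  + (- gam) * dC s u w x - h x * w 0%N x.
pose f3 x := lam ^+ 2 * dA k r u w x + lam * dB mu k u w x + (- gam) * dC s u w x.
have cf3 : continuous f3.
  by apply: ctD; first apply: ctD; apply: ctM => //; exact: ct_cst.
have cf : continuous f by exact: ctB.
pose F x := Y 2%N x * w 0%N x + Y 3%N x * w 1%N x.
have dF (x : R) : - a <= x <= 0 -> is_derive x 1 F (f x).
  move=> _; have [w0 w1 _] := jw; have [_ _ h2 h3] := hY x.
  apply: der_eq (derD (derM h2 (w0 x)) (derM h3 (w1 x))) _.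
  rewrite /f /dA /dB /dC /u /jet_of /=; field.
  by rewrite !gt_eqF.
have E1 := itg_FTC na0 cf dF.
have E2 : I f = 1 * I f3 + (-1) * I (fun x => h x * w 0%N x).
  by apply: itg_lin2 => // x _; rewrite mul1r mulN1r.
have E3 : I f3 = lam ^+ 2 * I (dA k r u w) + lam * I (dB mu k u w) + (- gam) * I (dC s u w).
  by apply: itg_lin3.
have -> : I (fun x => h x * w 0%N x) = I f3 - I f by rewrite E2; ring.
rewrite E1 E3 /F b1 a1 a2 /Qform /Pform /Cform /hform /halfline_form.
have {}b2 : Y 2%N 0 = - (gam * rp * Y 0%N 0) by lra.
by rewrite b2 /u /jet_of /=; ring.
Qed.

Definition chr lam := 0 < lam /\ exists Y, [/\ ham lam (fun=> 0) Y, bc_left lam Y,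
  bc_right Y & exists x, Y 0%N x != 0].

Lemma chr_initial lam Y : ham lam (fun=> 0) Y -> bc_left lam Y ->
  (exists x, Y 0%N x != 0) -> (Y 0%N (- a) != 0) || (Y 1%N (- a) != 0).
Proof.
move=> hY [a1 a2] [x xn]; apply/negPn/negP; rewrite negb_or !negbK => /andP[/eqP y0 /eqP y1].
rewrite y0 y1 !mulr0 ?subr0 ?addr0 ?mulr0 in a1 a2.
case/eqP: xn; apply: (ham_unique (x0 := - a) hY) => // -[|[|[|[|//]]]] _ //.
Qed.

Lemma basis_solutions lam : exists Y1 Y2, [/\ ham lam (fun=> 0) Y1 /\ ham lam (fun=> 0) Y2,
  bc_left lam Y1 /\ bc_left lam Y2, Y1 0%N (- a) = 1 /\ Y1 1%N (- a) = 0 &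
  Y2 0%N (- a) = 0 /\ Y2 1%N (- a) = 1].
Proof.
have H y z : exists Y, [/\ ham lam (fun=> 0) Y, bc_left lam Y, Y 0%N (- a) = y & Y 1%N (- a) = z].
  pose y0 (i : nat) : R := match i with 0 => y | 1 => z
   | 2 => lam * mu * (k * decay lam * (decay lam + k) * y - k * (decay lam - k) * z)
   | _ => lam * mu * (- (k * (decay lam - k)) * y + (decay lam + k) * z) end.
  have [Y [Y0 hY]] := @ham_ex lam (fun=> 0) 0 (- a) y0 (@ct_cst R 0) (fun x => ltac:(by rewrite normr0)).
  by exists Y; split => //; rewrite ?Y0// /bc_left !Y0.
have [Y1 [? ? ? ?]] := H 1 0; have [Y2 [? ? ? ?]] := H 0 1.
by exists Y1, Y2.
Qed.

(** A Fredholm alternative by shooting from -a: [bc_left] leaves two free constants and [bc_right]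
    imposes two conditions. A kernel vector of this 2 by 2 system would be an eigenfunction, so its
    determinant [D] is nonzero, and Cramer's rule gives both the solution and its bound. *)
Lemma not_chr_resolvent lam : 0 < lam -> ~ chr lam ->
  (forall h B, continuous h -> (forall x, `|h x| <= B) ->
    exists Y, [/\ ham lam h Y, bc_left lam Y & bc_right Y]) /\
  exists2 C, 0 <= C & forall h Y, continuous h -> ham lam h Y -> bc_left lam Y ->
    bc_right Y -> forall x, - a <= x <= 0 -> Y 0%N x ^+ 2 <= C * I (fun x => h x ^+ 2).
Proof.
move=> l0 nchr; have [Y1 [Y2 [[h1 h2] [b1 b2] [y10 y11] [y20 y21]]]] := basis_solutions lam.
pose e1 Y := Y 3%N 0; pose e2 Y := Y 2%N 0 + gam * rp * Y 0%N 0.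
have e1lc Y e Z : e1 (lc Y e Z) = e1 Y + e * e1 Z by [].
have e2lc Y e Z : e2 (lc Y e Z) = e2 Y + e * e2 Z by rewrite /e2 /lc; ring.
pose D := e1 Y1 * e2 Y2 - e2 Y1 * e1 Y2.
have nz c1 c2 : c1 * e1 Y1 + c2 * e1 Y2 = 0 -> c1 * e2 Y1 + c2 * e2 Y2 = 0 ->
    c1 = 0 /\ c2 = 0.
  move=> E1 E2; apply: contrapT => nc; apply: nchr; split => //.
  pose O : nat -> R -> R := fun _ _ => 0.
  have hO : ham lam (fun=> 0) O.
    by move=> x; split; apply: der_eq (der_cst 0 x) _; rewrite /O; ring.
  have bO : bc_left lam O by rewrite /bc_left /O; split; ring.
  pose Y := lc (lc O c1 Y1) c2 Y2; exists Y.
  have hY : ham lam (fun=> 0) Y.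
    have := ham_lc c2 (ham_lc c1 hO h1) h2.
    by under eq_fun do rewrite !mulr0 !addr0.
  split => //; first by apply: bc_left_lc => //; apply: bc_left_lc.
    split; first by rewrite -/(e1 Y) /Y !e1lc -[RHS]E1 /e1 /O add0r.
    by rewrite -/(e2 Y) /Y !e2lc -[RHS]E2 /e2 /O; ring.
  apply: contrapT => nx; have Y00 : Y 0%N = fun=> 0.
    apply/funext => x; apply/eqP; apply: contrapT => /negP xn; apply: nx; by exists x.
  have Y10 : Y 1%N (- a) = 0.
    have [d0 _ _ _] := hY (- a); rewrite Y00 in d0.
    exact: der_unique d0 (der_cst 0 (- a)).
  apply: nc; move: Y10 (congr1 (fun f => f (- a)) Y00).
  by rewrite /Y /lc /O y10 y11 y20 y21 => + +; split; lra.
have D0 : D != 0.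
  apply/eqP => D0.
  have [z1 z2] := nz (e1 Y2) (- e1 Y1) (ltac:(ring)) (ltac:(rewrite -[RHS]oppr0 -D0 /D; ring)).
  have [z3 z4] := nz (e2 Y2) (- e2 Y1) (ltac:(rewrite -[RHS]D0 /D; ring)) (ltac:(ring)).
  have [] := nz 1 0; first by rewrite mul0r addr0 mul1r; lra.
    by rewrite mul0r addr0 mul1r; lra.
  by move/eqP; rewrite oner_eq0.
split.
  move=> h B ch hB.
  have [Z [Z0 hZ]] := @ham_ex lam h B (- a) (fun=> 0) ch hB.
  have bZ : bc_left lam Z by rewrite /bc_left !Z0//; split; ring.
  pose c1 := - (e1 Z * e2 Y2 - e2 Z * e1 Y2) / D.
  pose c2 := - (e1 Y1 * e2 Z - e2 Y1 * e1 Z) / D.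
  exists (lc (lc Z c1 Y1) c2 Y2); split.
  - have := ham_lc c2 (ham_lc c1 hZ h1) h2.
    by under eq_fun do rewrite !mulr0 !addr0.
  - by apply: bc_left_lc => //; apply: bc_left_lc.
  - split; first rewrite -/(e1 _) !e1lc; last rewrite -/(e2 _) !e2lc;
    by rewrite /c1 /c2 /D; field.
have [L L0 hL] := ham_bound lam.
pose N1 := \sum_(i < 4) Y1 i (- a) ^+ 2; pose N2 := \sum_(i < 4) Y2 i (- a) ^+ 2.
have N10 : 0 <= N1 by rewrite sumr_ge0// => i _; exact: sqr_ge0.
have N20 : 0 <= N2 by rewrite sumr_ge0// => i _; exact: sqr_ge0.
have I0 : I (fun=> 0 ^+ 2) = 0.
  have -> : (fun=> 0 ^+ 2) = (fun=> 0) :> (R -> R) by apply/funext => x; rewrite expr0n.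
  by have -> := itg_FTC na0 (@ct_cst R 0) (fun x _ => der_cst 0 x); rewrite subrr.
(* From (x + y)^2 <= 2 x^2 + 2 y^2: [G] bounds the square of [e2] relative to those of the
   components, and [K1], [K2] those of the Cramer coefficients. *)
pose G := 2 * (1 + (gam * rp) ^+ 2).
pose K1 := 2 * (e2 Y2 ^+ 2 + G * e1 Y2 ^+ 2) / D ^+ 2.
pose K2 := 2 * (G * e1 Y1 ^+ 2 + e2 Y1 ^+ 2) / D ^+ 2.
have G0 : 0 <= G by rewrite mulr_ge0// addr_ge0 ?sqr_ge0.
have K10 : 0 <= K1.
  by rewrite divr_ge0 ?sqr_ge0// mulr_ge0// addr_ge0 ?sqr_ge0// mulr_ge0 ?sqr_ge0.
have K20 : 0 <= K2.
  by rewrite divr_ge0 ?sqr_ge0// mulr_ge0// addr_ge0 ?sqr_ge0// mulr_ge0 ?sqr_ge0.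
exists (3 * (L + K1 * L * (L * N1) + K2 * L * (L * N2))).
  apply: mulr_ge0 => //; apply: addr_ge0; first apply: addr_ge0 => //;
  by apply: mulr_ge0; apply: mulr_ge0.
move=> h Y ch hY bY [r1 r2] x xa.
pose c1 := Y 0%N (- a); pose c2 := Y 1%N (- a).
(* [Z] starts from zero at -a and is controlled by the source alone; as [Y] satisfies [bc_right],
   the values of [Z] at 0 determine [c1] and [c2]. *)
pose Z := lc (lc Y (- c1) Y1) (- c2) Y2.
have hZ : ham lam h Z.
  have := ham_lc (- c2) (ham_lc (- c1) hY h1) h2.
  by under eq_fun do rewrite !mulr0 !addr0.
have bZ : bc_left lam Z by apply: bc_left_lc => //; exact: bc_left_lc.
have Z00 : Z 0%N (- a) = 0 by rewrite /Z /lc y10 y20 /c1; ring.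
have Z10 : Z 1%N (- a) = 0 by rewrite /Z /lc y11 y21 /c2; ring.
have Zi i : (i < 4)%N -> Z i (- a) = 0.
  by case: bZ => [z2 z3]; case: i => [|[|[|[|//]]]] _ //; rewrite ?z2 ?z3 Z00 Z10; ring.
set J := I _.
have ZJ j y : (j < 4)%N -> - a <= y <= 0 -> Z j y ^+ 2 <= L * J.
  move=> j4 ya; have := hL _ _ ch hZ _ ya _ j4.
  by rewrite big1 ?add0r// => i _; rewrite Zi// expr0n.
have e1Z : e1 Z = - c1 * e1 Y1 - c2 * e1 Y2.
  by rewrite /Z !e1lc [e1 Y]r1; ring.
have e2Z : e2 Z = - c1 * e2 Y1 - c2 * e2 Y2.
  by rewrite /Z !e2lc [e2 Y]r2; ring.
have c1E : c1 = - (e1 Z * e2 Y2 - e2 Z * e1 Y2) / D by rewrite e1Z e2Z /D; field.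
have c2E : c2 = - (e1 Y1 * e2 Z - e2 Y1 * e1 Z) / D by rewrite e1Z e2Z /D; field.
have z0 : - a <= (0 : R) <= 0 by rewrite na0 lexx.
have b1' : e1 Z ^+ 2 <= L * J by exact: ZJ.
have b2' : e2 Z ^+ 2 <= G * (L * J).
  have w2 := ZJ 2%N 0 isT z0; have w0 := ZJ 0%N 0 isT z0.
  have w0' := ler_wpM2l (sqr_ge0 (gam * rp)) w0.
  have := sqr_ge0 (Z 2%N 0 - gam * rp * Z 0%N 0).
  rewrite /G /e2; move: (gam * rp) w0' => d w0'.
  have -> : (Z 2%N 0 + d * Z 0%N 0) ^+ 2 = 2 * Z 2%N 0 ^+ 2 + 2 * (d ^+ 2 * Z 0%N 0 ^+ 2)
     - (Z 2%N 0 - d * Z 0%N 0) ^+ 2 by ring.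
  by move=> ?; lra.
have D2 : 0 < D ^+ 2 by rewrite exprn_even_gt0.
have c1b : c1 ^+ 2 <= K1 * (L * J).
  rewrite c1E expr_div_n ler_pdivrMr//.
  have -> : K1 * (L * J) * D ^+ 2 = 2 * (e2 Y2 ^+ 2 + G * e1 Y2 ^+ 2) * (L * J).
    by rewrite /K1; field.
  have u1 := ler_wpM2r (sqr_ge0 (e2 Y2)) b1'; have u2 := ler_wpM2r (sqr_ge0 (e1 Y2)) b2'.
  have u3 := sqr_ge0 (e1 Z * e2 Y2 + e2 Z * e1 Y2).
  rewrite sqrrN.
  have -> : (e1 Z * e2 Y2 - e2 Z * e1 Y2) ^+ 2 = 2 * (e1 Z ^+ 2 * e2 Y2 ^+ 2) + 2 * (e2 Z ^+ 2 * e1 Y2 ^+ 2)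
     - (e1 Z * e2 Y2 + e2 Z * e1 Y2) ^+ 2 by ring.
  lra.
have c2b : c2 ^+ 2 <= K2 * (L * J).
  rewrite c2E expr_div_n ler_pdivrMr//.
  have -> : K2 * (L * J) * D ^+ 2 = 2 * (G * e1 Y1 ^+ 2 + e2 Y1 ^+ 2) * (L * J).
    by rewrite /K2; field.
  have u1 := ler_wpM2r (sqr_ge0 (e2 Y1)) b1'; have u2 := ler_wpM2r (sqr_ge0 (e1 Y1)) b2'.
  have u3 := sqr_ge0 (e1 Y1 * e2 Z + e2 Y1 * e1 Z).
  rewrite sqrrN.
  have -> : (e1 Y1 * e2 Z - e2 Y1 * e1 Z) ^+ 2 = 2 * (e2 Z ^+ 2 * e1 Y1 ^+ 2) + 2 * (e1 Z ^+ 2 * e2 Y1 ^+ 2)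
     - (e1 Y1 * e2 Z + e2 Y1 * e1 Z) ^+ 2 by ring.
  lra.
have m1 : Y1 0%N x ^+ 2 <= L * N1 by have := hL _ _ (@ct_cst R 0) h1 _ xa 0%N isT; rewrite I0 addr0.
have m2 : Y2 0%N x ^+ 2 <= L * N2 by have := hL _ _ (@ct_cst R 0) h2 _ xa 0%N isT; rewrite I0 addr0.
have J0 : 0 <= J by apply: itg_ge0 => //; [exact: ctX|move=> y _; exact: sqr_ge0].
have p1 : c1 ^+ 2 * Y1 0%N x ^+ 2 <= K1 * (L * J) * (L * N1).
  by apply: ler_pM; rewrite ?sqr_ge0.
have p2 : c2 ^+ 2 * Y2 0%N x ^+ 2 <= K2 * (L * J) * (L * N2).
  by apply: ler_pM; rewrite ?sqr_ge0.
have p0 := ZJ 0%N x isT xa.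
have -> : Y 0%N x = Z 0%N x + c1 * Y1 0%N x + c2 * Y2 0%N x by rewrite /Z /lc; ring.
move: (Z 0%N x) p0 (Y1 0%N x) p1 (Y2 0%N x) p2 => z p0 y p1 y' p2.
have := sqr_ge0 (z - c1 * y); have := sqr_ge0 (z - c2 * y'); have := sqr_ge0 (c1 * y - c2 * y').
have -> : (z + c1 * y + c2 * y') ^+ 2 = 3 * (z ^+ 2 + c1 ^+ 2 * y ^+ 2 + c2 ^+ 2 * y' ^+ 2)
  - (z - c1 * y) ^+ 2 - (z - c2 * y') ^+ 2 - (c1 * y - c2 * y') ^+ 2 by ring.
lra.
Qed.

(** The eigenfunction is orthogonal to every jet for [Qform L], so adding it keeps that form
    nonpositive. By [Pform_mono] the form at [l] is then strictly negative, since P_l <= (l / L) P_L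
    <= (l / L) C < C once C > 0. *)
Lemma index_ge_chr l L n : 0 < l -> l < L -> chr L -> index_ge L n -> index_ge l n.+1.
Proof.
move=> l0 lL [L0 [Y [hY bl br nz]]] [F [jF FQ]].
set phi := jet_of L Y; have jphi : jet phi := jet_of_jet hY.
have Qphi w : jet w -> Qform L phi w = 0.
  move=> jw; rewrite (weak_form L0 (@ct_cst R 0) hY bl br jw).
  rewrite (@eq_itg _ _ _ na0 _ (fun=> 0))//; first last.
  - by move=> x _; rewrite mul0r.
  - exact: ct_cst.
  - by apply: ctM; [exact: ct_cst|exact: jet0_continuous].
  by have -> := itg_FTC na0 (@ct_cst R 0) (fun x _ => der_cst 0 x); rewrite subrr.
pose F' (i : 'I_n.+1) := if unlift ord0 i is Some j then F j else phi.
have jF' i : jet (F' i) by rewrite /F'; case: unliftP.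
exists F'; split => // c [i ci].
have E : comb F' c = lc (comb F (fun j => c (lift ord0 j))) (c ord0) phi.
  apply/funext => j; apply/funext => x; rewrite /comb /lc big_ord_recl addrC /F' unlift_none.
  by congr (_ + _); apply: eq_bigr => l' _; rewrite liftK.
set v := comb F (fun j => c (lift ord0 j)) in E.
have jv : jet v by exact: jet_comb.
have ju : jet (comb F' c) by exact: jet_comb.
have QL : Qform L (comb F' c) (comb F' c) = Qform L v v.
  by rewrite E Qform_lc// (QformC _ _ _ _ _ _ _ _ _ v phi) !Qphi// !mulr0 !addr0.
have h1 := Pform_mono a_gt0 mu_gt0 k_gt0 rm_gt0 cr r_ge l0 (ltW lL) ju.
(* If the old part of the combination is nontrivial, the strict inequality at [L] gives both facts.
   Otherwise the combination is a multiple of the eigenfunction, where P = C, and C > 0 since its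
   data at -a do not both vanish. *)
have key : Pform L (comb F' c) (comb F' c) <= Cform (comb F' c) (comb F' c) /\
    0 < Cform (comb F' c) (comb F' c).
  have [[j cj]|nj] := pselect (exists j, c (lift ord0 j) != 0).
    have := FQ (fun j => c (lift ord0 j)) (ex_intro _ j cj); rewrite -/v -QL /Qform subr_lt0 => h.
    split; first exact: ltW.
    apply: le_lt_trans h; exact: Pform_ge0.
  have c0 j : c (lift ord0 j) = 0.
    by apply/eqP; apply: contrapT => /negP cj; apply: nj; exists j.
  have v0 : v = fun _ _ => 0.
    apply/funext => j; apply/funext => x; apply: big1 => l' _; by rewrite c0 mul0r.
  have ci0 : c ord0 != 0.
    case: (unliftP ord0 i) ci => [j ->|->//]; by rewrite c0 eqxx.
  have PC : Pform L (comb F' c) (comb F' c) = Cform (comb F' c) (comb F' c).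
    apply/eqP; rewrite -subr_eq0 -/(Qform _ _ _) QL v0.
    have j0 : jet ((fun _ _ => 0) : nat -> R -> R).
      by split; [move=> x; exact: der_cst|move=> x; exact: der_cst|exact: ct_cst].
    set O := (fun _ _ => 0) in j0 *.
    have : Qform L (lc O (-1) O) (lc O (-1) O) =
      Qform L O O + 2 * (-1) * Qform L O O + (-1) ^+ 2 * Qform L O O by exact: Qform_lc.
    set q := Qform L O O; have -> : lc O (-1) O = O.
      by apply/funext => j; apply/funext => x; rewrite /lc mulr0 addr0.
    by rewrite -/q => ?; apply/eqP; lra.
  split; first by rewrite PC.
  rewrite -PC; apply: Pform_gt0 => //.
  have := chr_initial hY bl nz.
  rewrite E v0 /lc !add0r /phi /jet_of/= !mulf_eq0 !negb_or ci0 /=; exact.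
case: key => [PC C0]; rewrite /Qform subr_lt0 -(ltr_pM2l L0).
apply: (le_lt_trans h1); apply: le_lt_trans (_ : l * Cform (comb F' c) (comb F' c) < _).
  by rewrite ler_pM2l.
by rewrite ltr_pM2r.
Qed.

End Hamiltonian.

(** * The sequence of real characteristic values *)

(** The arithmetic of [chr_transfer] with z = u - e v. Moving u from l1 to L costs 6 t Cu <= e J /
    2, and moving z from L to l2 costs 3 t Cz <= e J / 4; both are paid by the gain e J at L. The
    defining equation of [t] encodes these two bounds and [2 * t <= 1]. *)
Lemma perturbed_form_lt0 (F : realFieldType)
    (L l1 l2 e gam G t J Pu1 PuL Cu PzL Pz2 Cz : F) :
  0 < L -> 0 < l1 -> L <= l2 -> 0 < e -> 0 < gam -> 0 < G -> 0 < t -> 2 * t <= 1 ->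
  t * (2 * e + 12 * gam + 24 * gam * G) = e ->
  L - t * L < l1 -> l2 < L + t * L ->
  0 <= Pu1 -> Pu1 < Cu -> Cu <= gam * J -> l1 ^+ 2 * PuL <= L ^+ 2 * Pu1 ->
  PzL - Cz <= PuL - Cu - e * J -> 0 <= PzL -> Cz <= gam * (2 * G * J) ->
  L ^+ 2 * Pz2 <= l2 ^+ 2 * PzL ->
  Pz2 - Cz < 0.
Proof.
move=> L0 l10 h3 e0 gam0 G0 t0 t2 tE h1 h4 Pu0 Pu CuJ P1 Qz Pz0 CzJ P2.
have Jgt0 : 0 < J by rewrite -(pmulr_rgt0 _ gam0); exact: lt_le_trans (le_lt_trans Pu0 Pu) CuJ.
have hPu : PuL <= (1 + 6 * t) * Cu.
  have th1 : L ^+ 2 <= (1 + 6 * t) * l1 ^+ 2.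
    have hl2 : ((1 - t) * L) ^+ 2 <= l1 ^+ 2.
      rewrite ler_pXn2r// ?nnegrE ?(ltW l10)//; first by clear -h1; lra.
      by rewrite mulr_ge0 ?(ltW L0)//; clear -t2 t0; lra.
    apply: le_trans (ler_wpM2l _ hl2); last by clear -t0; lra.
    rewrite exprMn mulrA ler_peMl ?sqr_ge0//.
    have -> : (1 + 6 * t) * (1 - t) ^+ 2 = 1 + t * (1 - 2 * t) * (4 - 3 * t) by ring.
    by rewrite lerDl; clear -t0 t2; apply: mulr_ge0; [apply: mulr_ge0|]; lra.
  rewrite -(ler_pM2l (exprn_gt0 2 l10)); apply: (le_trans P1).
  apply: (le_trans (ler_wpM2r Pu0 th1)).
  rewrite -mulrA mulrCA ler_pM2l ?exprn_gt0// ler_pM2l; first exact: ltW.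
  by clear -t0; lra.
have hPz : Pz2 <= (1 + 3 * t) * PzL.
  have th2 : l2 ^+ 2 <= (1 + 3 * t) * L ^+ 2.
    have hl2 : l2 ^+ 2 <= ((1 + t) * L) ^+ 2.
      rewrite ler_pXn2r// ?nnegrE; first by clear -h4; lra.
        exact: le_trans (ltW L0) h3.
      by rewrite mulr_ge0 ?(ltW L0)//; clear -t0; lra.
    apply: (le_trans hl2); rewrite exprMn ler_wpM2r ?sqr_ge0//.
    have : 0 <= t * (1 - t) by clear -t0 t2; apply: mulr_ge0; lra.
    by clear; lra.
  rewrite -(ler_pM2l (exprn_gt0 2 L0)); apply: (le_trans P2).
  by apply: (le_trans (ler_wpM2r Pz0 th2)); rewrite -mulrA mulrCA.
have [b1 b2] : 12 * (t * gam) <= e /\ 24 * (t * (gam * G)) <= e.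
  have := mulr_gt0 t0 e0; have := mulr_gt0 t0 gam0.
  have := mulr_gt0 t0 (mulr_gt0 gam0 G0).
  by clear -tE => *; split; lra.
have eJ : 0 < e * J by rewrite mulr_gt0.
have QzJ : PzL - Cz <= - (e * J / 2).
  have h5 := ler_wpM2r (ltW Jgt0) b1; have h6 := ler_wpM2l (ltW t0) CuJ.
  by clear -Qz hPu h5 h6; lra.
have tPz : t * PzL <= t * Cz by rewrite ler_pM2l//; clear -QzJ eJ; lra.
have h7 := ler_wpM2r (ltW Jgt0) b2; have h8 := ler_wpM2l (ltW t0) CzJ.
by clear -hPz QzJ tPz h7 h8 eJ; lra.
Qed.

Section CharacteristicSet.
Context {R : realType}.
Variables (a g mu k rm rp S : R) (r s : R -> R).
Hypotheses (a_gt0 : 0 < a) (g_gt0 : 0 < g) (mu_gt0 : 0 < mu) (k_gt0 : 0 < k)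
  (rm_gt0 : 0 < rm) (cr : continuous r) (cs : continuous s)
  (r_ge : forall x, rm <= r x) (r_le : forall x, r x <= rp)
  (s_ge0 : forall x, 0 <= s x) (s_le : forall x, s x <= S)
  (s_dense : forall p q : R, - a <= p -> p < q -> q <= 0 ->
     exists2 x, p < x < q & 0 < s x).
Local Notation I := (itg (- a) 0).
Implicit Types (u v : nat -> R -> R) (l L e x : R) (n : nat).
Local Notation gam := (g * k ^+ 2).
Local Notation ham := (ham g mu k r s).
Local Notation bc_left := (bc_left a mu k rm).
Local Notation bc_right := (bc_right g k rp).
Local Notation jet_of := (jet_of mu k).
Local Notation Qform := (Qform a g mu k rm rp r s).
Local Notation Pform := (Pform a mu k rm r).
Local Notation Cform := (Cform a g k rp s).
Local Notation index_ge := (index_ge a g mu k rm rp r s).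
Local Notation chr := (chr a g mu k rm rp r s).

Let na0 : - a <= 0. Proof. by rewrite oppr_le0 ltW. Qed.

(* The source [s f], with [f] frozen outside [-a, 0] to make it bounded. *)
Definition source (f : R -> R) x := s x * f (Num.max (- a) (Num.min x 0)).

Lemma source_continuous f : continuous f -> continuous (source f).
Proof.
move=> cf; apply: ctM => // x.
apply: (@continuous_comp _ _ _ (fun x : R => Num.max (- a) (Num.min x 0)) f); last exact: cf.
apply: (@continuous_max _ _ (fun=> - a) (fun x => Num.min x 0)); first exact: cvg_cst.
by apply: (@continuous_min _ _ (fun x => x) (fun=> 0)); [exact: cvg_id|exact: cvg_cst].
Qed.

Lemma source_bounded f : continuous f -> exists B, forall x, `|source f x| <= B.
Proof.
move=> cf.
have cn : {within `[- a, 0], continuous (fun x => `|f x|)}.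
  apply: continuous_subspaceT => x; apply: (@continuous_comp _ _ _ f (fun y : R => `|y|)).
    exact: cf.
  exact: norm_continuous.
have [c _ hc] := EVT_max na0 cn.
exists (S * `|f c|) => x; rewrite normrM ger0_norm//.
apply: ler_pM => //; apply: hc.
by rewrite in_itv/= le_max lexx/= ge_max na0/= ge_min lexx orbT.
Qed.

Lemma source_in f x : - a <= x <= 0 -> source f x = s x * f x.
Proof.
by move=> /andP[ax x0]; rewrite /source; rewrite (min_idPl x0) (max_idPr ax).
Qed.

(** Here v solves the problem at [L] with source s u, so Q_L(v, w) is the integral of s u w for
    every w. The correction u - e v is linear in u, and its gain e J is uniform over the space, so
    one [eta] serves for every [n]. *)
Lemma chr_transfer L : 0 < L -> ~ chr L -> exists2 eta, 0 < eta &
  forall l1 l2 n, 0 < l1 -> L - eta < l1 -> l1 <= L -> L <= l2 -> l2 < L + eta ->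
  index_ge l1 n -> index_ge l2 n.
Proof.
move=> L0 nchr.
have [hex [C C0 hC]] : (forall h B, continuous h -> (forall x, `|h x| <= B) ->
    exists Y, [/\ ham L h Y, bc_left L Y & bc_right Y]) /\
  exists2 C, 0 <= C & forall h Y, continuous h -> ham L h Y -> bc_left L Y ->
    bc_right Y -> forall x, - a <= x <= 0 -> Y 0%N x ^+ 2 <= C * I (fun x => h x ^+ 2).
  by apply: not_chr_resolvent; eassumption.
have S0 : 0 <= S by exact: le_trans (s_ge0 0) (s_le 0).
pose C1 := a * (S * (C * S)).
have C10 : 0 <= C1 by rewrite mulr_ge0 ?(ltW a_gt0)// mulr_ge0// mulr_ge0.
have gam0 : 0 < gam by rewrite mulr_gt0 ?exprn_gt0.
have est u Y : jet u -> ham L (source (u 0%N)) Y -> bc_left L Y -> bc_right Y ->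
    I (dC s (jet_of L Y) (jet_of L Y)) <= C1 * I (dC s u u).
  move=> ju hY bl br; have cu := jet0_continuous ju.
  have csu := source_continuous cu.
  have cC := dC_continuous cs ju ju.
  have h1 : I (fun x => source (u 0%N) x ^+ 2) <= S * I (dC s u u).
    rewrite -itgZ//; apply: le_itg => //; first exact: ctX.
      by apply: ctM => //; exact: ct_cst.
    move=> x xa; rewrite source_in// /dC exprMn -expr2 mulrA ler_wpM2r ?sqr_ge0//.
    by rewrite expr2 ler_wpM2r.
  have h2 := hC _ _ csu hY bl br.
  set N := I _ in h1 h2.
  have N0 : 0 <= N by apply: itg_ge0 => //; [exact: ctX|move=> x _; exact: sqr_ge0].
  have jv := jet_of_jet hY.
  have h3 : I (dC s (jet_of L Y) (jet_of L Y)) <= I (fun=> S * (C * N)).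
    apply: le_itg => //; [exact: dC_continuous|exact: ct_cst|].
    move=> x xa; rewrite /dC /= -expr2 ler_pM ?sqr_ge0//; exact: h2.
  have h4 : I (fun=> S * (C * N)) = a * (S * (C * N)).
    have -> := itg_FTC na0 (@ct_cst R (S * (C * N))) (F := fun x => S * (C * N) * x)
       (fun x _ => der_eq (derZ _ (der_id x)) (mulr1 _)).
    by ring.
  apply: (le_trans h3); rewrite h4 /C1 -!mulrA ler_wpM2l ?(ltW a_gt0)// ler_wpM2l//.
  by rewrite ler_wpM2l.
(* Since Q_L(v, v) <= (1 + C1) / 2 J, this value makes e^2 Q_L(v, v) at most e J, half of the linear
   gain 2 e J. *)
pose e := 2 / (1 + C1).
have e0 : 0 < e by rewrite divr_gt0//; lra.
pose G := 1 + e ^+ 2 * C1.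
have G0 : 0 < G by rewrite /G ltr_pwDl// mulr_ge0 ?sqr_ge0.
pose t := e / (2 * e + 12 * gam + 24 * gam * G).
have gG : 0 < gam * G by rewrite mulr_gt0.
have den0 : 0 < 2 * e + 12 * gam + 24 * gam * G by lra.
have t0 : 0 < t by rewrite divr_gt0.
have tE : t * (2 * e + 12 * gam + 24 * gam * G) = e by rewrite divfK ?gt_eqF.
have te0 := mulr_gt0 t0 e0; have tg0 := mulr_gt0 t0 gam0; have tG0 := mulr_gt0 t0 gG.
have t2 : 2 * t <= 1.
  rewrite -(ler_pM2r e0); lra.
exists (t * L); first exact: mulr_gt0.
move=> l1 l2 n l10 h1 h2 h3 h4 [F [jF FQ]].
have [Y hY] : exists Y : 'I_n -> nat -> R -> R, forall i,
    [/\ ham L (source (F i 0%N)) (Y i), bc_left L (Y i) & bc_right (Y i)].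
  have H i : exists Y, [/\ ham L (source (F i 0%N)) Y, bc_left L Y & bc_right Y].
    have cF := jet0_continuous (jF i); have [B hB] := source_bounded cF.
    exact: hex (source_continuous cF) hB.
  exists (fun i => projT1 (cid (H i))) => i; exact: (projT2 (cid (H i))).
pose V i := jet_of L (Y i).
have jV i : jet (V i) by have [h _ _] := hY i; exact: jet_of_jet h.
exists (fun i => lc (F i) (- e) (V i)); split; first by move=> i; exact: jet_lc.
move=> c cn; have FQc := FQ c cn.
have -> : comb (fun i => lc (F i) (- e) (V i)) c = lc (comb F c) (- e) (comb V c).
  apply/funext => j; apply/funext => x; rewrite /comb /lc mulr_sumr -big_split/=.
  by apply: eq_bigr => i _; ring.
set u := comb F c in FQc *; set v := comb V c.
have ju : jet u by exact: jet_comb.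
have jv : jet v by exact: jet_comb.
have vE : v = jet_of L (comb Y c).
  apply/funext => j; apply/funext => x; rewrite /v /comb /V /jet_of.
  case: (j == 2%N) => //=; rewrite mulr_suml mulr_sumr -sumrB.
  by apply: eq_bigr => i _; ring.
have sE : (fun x => \sum_i c i * source (F i 0%N) x) = source (u 0%N).
  by apply/funext => x; rewrite /source /u /comb mulr_sumr; apply: eq_bigr => i _; ring.
have hv : ham L (source (u 0%N)) (comb Y c).
  by rewrite -sE; apply: ham_comb => i; have [] := hY i.
have blv : bc_left L (comb Y c) by apply: bc_left_comb => i; have [] := hY i.
have brv : bc_right (comb Y c) by apply: bc_right_comb => i; have [] := hY i.
have csu := source_continuous (jet0_continuous ju).
have weak w : jet w -> Qform L v w = I (fun x => source (u 0%N) x * w 0%N x).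
  by move=> jw; rewrite vE; exact: weak_form.
set J := I (dC s u u).
have J0 : 0 <= J by exact: dC_ge0.
have Qvu : Qform L u v = J.
  rewrite QformC weak//; apply: eq_itg => //.
  - by apply: ctM => //; exact: jet0_continuous.
  - exact: dC_continuous.
  - by move=> x xa; rewrite source_in// /dC; ring.
have Jv : I (dC s v v) <= C1 * J by rewrite vE; exact: est.
have Qvv : Qform L v v <= (1 + C1) / 2 * J.
  rewrite weak//.
  have cw := dC_continuous cs ju ju; have cv := dC_continuous cs jv jv.
  have ch : continuous (fun x => 2^-1 * dC s u u x + 2^-1 * dC s v v x).
    by apply: ctD; apply: ctM => //; exact: ct_cst.
  apply: (@le_trans _ _ (I (fun x => 2^-1 * dC s u u x + 2^-1 * dC s v v x))).
    apply: le_itg => //; first by apply: ctM => //; exact: jet0_continuous.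
    move=> x xa; rewrite source_in// /dC -subr_ge0.
    have -> : 2^-1 * (s x * (u 0%N x * u 0%N x)) + 2^-1 * (s x * (v 0%N x * v 0%N x)) - s x * u 0%N x * v 0%N x
      = 2^-1 * (s x * (u 0%N x - v 0%N x) ^+ 2) by field.
    by rewrite mulr_ge0// mulr_ge0 ?sqr_ge0.
  rewrite (itg_lin2 na0 cw cv ch (fun x _ => erefl _)) -/J; lra.
set z := lc u (- e) v.
have jz : jet z by exact: jet_lc.
have Qz : Qform L z z <= Qform L u u - e * J.
  rewrite /z Qform_lc// Qvu sqrrN.
  have : e ^+ 2 * Qform L v v <= e * J.
    have -> : e * J = e ^+ 2 * ((1 + C1) / 2 * J).
      rewrite /e; field; lra.
    by rewrite ler_wpM2l ?sqr_ge0.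
  lra.
have Cz : Cform z z <= gam * (2 * G * J).
  apply: (le_trans (Cform_le a s g_gt0 k_gt0 rm_gt0 r_ge r_le z)); rewrite ler_pM2l//.
  have cw := dC_continuous cs ju ju; have cv := dC_continuous cs jv jv.
  have ch : continuous (fun x => 2 * dC s u u x + 2 * e ^+ 2 * dC s v v x).
    by apply: ctD; apply: ctM => //; exact: ct_cst.
  apply: (@le_trans _ _ (I (fun x => 2 * dC s u u x + 2 * e ^+ 2 * dC s v v x))).
    apply: le_itg => //; first exact: dC_continuous.
    move=> x _; rewrite /dC /z /lc -subr_ge0.
    set y := u 0%N x; set y' := v 0%N x.
    have -> : 2 * (s x * (y * y)) + 2 * e ^+ 2 * (s x * (y' * y')) - s x * ((y + - e * y') * (y + - e * y'))
      = s x * (y + e * y') ^+ 2 by ring.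
    by rewrite mulr_ge0 ?sqr_ge0.
  rewrite (itg_lin2 na0 cw cv ch (fun x _ => erefl _)) -/J /G.
  have := ler_wpM2l (sqr_ge0 e) Jv; lra.
have Cu : Cform u u <= gam * J by exact: (Cform_le a s g_gt0 k_gt0 rm_gt0 r_ge r_le u).
have Pu0 := Pform_ge0 a_gt0 mu_gt0 k_gt0 rm_gt0 cr r_ge l10 ju.
have Pu : Pform l1 u u < Cform u u by rewrite -subr_lt0.
have Jgt0 : 0 < J.
  have : 0 < gam * J by exact: lt_le_trans (le_lt_trans Pu0 Pu) Cu.
  by rewrite pmulr_rgt0.
have P1 := Pform_scale r a_gt0 mu_gt0 k_gt0 rm_gt0 l10 h2 ju.
have P2 := Pform_scale r a_gt0 mu_gt0 k_gt0 rm_gt0 L0 h3 jz.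
have Pz0 := Pform_ge0 a_gt0 mu_gt0 k_gt0 rm_gt0 cr r_ge L0 jz.
exact: (perturbed_form_lt0 L0 l10 h3 e0 gam0 G0 t0 t2 tE h1 h4 Pu0 Pu Cu P1 Qz Pz0 Cz P2).
Qed.

Lemma chr_sequence : exists lam : nat -> R, [/\ forall n, 0 < lam n,
  forall n, lam n.+1 < lam n, lam @ \oo --> (0 : R) &
  forall x, chr x <-> exists n, x = lam n].
Proof.
have S0 : 0 <= S by exact: le_trans (s_ge0 0) (s_le 0).
have mesh l : 0 < l -> exists2 N, (0 < N)%N & forall n l', l <= l' -> index_ge l' n -> (n <= N)%N.
  (* [N] exceeds [X] and N <= N^2, so the mesh a / N meets the requirement of [index_le] at [l],
     hence at every larger parameter. *)
  move=> l0; pose X := g * S * a ^+ 2 / (l * mu).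
  have lm0 : 0 < l * mu by rewrite mulr_gt0.
  have X0 : 0 <= X by rewrite divr_ge0 ?(ltW lm0)// mulr_ge0 ?sqr_ge0// mulr_ge0// ltW.
  have := truncnS_gt X; set N := (_.+1) => XN; exists N => // n l' ll'.
  apply: index_le => //; first exact: lt_le_trans l0 ll'.
  have N0 : (0 : R) < N%:R by rewrite ltr0n.
  apply: (@le_trans _ _ (l * mu)); last by rewrite ler_pM2r.
  rewrite expr_div_n mulrA ler_pdivrMr ?exprn_gt0//.
  have XE : g * S * a ^+ 2 = X * (l * mu) by rewrite /X divfK// gt_eqF.
  rewrite XE mulrC ler_pM2l//; apply: (le_trans (ltW XN)).
  by rewrite expr2 ler_peMl ?ler0n// ler1n.
(* The index of [l], as a maximum over the range allowed by [mesh], bound included; as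
   [index_ge l 0] holds, the maximum is itself admissible. *)
pose nu l := \max_(n < (if pselect (0 < l) is left h then
    s2val (cid2 (mesh l h)) else 0%N).+1 | `[< index_ge l n >]) n.
have nuP l n : 0 < l -> index_ge l n -> (n <= nu l)%N.
  move=> l0 hn; rewrite /nu; case: pselect => // h; case: cid2 => N N0 hN /=.
  have nN : (n < N.+1)%N by rewrite ltnS (hN n l).
  by rewrite (bigD1 (Ordinal nN)) ?asboolE//= leq_maxl.
have nuI l : 0 < l -> index_ge l (nu l).
  move=> l0; rewrite /nu.
  have i0 : index_ge l 0%N.
    by exists (fun _ _ _ => 0); split=> [[]//|c [[]//]].
  by elim/big_ind: _ => [//|p q hp hq|n /asboolP//]; rewrite /maxn; case: ifP.
apply: (@decreasing_enumeration R chr nu).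
- by move=> x [].
- move=> x y [x0 hx] hy xy; have [y0 _] := hy.
  by apply: nuP => //; apply: index_ge_chr xy hy (nuI _ y0).
- move=> d d0; apply: contrapT => hno.
  have d20 : 0 < d / 2 by lra.
  have [N N0 hN] := mesh _ d20.
  have [l0 l00 hl0] : exists2 l, 0 < l & index_ge l N.+1 by apply: index_ge_exists.
  (* [N] bounds the index from d/2 on, so [T] lies below d/2. If its supremum were not
     characteristic, [chr_transfer] would carry index N + 1 from just below it to a point above
     it. *)
  pose T := [set l | 0 < l /\ index_ge l N.+1].
  have Tub : ubound T (d / 2).
    move=> l [_ hl]; rewrite leNgt; apply/negP => dl.
    by have := hN _ _ (ltW dl) hl; rewrite ltnn.
  have Tl0 : T l0 by [].
  have hs : has_sup T by split; [exists l0|exists (d / 2)].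
  have l0L : l0 <= sup T by apply: ub_le_sup => //; exists (d / 2).
  have Ld : sup T <= d / 2 by apply: ge_sup => //; exists l0.
  have L0 : 0 < sup T by exact: lt_le_trans l00 l0L.
  have nchr : ~ chr (sup T) by move=> hc; apply: hno; exists (sup T) => //; lra.
  have [eta eta0 heta] := chr_transfer L0 nchr.
  have [l1 [l10 hl1] l1L] := sup_adherent eta0 hs.
  have l1L' : l1 <= sup T by apply: ub_le_sup => //; exists (d / 2).
  have : T (sup T + eta / 2).
    split; first lra.
    by apply: (heta l1) => //; lra.
  move=> /(ub_le_sup (ex_intro _ _ Tub)); lra.
Qed.

End CharacteristicSet.

(** * From weak to classical eigenfunctions *)

Section Profile.
Context {R : realType}.
Variables (a rm rp : R) (rho : R -> R).
Hypotheses (a_gt0 : 0 < a) (rhoP : density_assumption a rm rp rho).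

(** Freezing rho and rho' at their boundary values for x >= 0 gives bounded continuous coefficients
    on the whole line. Beyond 0, [ext_s] is the limit of rho' and need not be the derivative of
    [ext_r]. *)
Definition ext_r (x : R) : R := rho (Num.min x 0).

Definition ext_s (x : R) : R :=
  if x < 0 then derive1 rho x else lim (derive1 rho z @[z --> 0^'-]).

Lemma ext_r_lt0 x : x < 0 -> ext_r x = rho x.
Proof. by move=> x0; rewrite /ext_r (min_idPl (ltW x0)). Qed.

Lemma ext_s_lt0 x : x < 0 -> ext_s x = derive1 rho x.
Proof. by move=> x0; rewrite /ext_s x0. Qed.

Lemma ext_r0 : ext_r 0 = rp.
Proof. by rewrite /ext_r minxx (density_plus rhoP). Qed.

Lemma der_rho (x : R) : x < 0 -> is_derive x 1 rho (ext_s x).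
Proof.
move=> x0; rewrite ext_s_lt0//; apply: derivable_der.
by have [h _] := density_smooth rhoP; exact: (h 0%N).
Qed.

Lemma der_ext_r (x : R) : x < 0 -> is_derive x 1 ext_r (ext_s x).
Proof.
move=> x0; apply: (der_near (der_rho x0)); near=> y; rewrite ext_r_lt0//.
by near: y; exact: lt_nbhsl.
Unshelve. all: by end_near. Qed.

Lemma continuous_ext0 (f : R -> R) : (forall x, x < 0 -> {for x, continuous f}) ->
  (forall x, 0 <= x -> f x = f 0) -> f x @[x --> 0^'-] --> f 0 -> continuous f.
Proof.
move=> cf fc f0 x; have [x0|x0|->] := ltrgtP x 0.
- exact: cf.
- rewrite /continuous_at (fc x (ltW x0)); apply: cvg_near_cst; near=> y.
  by apply: fc; apply/ltW; near: y; exact: lt_nbhsr.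
- apply/left_right_continuousP; split => //.
  apply: cvg_near_cst; near=> y; apply: fc.
  by near: y; exact: nbhs_right_ge.
Unshelve. all: by end_near. Qed.

Lemma ext_r_continuous : continuous ext_r.
Proof.
apply: continuous_ext0 => [x x0|x x0|].
- exact: der_continuous (der_ext_r x0).
- by rewrite /ext_r minxx (min_idPr x0).
- have [_ [_ h]] := density_smooth rhoP.
  have -> : ext_r 0 = rho 0 by rewrite /ext_r minxx.
  apply: cvg_trans h; apply: near_eq_cvg; near=> y.
  by rewrite ext_r_lt0//; near: y; exact: nbhs_left_lt.
Unshelve. all: by end_near. Qed.

Lemma ext_s_continuous : continuous ext_s.
Proof.
have [h1 [h2 _]] := density_smooth rhoP.
apply: continuous_ext0 => [x x0|x x0|].
- have := derivable_der (h1 1%N x x0) => /der_continuous c.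
  apply: (cvg_trans _ (_ : derive1 rho z @[z --> x] --> ext_s x)).
    apply: near_eq_cvg; near=> y; rewrite ext_s_lt0//.
    by near: y; exact: lt_nbhsl.
  by rewrite ext_s_lt0.
- by rewrite /ext_s ltxx ltNge x0.
- rewrite {2}/ext_s ltxx.
  apply: cvg_trans (h2 1%N); apply: near_eq_cvg; near=> y.
  by rewrite ext_s_lt0//; near: y; exact: nbhs_left_lt.
Unshelve. all: by end_near. Qed.

Lemma ge0_lim_left (f : R -> R) : continuous f -> (forall x, x < 0 -> 0 <= f x) -> 0 <= f 0.
Proof.
move=> cf f0; rewrite leNgt; apply/negP => fn.
have /cvgrPdist_lt/(_ (- f 0)) := cf 0.
rewrite oppr_gt0 => /(_ fn)/nbhs_ballP[e /= e0 he].
have := he (- (e / 2)); rewrite /ball/= sub0r opprK gtr0_norm ?divr_gt0//.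
have e2 : e / 2 < e by rewrite ltr_pdivrMr// ltr_pMr// ltr1n.
move=> /(_ e2).
have := f0 (- (e / 2)) (ltac:(by rewrite oppr_lt0 divr_gt0)).
by rewrite ltr_norml => h1 /andP[h2 _]; lra.
Qed.

Lemma ext_s_ge0 x : 0 <= ext_s x.
Proof.
have H y : y < 0 -> 0 <= ext_s y.
  by move=> y0; rewrite ext_s_lt0//; exact: density_incr rhoP y y0.
have [x0|x0] := ltP x 0; first exact: H.
have := ge0_lim_left ext_s_continuous H.
by rewrite /ext_s ltxx ltNge x0.
Qed.

Lemma ext_r_mono x y : x <= y -> ext_r x <= ext_r y.
Proof.
move=> xy; have H u v : u <= v -> v < 0 -> ext_r u <= ext_r v.
  move=> uv v0; apply: (ndecr_der uv (f' := ext_s)).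
    by move=> z /andP[_ zv]; apply: der_ext_r; exact: le_lt_trans zv v0.
  by move=> z _; exact: ext_s_ge0.
have H0 u : u < 0 -> ext_r u <= ext_r 0.
  move=> u0; rewrite -subr_ge0.
  have -> : ext_r 0 = ext_r (Num.max 0 u) by rewrite (max_idPl (ltW u0)).
  apply: (@ge0_lim_left (fun z => ext_r (Num.max z u) - ext_r u)).
  - move=> z; apply: cvgB; last exact: cvg_cst.
    apply: (@continuous_comp _ _ _ (fun z : R => Num.max z u) ext_r); last exact: ext_r_continuous.
    by apply: (@continuous_max _ _ (fun z => z) (fun=> u)); [exact: cvg_id|exact: cvg_cst].
  - by move=> z z0; rewrite subr_ge0; apply: H; rewrite ?le_max ?lexx ?orbT// gt_max z0.
have [y0|y0] := ltP y 0; first exact: H.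
have -> : ext_r y = ext_r 0 by rewrite /ext_r minxx (min_idPr y0).
have [x0|x0] := ltP x 0; first exact: H0.
by rewrite /ext_r minxx (min_idPr x0).
Qed.

Lemma ext_r_le_a x : x <= - a -> ext_r x = rm.
Proof.
move=> xa; have x0 : x < 0 by apply: le_lt_trans xa _; rewrite oppr_lt0.
by rewrite ext_r_lt0// (density_minus rhoP).
Qed.

Lemma ext_r_ge x : rm <= ext_r x.
Proof.
have [xa|xa] := leP x (- a); first by rewrite ext_r_le_a.
by rewrite -(ext_r_le_a (lexx (- a))); apply: ext_r_mono; exact: ltW.
Qed.

Lemma ext_r_le x : ext_r x <= rp.
Proof.
rewrite -ext_r0; have [x0|x0] := leP x 0; first exact: ext_r_mono.
by rewrite /ext_r minxx (min_idPr (ltW x0)).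
Qed.

Lemma ext_s_lt_a x : x < - a -> ext_s x = 0.
Proof.
move=> xa; have x0 : x < 0 by apply: lt_trans xa _; rewrite oppr_lt0.
apply: der_unique (der_rho x0) _; apply: (der_near (der_cst rm x)).
near=> y; rewrite (density_minus rhoP)//; apply/ltW; near: y.
exact: lt_nbhsl.
Unshelve. all: by end_near. Qed.

Lemma ext_s_bounded : exists S, forall x, ext_s x <= S.
Proof.
have aa := a_gt0; have a0 : - (a + 1) <= 0 by rewrite oppr_le0; lra.
have [c _ hc] := EVT_max a0 (continuous_subspaceT ext_s_continuous).
exists (ext_s c) => x.
have [xa|xa] := ltP x (- (a + 1)).
  by rewrite ext_s_lt_a ?ext_s_ge0//; lra.
have [x0|x0] := leP x 0; first by apply: hc; rewrite in_itv/= xa x0.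
have -> : ext_s x = ext_s 0 by rewrite /ext_s ltxx ltNge (ltW x0).
by apply: hc; rewrite in_itv/= a0 lexx.
Qed.

Lemma ext_s_dense p q : - a <= p -> p < q -> q <= 0 -> exists2 x, p < x < q & 0 < ext_s x.
Proof.
move=> ap pq q0; pose m := (p + q) / 2.
have hm : (closure [set x | x < 0 /\ derive1 rho x != 0]) m.
  rewrite (density_supp rhoP) /= in_itv/=; apply/andP; split; rewrite /m; lra.
have [|y [[y0 yn] hy]] := hm (ball m ((q - p) / 2)).
  by apply: nbhsx_ballx; lra.
exists y.
  move: hy; rewrite /ball/= ltr_norml /m => /andP[h1 h2]; apply/andP; split; lra.
by rewrite lt_neqAle eq_sym ext_s_lt0// yn -ext_s_lt0// ext_s_ge0.
Qed.

End Profile.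

(** * Weak derivatives on the half-line *)

Section WeakDerivatives.
Context {R : realType}.
Local Notation leb := (@lebesgue_measure R).
Local Notation D := (`]-oo, 0[%classic : set R).
Implicit Types (f g h : R -> R) (theta : R -> R) (p q b c x : R).

Lemma Rint_seg G p q : p < q -> continuous G ->
  \int[leb]_(x in `[p, q]) G x = itg p q G.
Proof.
move=> pq cG; have dF (x : R) := der_prim p x cG.
rewrite /Rintegral (@continuous_FTC2 _ G (prim p G))//.
- by rewrite /itg prim0//= subr0.
- exact: continuous_subspaceT.
- have cF := @prim_continuous R p G cG; split.
  + by move=> x _; have [] := dF x.
  + by apply: cvg_at_right_filter; exact: cF.
  + by apply: cvg_at_left_filter; exact: cF.
- by move=> x _; exact: der1E.
Qed.

Lemma D_seg p q : q < 0 -> D `&` `[p, q] = `[p, q]%classic.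
Proof.
move=> q0; apply/seteqP; split => [x []//|x /=]; rewrite !in_itv/= => /andP[px xq].
by rewrite px xq (le_lt_trans xq q0).
Qed.

Lemma restrict_support (G : R -> R) p q :
  (forall x, x <= p \/ q <= x -> G x = 0) -> G = G \_ `[p, q].
Proof.
move=> G0; apply/funext => x; rewrite patchE; case: ifPn => //.
rewrite notin_setE /= in_itv/= => /negP; rewrite negb_and -!ltNge => /orP[] h.
  by rewrite G0//; left; exact: ltW.
by rewrite G0//; right; exact: ltW.
Qed.

Lemma integrable_support G p q : q < 0 -> continuous G ->
  (forall x, x <= p \/ q <= x -> G x = 0) -> leb.-integrable D (EFin \o G).
Proof.
move=> q0 cG G0.
have -> : EFin \o G = (EFin \o G) \_ `[p, q].
  by rewrite {1}(restrict_support G0) -restrict_EFin.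
apply/integrable_restrict => //; rewrite D_seg//.
exact: continuous_integrable_seg.
Qed.

Lemma Rint_support G p q : p < q -> q < 0 -> continuous G ->
  (forall x, x <= p \/ q <= x -> G x = 0) -> \int[leb]_(x in D) G x = itg p q G.
Proof.
move=> pq q0 cG G0; rewrite -Rint_seg// -(D_seg p q0) Rintegral_mkcondr.
by rewrite -(restrict_support G0).
Qed.

Lemma continuous_minr f c : (forall x, x <= c -> {for x, continuous f}) ->
  continuous (fun x => f (Num.min x c)).
Proof.
move=> cf x; apply: (@continuous_comp _ _ _ (fun x : R => Num.min x c) f).
  by apply: (@continuous_min _ _ (fun x => x) (fun=> c)); [exact: cvg_id|exact: cvg_cst].
by apply: cf; rewrite ge_min lexx orbT.
Qed.

Lemma test_halflineP theta : test_halfline theta ->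
  [/\ forall x, is_derive x 1 theta (derive1 theta x), continuous theta,
      continuous (derive1 theta) & exists b c, [/\ b < c, c < 0 &
        forall x, x <= b \/ c <= x -> theta x = 0 /\ derive1 theta x = 0]].
Proof.
move=> [sth [b [c [c0 hbc]]]].
have d0 x : is_derive x 1 theta (derive1 theta x) by apply: derivable_der; exact: (sth 0%N).
have d1 x : is_derive x 1 (derive1 theta) (derive1 (derive1 theta) x).
  by apply: derivable_der; exact: (sth 1%N).
split => //; [by move=> x; exact: der_continuous (d0 x)|by move=> x; exact: der_continuous (d1 x)|].
have z x : x < b \/ c < x -> theta x = 0.
  move=> h; apply/eqP; apply: contrapT => /negP /hbc /andP[h1 h2]; case: h; lra.
exists (Num.min (b - 1) (c - 1)), (c / 2); split.
- by rewrite gt_min; apply/orP; right; lra.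
- lra.
- move=> x h.
  have {}h : x < b \/ c < x.
    case: h => h; [left|right]; last by lra.
    by move: h; rewrite le_min => /andP[h _]; lra.
  split; first exact: z.
  apply: der_unique (d0 x) _; apply: (der_near (der_cst 0 x)).
  case: h => h; near=> y; apply/esym/z.
    have : y < b by near: y; exact: lt_nbhsl.
    by left.
  have : c < y by near: y; exact: lt_nbhsr.
  by right.
Unshelve. all: by end_near. Qed.

(** From square integrability only integrability against test functions is kept, which is what
    splitting the integrals of linear combinations requires. *)
Definition wder f g := [/\ measurable_fun D f, measurable_fun D g &
  forall theta, test_halfline theta ->
    [/\ leb.-integrable D (EFin \o (fun x => f x * derive1 theta x)),
        leb.-integrable D (EFin \o (fun x => g x * theta x)) &
     \int[leb]_(x in D) (f x * derive1 theta x) = - \int[leb]_(x in D) (g x * theta x)]].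

Lemma integrable_L2_test f th p q : L2 leb D f -> q < 0 -> continuous th ->
  (forall x, x <= p \/ q <= x -> th x = 0) ->
  leb.-integrable D (EFin \o (fun x => f x * th x)).
Proof.
move=> [mf if2] q0 cth th0.
have mD : measurable (D : set (measurableTypeR R)) by exact: measurable_itv.
have ith : leb.-integrable D (EFin \o (fun x => th x ^+ 2)).
  apply: (integrable_support (p := p) q0); first exact: ctX.
  by move=> x /th0 ->; rewrite expr0n.
have isum := integrableD mD if2 ith.
apply: le_integrable isum => //.
  apply/measurable_EFinP; apply: measurable_funM => //.
  by apply: measurable_funTS; exact: continuous_measurable_fun.
move=> x _; rewrite /= lee_fin ler_norml.
rewrite (ger0_norm (addr_ge0 (sqr_ge0 _) (sqr_ge0 _))).
have := sqr_ge0 (f x + th x); have := sqr_ge0 (f x - th x).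
have := sqr_ge0 (f x); have := sqr_ge0 (th x).
by move=> ? ? ? ?; apply/andP; split; nra.
Qed.

Lemma weak_wder f g : weak_derivative f g -> wder f g.
Proof.
move=> [Lf Lg E]; split; [by case: Lf|by case: Lg|] => theta th.
have [d0 c0 c1 [b [c [bc c_lt0 z]]]] := test_halflineP th; split.
- by apply: (integrable_L2_test (p := b) Lf c_lt0 c1) => x /z[].
- by apply: (integrable_L2_test (p := b) Lg c_lt0 c0) => x /z[].
- exact: E.
Qed.

Lemma wder_lin (al be : R) f g f' g' : wder f g -> wder f' g' ->
  wder (fun x => al * f x + be * f' x) (fun x => al * g x + be * g' x).
Proof.
move=> [mf mg E] [mf' mg' E']; have mD : measurable (D : set (measurableTypeR R)) by exact: measurable_itv.
have mlin u v : measurable_fun D u -> measurable_fun D v ->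
    measurable_fun D (fun x : R => al * u x + be * v x).
  by move=> mu mv; apply: measurable_funD; apply: measurable_funM.
have ilin u v : leb.-integrable D (EFin \o u) -> leb.-integrable D (EFin \o v) ->
    leb.-integrable D (EFin \o (fun x => al * u x + be * v x)).
  move=> iu iv.
  have := integrableD mD (integrableZl mD al iu) (integrableZl mD be iv).
  by apply: eq_integrable.
have Rlin u v : leb.-integrable D (EFin \o u) -> leb.-integrable D (EFin \o v) ->
    \int[leb]_(x in D) (al * u x + be * v x) =
    al * \int[leb]_(x in D) u x + be * \int[leb]_(x in D) v x.
  move=> iu iv; rewrite RintegralD//; last 2 first.
  - by have := integrableZl mD al iu; exact: eq_integrable.
  - by have := integrableZl mD be iv; exact: eq_integrable.
  by rewrite !RintegralZl.
split; [exact: mlin|exact: mlin|] => theta th.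
have [i1 i2 e1] := E _ th; have [i1' i2' e2] := E' _ th.
have r1 : (fun x => (al * f x + be * f' x) * derive1 theta x) =
  (fun x => al * (f x * derive1 theta x) + be * (f' x * derive1 theta x)).
  by apply/funext => x; ring.
have r2 : (fun x => (al * g x + be * g' x) * theta x) =
  (fun x => al * (g x * theta x) + be * (g' x * theta x)).
  by apply/funext => x; ring.
split; [by rewrite r1; exact: ilin|by rewrite r2; exact: ilin|].
by rewrite r1 r2 !Rlin// e1 e2; ring.
Qed.

(** The lemma of du Bois-Reymond: f minus a primitive of h has zero weak derivative, and continuity
    makes it constant. It suffices to test against plateaus, which compare the averages near two
    points. *)
Lemma wder_classical f g h : wder f g ->
  (forall x, x < 0 -> {for x, continuous f}) ->
  (forall x, x < 0 -> {for x, continuous h}) ->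
  {ae leb, forall x, x < 0 -> g x = h x} ->
  forall x : R, x < 0 -> is_derive x 1 f (h x).
Proof.
move=> [mf mg E] cf ch gh x0 x00.
have mD : measurable (D : set (measurableTypeR R)) by exact: measurable_itv.
(* Truncation at a point strictly between [x0] and 0 turns [f] and [h] into functions continuous on
   the whole line, unchanged near [x0]. *)
pose c := x0 / 2; have c0 : c < 0 by rewrite /c; lra.
have x0c : x0 < c by rewrite /c; lra.
pose fc x := f (Num.min x c); pose hc x := h (Num.min x c).
have cfc : continuous fc by apply: continuous_minr => x xc; apply: cf; exact: le_lt_trans xc c0.
have chc : continuous hc by apply: continuous_minr => x xc; apply: ch; exact: le_lt_trans xc c0.
pose H := prim x0 hc.
have dH x : is_derive x 1 H (hc x) by exact: der_prim.
have cH : continuous H by exact: prim_continuous.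
pose F x := fc x - H x.
have cF : continuous F by exact: ctB.
suff FE p q : p < q -> q < c -> F p = F q.
  have fE x : x < c -> f x = H x + F x0.
    move=> xc; have -> : F x0 = F x.
      case: (ltgtP x x0) => [h1|h1|->//]; last exact: FE.
      by apply/esym/FE.
    by rewrite /F /fc (min_idPl (ltW xc)); ring.
  have hE : hc x0 = h x0 by rewrite /hc (min_idPl (ltW x0c)).
  have := derD (dH x0) (der_cst (F x0) x0).
  rewrite addr0 hE => /der_near; apply; near=> y; apply/esym/fE.
  by near: y; exact: lt_nbhsl.
move=> pq qc.
apply/eqP; rewrite -subr_eq0 -normr_le0; apply/ler_addgt0Pl => e' e'0; rewrite addr0.
pose e := e' / 2; have e0 : 0 < e by rewrite divr_gt0.
have near_e (y : R) : exists2 d, 0 < d & forall z, y <= z <= y + d -> `|F z - F y| <= e.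
  have /cvgrPdist_le/(_ e e0)/nbhs_ballP[d /= d0 hd] := cF y.
  exists (d / 2); first by rewrite divr_gt0.
  move=> z /andP[yz zd]; rewrite distrC; apply: hd; rewrite /ball/= distrC ger0_norm ?subr_ge0//.
  rewrite ltrBlDl; apply: le_lt_trans zd _; rewrite ltrD2l; lra.
have [d1 d10 hp] := near_e p; have [d2 d20 hq] := near_e q.
pose eps := Num.min (Num.min d1 d2) ((c - q) / 2).
have eps0 : 0 < eps by rewrite !lt_min d10 d20/= divr_gt0// subr_gt0.
have epsd1 : eps <= d1 by rewrite !ge_min lexx.
have epsd2 : eps <= d2 by rewrite !ge_min lexx orbT.
have epsc : eps <= (c - q) / 2 by rewrite ge_min lexx orbT.
have eE : e' = 2 * e by rewrite /e; field.
clearbody eps e.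
pose bu : R -> R := hbump 0 eps.
have sbu : smooth bu by exact: smooth_hbump.
have cbu : continuous bu by exact: smooth_continuous.
have bu0 x : x <= 0 \/ eps <= x -> bu x = 0 by move=> /hbump_out[].
have bu_ge0 x : 0 <= bu x by exact: hbump_ge0.
pose B := prim 0 bu; pose M := B eps.
have dB x : is_derive x 1 B (bu x) by exact: der_prim.
have M0 : 0 < M.
  apply: (itg_gt0 (x0 := eps / 2)); rewrite ?(ltW eps0)//.
    by apply/andP; split; lra.
  by apply: hbump_gt0; apply/andP; split; lra.
have B0 x : x <= 0 -> B x = 0.
  move=> xle; have := @eq_der0 _ B bu x 0 xle (fun y _ => dB y).
  have -> : B 0 = 0 by exact: prim0.
  by apply => y /andP[_ y0]; apply: bu0; left.
have B1 x : eps <= x -> B x = M.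
  move=> xge; apply/esym/(eq_der0 xge (fun y _ => dB y)) => y /andP[y0 _].
  by apply: bu0; right.
clearbody M B bu.
(* [B] is a smoothed step of height [M], so [th] is a plateau whose derivative is a bump just to the
   right of [p] minus its translate to the right of [q]. Testing against it equates the averages of
   [F] at the two places. *)
pose th y := B (y - p) - B (y - q).
pose th' y := bu (y - p) - bu (y - q).
have dth (y : R) : is_derive y 1 th (th' y).
  apply: derB; [apply: der_eq (der_comp (dB _) (derB (der_id y) (der_cst p y))) _|
    apply: der_eq (der_comp (dB _) (derB (der_id y) (der_cst q y))) _]; by rewrite subr0 mulr1.
have cbs z : continuous (fun y : R => bu (y - z)).
  move=> y; apply: (@continuous_comp _ _ _ (fun y : R => y - z) bu); last exact: cbu.
  by apply: cvgB; [exact: cvg_id|exact: cvg_cst].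
have cth' : continuous th' by exact: ctB.
have cth : continuous th by move=> y; exact: der_continuous (dth y).
have [Q QE] : exists Q, Q = q + eps by eexists.
have pQ : p < Q by rewrite QE; lra.
have Qc : Q < c by rewrite QE; lra.
have Q0 : Q < 0 by exact: lt_trans Qc c0.
have thout y : y <= p \/ Q <= y -> th y = 0.
  clear -pq QE B0 B1 => -[hy|hy]; first by rewrite /th !B0 ?subrr//; lra.
  by rewrite /th !B1 ?subrr//; lra.
have th'out y : y <= p \/ Q <= y -> th' y = 0.
  clear -pq QE bu0 => -[hy|hy]; first by rewrite /th' !bu0 ?subrr//; left; lra.
  by rewrite /th' !bu0 ?subrr//; right; lra.
have sth : smooth th.
  move=> n; apply: nsmoothW; exists th'; split => //.
  apply: nsmoothD.
    have := nsmooth_affine 1 (- p) (sbu n).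
    by under eq_fun do rewrite mul1r.
  have := nsmoothZ (-1) (nsmooth_affine 1 (- q) (sbu n)).
  by under eq_fun do rewrite mul1r mulN1r.
have tth : test_halfline th.
  split; first exact: smooth_derive1n.
  exists p, Q; split => // y yn; apply: contrapT => /negP; rewrite negb_and -!ltNge => hy.
  by case/eqP: yn; apply: thout; case/orP: hy => hy; [left|right]; exact: ltW.
have [_ _ Eth] := E _ tth.
have d1th : derive1 th = th' by apply/funext => y; exact: der1E.
have E1 : \int[leb]_(x in D) (f x * derive1 th x) = itg p Q (fun x => fc x * th' x).
  rewrite -Rint_support//; first last.
  - by move=> y /th'out ->; rewrite mulr0.
  - exact: ctM.
  apply: eq_Rintegral => y _; rewrite d1th /fc.
  have [yc|yc] := leP y c => //.
  by rewrite (th'out y) ?mulr0//; right; exact: ltW (lt_trans Qc yc).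
have E2 : \int[leb]_(x in D) (g x * th x) = itg p Q (fun x => hc x * th x).
  rewrite -Rint_support//; first last.
  - by move=> y /thout ->; rewrite mulr0.
  - exact: ctM.
  rewrite /Rintegral; congr fine; apply: ae_eq_integral => //.
  - apply/measurable_EFinP; apply: measurable_funM => //.
    by apply: measurable_funTS; exact: continuous_measurable_fun.
  - apply/measurable_EFinP; apply: measurable_funTS; apply: continuous_measurable_fun.
    exact: ctM.
  - move: gh; apply: filterS; first exact: (ae_filter_ringOfSetsType leb).
    move=> y ghy yD; congr EFin.
    have y0 : y < 0 by move: yD; rewrite /= in_itv.
    rewrite /hc ghy//; have [yc|yc] := leP y c => //.
    by rewrite (thout y) ?mulr0//; right; exact: ltW (lt_trans Qc yc).
rewrite E1 E2 in Eth.
have cc1 : continuous (fun x => hc x * th x + H x * th' x).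
  by apply: ctD; exact: ctM.
have E3 : itg p Q (fun x => hc x * th x + H x * th' x) = 0.
  have := itg_FTC (ltW pQ) cc1 (fun x _ => derM (dH x) (dth x)).
  by move=> ->; rewrite !thout ?mulr0 ?subrr//; [left|right].
have E4 : itg p Q (fun x => F x * th' x) = 0.
  have c1 : continuous (fun x => fc x * th' x) by exact: ctM.
  have c2 : continuous (fun x => hc x * th x) by exact: ctM.
  have c3 : continuous (fun x => F x * th' x) by exact: ctM.
  rewrite (itg_lin3 (ltW pQ) (b := 1) (c := 1) (d := -1) c1 c2 cc1 c3).
    by rewrite Eth E3; ring.
  by move=> y _; rewrite /F; ring.
have mass (z : R) : p <= z -> z <= q -> itg p Q (fun y => bu (y - z)) = M.
  move=> pz zq; have dBz (y : R) : is_derive y 1 (fun y => B (y - z)) (bu (y - z)).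
    by apply: der_eq (der_comp (dB _) (derB (der_id y) (der_cst z y))) _; rewrite subr0 mulr1.
  have Qz : eps <= Q - z by clear -QE zq; lra.
  have pz' : p - z <= 0 by rewrite subr_le0.
  by rewrite (itg_FTC (ltW pQ) (cbs z) (fun y _ => dBz y)) (B1 _ Qz) (B0 _ pz') subr0.
have loc (z d : R) : p <= z -> z <= q -> eps <= d ->
    (forall y, z <= y <= z + d -> `|F y - F z| <= e) ->
    `|itg p Q (fun y => F y * bu (y - z)) - F z * M| <= e * M.
  move=> pz zq ed hz; rewrite -(mass z pz zq).
  have c1 : continuous (fun y => F y * bu (y - z)) by exact: ctM.
  have bound y : `|F y - F z| * bu (y - z) <= e * bu (y - z).
    clear -bu0 bu_ge0 ed hz.
    have [h1|h1] := leP y z; first by rewrite bu0 ?mulr0//; left; lra.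
    have [h2|h2] := leP (z + eps) y; first by rewrite bu0 ?mulr0//; right; lra.
    by apply: ler_wpM2r (bu_ge0 _) _ _ (hz _ _); apply/andP; split; lra.
  have cb := cbs z.
  have lo : (F z - e) * itg p Q (fun y => bu (y - z)) <= itg p Q (fun y => F y * bu (y - z)).
    rewrite -(itgZ (ltW pQ))//; apply: (le_itg (ltW pQ)) => //.
      by apply: ctM => //; exact: ct_cst.
    move=> y _; have := bound y; have := bu_ge0 (y - z); clear; move: (bu _) => w w0.
    rewrite -{1}(ger0_norm w0) -normrM ler_norml => /andP[hn _]; lra.
  have up : itg p Q (fun y => F y * bu (y - z)) <= (F z + e) * itg p Q (fun y => bu (y - z)).
    rewrite -(itgZ (ltW pQ))//; apply: (le_itg (ltW pQ)) => //.
      by apply: ctM => //; exact: ct_cst.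
    move=> y _; have := bound y; have := bu_ge0 (y - z); clear; move: (bu _) => w w0.
    rewrite -{1}(ger0_norm w0) -normrM ler_norml => /andP[_ hn]; lra.
  by move: lo up; clear; move=> lo up; rewrite ler_norml; apply/andP; split; lra.
have E5 : itg p Q (fun y => F y * bu (y - p)) = itg p Q (fun y => F y * bu (y - q)).
  have c1 : continuous (fun y => F y * bu (y - p)) by exact: ctM.
  have c2 : continuous (fun y => F y * bu (y - q)) by exact: ctM.
  have c3 : continuous (fun x => F x * th' x) by exact: ctM.
  have := itg_lin2 (ltW pQ) (c := 1) (d := -1) c1 c2 c3.
  rewrite E4 => hl.
  have Eth' y : p <= y <= Q -> F y * th' y = 1 * (F y * bu (y - p)) + -1 * (F y * bu (y - q)).
    by move=> _; rewrite /th'; ring.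
  by have := hl Eth'; clear; move=> hE; lra.
have l1 := loc p d1 (lexx p) (ltW pq) epsd1 hp.
have l2 := loc q d2 (ltW pq) (lexx q) epsd2 hq.
rewrite E5 in l1; rewrite -(ler_pM2r M0) -{1}(gtr0_norm M0) -normrM mulrBl.
rewrite eE.
move: l1 l2; rewrite !ler_norml; clear; move: (e * M) (mulrA 2 e M) => eM <-.
by move=> /andP[? ?] /andP[? ?]; apply/andP; split; lra.
Unshelve. all: by end_near. Qed.

End WeakDerivatives.

(** * Square integrability and growth towards minus infinity *)

Section Domination.
Context {R : realType}.
Local Notation leb := (@lebesgue_measure R).
Local Notation D := (`]-oo, 0[%classic : set R).
Implicit Types (N f g : R -> R) (t d C : R).

Lemma integrable_not_ge N t0 d C : leb.-integrable D (EFin \o N) -> 0 < d ->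
  (forall t, t < t0 -> t < 0 -> d <= C * N t) -> False.
Proof.
move=> iN d0 hd; pose m := Num.min t0 0.
have mD : measurable (D : set (measurableTypeR R)) by exact: measurable_itv.
have mE : measurable (`]-oo, m[%classic : set (measurableTypeR R)) by exact: measurable_itv.
have ED : `]-oo, m[%classic `<=` D.
  move=> t /=; rewrite !in_itv/= => h; apply: (lt_le_trans h); by rewrite /m ge_min lexx orbT.
have iE : leb.-integrable `]-oo, m[ (EFin \o (fun t => C * N t)).
  have := integrableS mD mE ED (integrableZl mD C iN); exact: eq_integrable.
have := integrable_lty mE iE; rewrite ltNge => /negP; apply.
apply: (@le_trans _ _ (\int[leb]_(t in `]-oo, m[) d%:E)%E).
  rewrite integral_cst//= lebesgue_measure_itv/= ltNyr/=.
  by rewrite addey// gt0_muley// lte_fin.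
apply: ge0_le_integral => //.
- by move=> t _; rewrite lee_fin ltW.
- exact: (measurable_int _ iE).
- move=> t /=; rewrite in_itv/= lt_min => /andP[h1 h2]; rewrite lee_fin; exact: hd.
Qed.

(** For an integrable [N] this pointwise bound stands in for square integrability: sums and bounded
    multiples preserve it with no measurability to check. *)
Definition dom N f := exists C, forall t, t < 0 -> f t ^+ 2 <= C * N t.

Lemma domD N f g : dom N f -> dom N g -> dom N (fun t => f t + g t).
Proof.
move=> [C hC] [C' hC']; exists (2 * C + 2 * C') => t t0.
have := hC t t0; have := hC' t t0; have := sqr_ge0 (f t - g t); nra.
Qed.

Lemma domM N f g B : (forall t, t < 0 -> `|g t| <= B) -> dom N f ->
  dom N (fun t => g t * f t).
Proof.
move=> gB [C hC]; exists (B ^+ 2 * C) => t t0.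
rewrite exprMn; apply: (@le_trans _ _ (B ^+ 2 * f t ^+ 2)).
  apply: (@ler_wpM2r R); first exact: sqr_ge0.
  by rewrite -(real_normK (num_real (g t))) !expr2 ler_pM// gB.
by rewrite -[_ * N t]mulrA; apply: ler_wpM2l; [exact: sqr_ge0|exact: hC].
Qed.

Lemma domZ N f c : dom N f -> dom N (fun t => c * f t).
Proof. by apply: (domM (B := `|c|)) => t _. Qed.

Lemma domB N f g : dom N f -> dom N g -> dom N (fun t => f t - g t).
Proof.
move=> hf /(domZ (-1)) hg; have := domD hf hg.
by under eq_fun do rewrite mulN1r.
Qed.

Lemma integrable_sumsq n (F : 'I_n -> R -> R) : (forall i, L2 leb D (F i)) ->
  leb.-integrable D (EFin \o (fun t => \sum_i F i t ^+ 2)).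
Proof.
move=> LF; have mD : measurable (D : set (measurableTypeR R)) by exact: measurable_itv.
elim: n F LF => [|n IH] F LF.
  apply: eq_integrable (integrable0 leb D) => // t _; by rewrite /= big_ord0.
have [_ i0] := LF ord0.
apply: eq_integrable (integrableD mD i0 (IH _ (fun i => LF (lift ord0 i)))) => // t _.
by rewrite /= big_ord_recl EFinD.
Qed.

Lemma dom_basis n (F : 'I_n -> R -> R) i : dom (fun t => \sum_i F i t ^+ 2) (F i).
Proof.
exists 1 => t _; rewrite mul1r (bigD1 i)//= lerDl sumr_ge0// => j _; exact: sqr_ge0.
Qed.

Lemma growing_zero N u (kap c : R) : 0 < kap -> c <= 0 ->
  leb.-integrable D (EFin \o N) -> dom N u ->
  (forall t : R, t < c -> is_derive t 1 u (- kap * u t)) ->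
  forall t, t < c -> u t = 0.
Proof.
move=> kap0 c0 iN [C hC] du t tc; apply/eqP; apply: contrapT => /negP ut.
apply: (@integrable_not_ge N t (u t ^+ 2) C iN); first by rewrite exprn_even_gt0.
move=> z zt z0; apply: le_trans (hC z z0).
have du2 (y : R) : z <= y <= t -> is_derive y 1 (fun x => u x * u x)
    (- kap * u y * u y + u y * (- kap * u y)).
  by move=> /andP[_ yt]; apply: derM; apply: du; exact: le_lt_trans yt tc.
rewrite !expr2; apply: (nincr_der (ltW zt) du2) => y _.
by have := sqr_ge0 (u y); nra.
Qed.

End Domination.

Section RealSolution.
Context {R : realType}.
Variables (a g mu k rm rp : R) (rho : R -> R).
Hypotheses (a_gt0 : 0 < a) (g_gt0 : 0 < g) (mu_gt0 : 0 < mu) (k_gt0 : 0 < k)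
  (rhoP : density_assumption a rm rp rho).
Local Notation leb := (@lebesgue_measure R).
Local Notation D := (`]-oo, 0[%classic : set R).
Local Notation r := (ext_r rho).
Local Notation s := (ext_s rho).
Local Notation gam := (g * k ^+ 2).
Local Notation decay := (decay mu k rm).

Lemma cvg_left_unique (f h : R -> R) : (forall x, x < 0 -> f x = h x) ->
  f x @[x --> 0^'-] --> f 0 -> {for 0, continuous h} -> f 0 = h 0.
Proof.
move=> fh cf ch; have cf' : h x @[x --> 0^'-] --> f 0.
  apply: cvg_trans cf; apply: near_eq_cvg; near=> y; apply: fh.
  by near: y; exact: nbhs_left_lt.
exact: (cvg_unique _ cf' (cvg_at_left_filter ch)).
Unshelve. all: by end_near. Qed.

(** On x < 0 the eigenfunction with its momenta agrees with a global solution of the system started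
    at -1. The conditions at 0 pass to the limit from the left, and square integrability produces
    [bc_left]. *)
Lemma real_solution_chr (lam : R) (w : nat -> R -> R) : 0 < lam ->
  (forall j, (j < 4)%N -> L2 leb D (w j)) ->
  (forall j, (j < 4)%N -> w j x @[x --> 0^'-] --> w j 0) ->
  (forall j, (j < 3)%N -> forall x : R, x < 0 -> is_derive x 1 (w j) (w j.+1 x)) ->
  (forall x : R, x < 0 -> is_derive x 1
     (fun x => lam ^+ 2 * r x * w 1%N x + 3 * lam * mu * k ^+ 2 * w 1%N x - lam * mu * w 3%N x)
     ((lam ^+ 2 * k ^+ 2 * r x - gam * s x) * w 0%N x
        + k ^+ 2 * (lam * mu * (w 2%N x + k ^+ 2 * w 0%N x)))) ->
  k ^+ 2 * w 0%N 0 + w 2%N 0 = 0 ->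
  - (lam * mu * w 3%N 0) + (3 * lam * mu * k ^+ 2 + lam ^+ 2 * rp) * w 1%N 0
    + g * k ^+ 2 * rp * w 0%N 0 = 0 ->
  (exists2 x, x < 0 & w 0%N x != 0) -> chr a g mu k rm rp r s lam.
Proof.
move=> l0 Lw cw dw dp bc1 bc2 [xn xn0 wn]; split => //.
have lm0 : 0 < lam * mu by rewrite mulr_gt0.
have rm0 := density_minus_gt0 rhoP.
have cr := ext_r_continuous rhoP; have cs := ext_s_continuous rhoP.
have r_ge := ext_r_ge a_gt0 rhoP; have r_le := ext_r_le rhoP.
have s_ge0 := ext_s_ge0 rhoP; have [S s_le] := ext_s_bounded a_gt0 rhoP.
pose W (i : nat) (x : R) : R := match i with 0 => w 0%N x | 1 => w 1%N x
  | 2 => lam ^+ 2 * r x * w 1%N x + 3 * lam * mu * k ^+ 2 * w 1%N x - lam * mu * w 3%N x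
  | _ => lam * mu * (w 2%N x + k ^+ 2 * w 0%N x) end.
have [Y [Y0 hY]] : exists Y, (forall i, (i < 4)%N -> Y i (-1) = W i (-1)) /\
    ham g mu k r s lam (fun=> 0) Y.
  apply: (@ham_ex R g mu k rm rp S r s rm0 cr cs r_ge r_le s_ge0 s_le lam (fun=> 0) 0); first exact: ct_cst.
  by move=> x; rewrite normr0.
have YW i x : (i < 4)%N -> x < 0 -> Y i x = W i x.
  move=> i4 x0.
  have [K hK] : exists K, forall (i j : 'I_4) x, `|coef g mu k r s lam i j x| <= K.
    exact: (coef_bounded g mu k rm0 r_ge r_le s_ge0 s_le).
  pose p : R := Num.min (-1) x; pose q : R := Num.max (-1) x.
  have q0 : q < 0 by rewrite /q gt_max oppr_lt0 ltr01 x0.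
  have := @ode_unique_on R 4 (coef g mu k r s lam) K hK (fun i x => Y i x - W i x) p q (-1)
     (ltac:(by rewrite /p /q ge_min le_max !lexx)) _ _ (Ordinal i4) x
     (ltac:(by rewrite /p /q ge_min le_max !lexx !orbT)).
  move=> H; apply/eqP; rewrite -subr_eq0; apply/eqP; apply: H; last first.
    by move=> j; rewrite Y0 ?subrr.
  move=> j y /andP[_ yq]; have y0 : y < 0 by exact: le_lt_trans yq q0.
  have /hamP hY' := hY.
  have dW : is_derive y 1 (W j) (\sum_(l < 4) coef g mu k r s lam j l y * W l y).
    case: j => [[|[|[|[|//]]]] hj]; rewrite !big_ord_recl big_ord0 /coef /W/=.
    - by apply: der_eq (dw 0%N isT y y0) _; ring.
    - apply: der_eq (dw 1%N isT y y0) _; field; rewrite !gt_eqF//.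
    - by apply: der_eq (dp y y0) _; ring.
    - apply: der_eq (derZ _ (derD (dw 2%N isT y y0) (derZ _ (dw 0%N isT y y0)))) _; ring.
  apply: der_eq (derB (hY' j y) dW) _.
  rewrite oppr0 if_same addr0 -sumrB; apply: eq_bigr => l _; ring.
exists Y; split => //; last first.
  by exists xn; rewrite YW.
- have cY j : (j < 4)%N -> {for 0, continuous (Y j)}.
    by move=> j4; exact: (ham_continuous j4 hY).
  have cW i : (i < 4)%N -> W i x @[x --> 0^'-] --> W i 0.
    move=> i4; have c0 := cw 0%N isT; have c1 := cw 1%N isT; have c2 := cw 2%N isT; have c3 := cw 3%N isT.
    have crl : r x @[x --> 0^'-] --> r 0 by apply: cvg_at_left_filter; exact: cr.
    have cc (c : R) : (fun=> c) x @[x --> (0:R)^'-] --> c by exact: cvg_cst.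
    case: i i4 => [|[|[|[|//]]]] _ //=.
    + apply: cvgB; last exact: cvgM.
      by apply: cvgD; apply: cvgM => //; apply: cvgM.
    + by apply: cvgM => //; apply: cvgD => //; apply: cvgM.
  have E i : (i < 4)%N -> Y i 0 = W i 0.
    move=> i4; apply/esym; apply: cvg_left_unique; [|exact: cW|exact: cY].
    by move=> x x0; rewrite YW.
  rewrite /bc_right !E//= (ext_r0 rhoP); split; first by rewrite [w 2%N 0 + _]addrC bc1 mulr0.
  by rewrite -[RHS]bc2; ring.
- have m0 := decay_gt mu_gt0 k_gt0 rm0 l0; have m2 := decay_sqr k mu_gt0 rm0 l0.
  set m := decay lam in m0 m2 *.
  pose N t := \sum_(i < 4) w i t ^+ 2.
  have iN : leb.-integrable D (EFin \o N) by apply: integrable_sumsq => i; exact: Lw.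
  have dW i : (i < 4)%N -> dom N (Y i).
    move=> i4; have d j : (j < 4)%N -> dom N (w j).
      by move=> j4; exact: (dom_basis (fun i : 'I_4 => w i) (Ordinal j4)).
    suff [C hC] : dom N (W i) by exists C => t t0; rewrite YW// hC.
    case: i i4 => [|[|[|[|//]]]] _ /=; [exact: d|exact: d| |].
    + apply: domB; last by apply: domZ; exact: d.
      apply: domD; last by apply: domZ; exact: d.
      apply: (domM (B := lam ^+ 2 * rp)); last exact: d.
      move=> t _; rewrite normrM !ger0_norm ?sqr_ge0//; last exact: le_trans (ltW rm0) (r_ge t).
      by rewrite ler_wpM2l ?sqr_ge0.
    + by apply: domZ; apply: domD; [exact: d|apply: domZ; exact: d].
  (* Row eigenvectors of the constant matrix below -a, for the eigenvalues - k and - m: they extract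
     the components along exp(- k t) and exp(- m t), which blow up at -oo. As m differs from k,
     their vanishing at -a amounts to [bc_left]. *)
  pose u1 t := Y 2%N t + k * Y 3%N t - 2 * (lam * mu) * k ^+ 2 * Y 1%N t
     - lam * mu * k * (k ^+ 2 + m ^+ 2) * Y 0%N t.
  pose u2 t := Y 2%N t + m * Y 3%N t - lam * mu * (m ^+ 2 + k ^+ 2) * Y 1%N t
     - 2 * (lam * mu) * k ^+ 2 * m * Y 0%N t.
  have rmE : rm = mu / lam * (m ^+ 2 - k ^+ 2).
    rewrite m2; field; rewrite !gt_eqF//.
  have du1 (t : R) : t < - a -> is_derive t 1 u1 (- k * u1 t).
    move=> ta; have [h0 h1 h2 h3] := hY t.
    have rt := ext_r_le_a a_gt0 rhoP (ltW ta); have st := ext_s_lt_a a_gt0 rhoP ta.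
    apply: der_eq (derB (derB (derD h2 (derZ k h3)) (derZ _ h1)) (derZ _ h0)) _.
    rewrite rt st /u1 rmE; field; rewrite !gt_eqF//.
  have du2 (t : R) : t < - a -> is_derive t 1 u2 (- m * u2 t).
    move=> ta; have [h0 h1 h2 h3] := hY t.
    have rt := ext_r_le_a a_gt0 rhoP (ltW ta); have st := ext_s_lt_a a_gt0 rhoP ta.
    apply: der_eq (derB (derB (derD h2 (derZ m h3)) (derZ _ h1)) (derZ _ h0)) _.
    rewrite rt st /u2 rmE; field; rewrite !gt_eqF//.
  have na0 : - a <= 0 by rewrite oppr_le0 ltW.
  have z1 : forall t, t < - a -> u1 t = 0.
    apply: (growing_zero (N := N) k_gt0 na0 iN _ du1).
    apply: domB; last by apply: domZ; exact: dW.
    apply: domB; last by apply: domZ; exact: dW.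
    by apply: domD; [exact: dW|apply: domZ; exact: dW].
  have z2 : forall t, t < - a -> u2 t = 0.
    apply: (growing_zero (N := N) (lt_trans k_gt0 m0) na0 iN _ du2).
    apply: domB; last by apply: domZ; exact: dW.
    apply: domB; last by apply: domZ; exact: dW.
    by apply: domD; [exact: dW|apply: domZ; exact: dW].
  have cY j : (j < 4)%N -> continuous (Y j) by move=> j4; exact: (ham_continuous j4 hY).
  have zero_a (u : R -> R) : continuous u -> (forall t, t < - a -> u t = 0) -> u (- a) = 0.
    move=> cu hu; apply/esym; apply: (cvg_unique (@Rhausdorff R) _ (cvg_at_left_filter (cu (- a)))).
    apply: cvg_near_cst; near=> y; apply: hu; by near: y; exact: nbhs_left_lt.
  have e1 : u1 (- a) = 0.
    apply: zero_a z1; apply: ctB; [apply: ctB; [apply: ctD|]|]; try exact: cY;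
      by apply: ctM; [exact: ct_cst|exact: cY].
  have e2 : u2 (- a) = 0.
    apply: zero_a z2; apply: ctB; [apply: ctB; [apply: ctD|]|]; try exact: cY;
      by apply: ctM; [exact: ct_cst|exact: cY].
  have mk0 : m - k != 0 by rewrite subr_eq0 gt_eqF.
  have E3 : Y 3%N (- a) = lam * mu * (- (k * (m - k)) * Y 0%N (- a) + (m + k) * Y 1%N (- a)).
    apply: (mulfI mk0); move: e1 e2; rewrite /u1 /u2; lra.
  rewrite /bc_left -/(decay lam) -/m E3; split=> //.
  by move: e1; rewrite /u1 E3; lra.
Unshelve. all: by end_near. Qed.

End RealSolution.

(** * Reality of the characteristic values *)

Section ComplexAlgebra.
Context {R : realType}.
Local Notation "r %:C" := (real_complex R r).

Lemma complex_momentum (l kk rr mm gg ss f w0 w2 w4 : R[i]) (x y k r mu g s : R) :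
  l = Complex x y -> kk = k%:C -> rr = r%:C -> mm = mu%:C -> gg = g%:C -> ss = s%:C ->
  l ^+ 2 * (kk ^+ 2 * rr * w0 - f) + l * mm * (w4 - 2 * kk ^+ 2 * w2 + kk ^+ 4 * w0)
     = gg * kk ^+ 2 * ss * w0 ->
  let: (Complex a0 b0, Complex a2 b2, Complex a4 b4, Complex fa fb) := (w0, w2, w4, f) in
  mu * x * a4 - mu * y * b4 - (x ^+ 2 - y ^+ 2) * fa + 2 * x * y * fb
  = g * k ^+ 2 * s * a0 - k ^+ 2 * r * ((x ^+ 2 - y ^+ 2) * a0 - 2 * x * y * b0)
    + mu * (2 * k ^+ 2 * (x * a2 - y * b2) - k ^+ 4 * (x * a0 - y * b0)) /\
  mu * x * b4 + mu * y * a4 - (x ^+ 2 - y ^+ 2) * fb - 2 * x * y * fa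
  = g * k ^+ 2 * s * b0 - k ^+ 2 * r * ((x ^+ 2 - y ^+ 2) * b0 + 2 * x * y * a0)
    + mu * (2 * k ^+ 2 * (x * b2 + y * a2) - k ^+ 4 * (x * b0 + y * a0)).
Proof.
case: w0 w2 w4 f => [a0 b0] [a2 b2] [a4 b4] [fa fb] -> -> -> -> -> ->.
move=> /eqP; rewrite eq_complex !exprS !expr0 !mulr1 => /andP[/eqP/= h1 /eqP/= h2].
by split; lra.
Qed.

Lemma complex_bc2 (l kk mm gg rr w0 w1 w3 : R[i]) (x y k mu g rp : R) :
  l = Complex x y -> kk = k%:C -> mm = mu%:C -> gg = g%:C -> rr = rp%:C ->
  - (l * mm * w3) + (3 * l * mm * kk ^+ 2 + l ^+ 2 * rr) * w1
     + gg * kk ^+ 2 * rr * w0 = 0 ->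
  let: (Complex a0 b0, Complex a1 b1, Complex a3 b3) := (w0, w1, w3) in
  - (mu * (x * a3 - y * b3)) + 3 * mu * k ^+ 2 * (x * a1 - y * b1)
    + rp * ((x ^+ 2 - y ^+ 2) * a1 - 2 * x * y * b1) + g * k ^+ 2 * rp * a0 = 0 /\
  - (mu * (x * b3 + y * a3)) + 3 * mu * k ^+ 2 * (x * b1 + y * a1)
    + rp * ((x ^+ 2 - y ^+ 2) * b1 + 2 * x * y * a1) + g * k ^+ 2 * rp * b0 = 0.
Proof.
case: w0 w1 w3 => [a0 b0] [a1 b1] [a3 b3] -> -> -> -> ->.
move=> /eqP; rewrite eq_complex !exprS !expr0 !mulr1 => /andP[/eqP/= h1 /eqP/= h2].
by split; lra.
Qed.

End ComplexAlgebra.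

Section LeftLimits.
Context {R : realType}.
Implicit Types (f h : R -> R) (l m : R).

Lemma limD f h l m : f t @[t --> 0^'-] --> l -> h t @[t --> 0^'-] --> m ->
  f t + h t @[t --> 0^'-] --> l + m.
Proof. exact: cvgD. Qed.

Lemma limB f h l m : f t @[t --> 0^'-] --> l -> h t @[t --> 0^'-] --> m ->
  f t - h t @[t --> 0^'-] --> l - m.
Proof. exact: cvgB. Qed.

Lemma limM f h l m : f t @[t --> 0^'-] --> l -> h t @[t --> 0^'-] --> m ->
  f t * h t @[t --> 0^'-] --> l * m.
Proof. exact: cvgM. Qed.

Lemma limZ c f l : f t @[t --> 0^'-] --> l -> c * f t @[t --> 0^'-] --> c * l.
Proof. by move=> fl; apply: limM fl; exact: cvg_cst. Qed.

End LeftLimits.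

Section RealEigenvalue.
Context {R : realType}.
Variables (a g mu k rm rp : R) (rho : R -> R).
Hypotheses (a_gt0 : 0 < a) (mu_gt0 : 0 < mu) (k_gt0 : 0 < k)
  (rhoP : density_assumption a rm rp rho).
Local Notation leb := (@lebesgue_measure R).
Local Notation D := (`]-oo, 0[%classic : set R).
Local Notation r := (ext_r rho).
Local Notation s := (ext_s rho).
Local Notation gam := (g * k ^+ 2).

Lemma dom_prod (N f h : R -> R) : dom N f -> dom N h ->
  exists C, forall t, t < 0 -> `|f t * h t| <= C * N t.
Proof.
move=> [C hC] [C' hC']; exists (C + C') => t t0.
have := hC t t0; have := hC' t t0.
rewrite ler_norml; have := sqr_ge0 (f t - h t); have := sqr_ge0 (f t + h t).
have := sqr_ge0 (f t); have := sqr_ge0 (h t).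
by move=> *; apply/andP; split; nra.
Qed.

(* The imaginary part of the weak form, tested against the conjugate of the
   solution, is the derivative of [J]. *)
Lemma real_eigenvalue (x y : R) (A B : nat -> R -> R) : 0 < x ->
  (forall j, (j < 4)%N -> L2 leb D (A j) /\ L2 leb D (B j)) ->
  (forall j, (j < 4)%N -> A j t @[t --> 0^'-] --> A j 0 /\ B j t @[t --> 0^'-] --> B j 0) ->
  (forall j, (j < 3)%N -> forall t : R, t < 0 ->
     is_derive t 1 (A j) (A j.+1 t) /\ is_derive t 1 (B j) (B j.+1 t)) ->
  let c1 t := ((x ^+ 2 - y ^+ 2) * r t * A 1%N t - 2 * x * y * r t * B 1%N t)
     + 3 * mu * k ^+ 2 * (x * A 1%N t - y * B 1%N t) - mu * (x * A 3%N t - y * B 3%N t) in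
  let d1 t := ((x ^+ 2 - y ^+ 2) * r t * B 1%N t + 2 * x * y * r t * A 1%N t)
     + 3 * mu * k ^+ 2 * (x * B 1%N t + y * A 1%N t) - mu * (x * B 3%N t + y * A 3%N t) in
  let c2 t := mu * (x * (A 2%N t + k ^+ 2 * A 0%N t) - y * (B 2%N t + k ^+ 2 * B 0%N t)) in
  let d2 t := mu * (x * (B 2%N t + k ^+ 2 * B 0%N t) + y * (A 2%N t + k ^+ 2 * A 0%N t)) in
  (forall t : R, t < 0 -> is_derive t 1 c1 (k ^+ 2 * r t * ((x ^+ 2 - y ^+ 2) * A 0%N t - 2 * x * y * B 0%N t) - gam * s t * A 0%N t + k ^+ 2 * c2 t)
     /\ is_derive t 1 d1 (k ^+ 2 * r t * ((x ^+ 2 - y ^+ 2) * B 0%N t + 2 * x * y * A 0%N t) - gam * s t * B 0%N t + k ^+ 2 * d2 t)) ->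
  c1 0 + gam * rp * A 0%N 0 = 0 -> d1 0 + gam * rp * B 0%N 0 = 0 ->
  c2 0 = 0 -> d2 0 = 0 ->
  (exists2 t, t < 0 & ~ (A 0%N t = 0 /\ B 0%N t = 0)) -> y = 0.
Proof.
move=> x0 LAB cAB dAB c1 d1 c2 d2 dcd bc1 bd1 bc2 bd2 [tn tn0 ntn].
have kk := k_gt0; have mu0 := mu_gt0.
have rm0 := density_minus_gt0 rhoP.
have cr := ext_r_continuous rhoP.
have r_ge := ext_r_ge a_gt0 rhoP; have r_le := ext_r_le rhoP.
apply/eqP; apply: contrapT => /negP y0.
(* The imaginary part of momentum times conjugate position is multiplied by [y], so that its
   derivative carries y^2 and has a sign; the gravity terms are real and cancel. *)
pose J t := y * (d1 t * A 0%N t - c1 t * B 0%N t + (d2 t * A 1%N t - c2 t * B 1%N t)).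
pose J' t := y ^+ 2 * (2 * x * r t * (k ^+ 2 * (A 0%N t ^+ 2 + B 0%N t ^+ 2) + (A 1%N t ^+ 2 + B 1%N t ^+ 2))
  + mu * ((A 2%N t + k ^+ 2 * A 0%N t) ^+ 2 + (B 2%N t + k ^+ 2 * B 0%N t) ^+ 2 + 4 * k ^+ 2 * (A 1%N t ^+ 2 + B 1%N t ^+ 2))).
have dJ (t : R) : t < 0 -> is_derive t 1 J (J' t).
  move=> t0; have [dc dd] := dcd t t0.
  have [dA0 dB0] := dAB 0%N isT t t0; have [dA1 dB1] := dAB 1%N isT t t0.
  have [dA2 dB2] := dAB 2%N isT t t0.
  have eA := derD dA2 (derZ (k ^+ 2) dA0); have eB := derD dB2 (derZ (k ^+ 2) dB0).
  have dc2 := derZ mu (derB (derZ x eA) (derZ y eB)).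
  have dd2 := derZ mu (derD (derZ x eB) (derZ y eA)).
  apply: der_eq (derZ y (derD (derB (derM dd dA0) (derM dc dB0)) (derB (derM dd2 dA1) (derM dc2 dB1)))) _.
  by rewrite /J' /c1 /d1 /c2 /d2; ring.
have J'0 t : y ^+ 2 * (2 * x * rm * k ^+ 2) * (A 0%N t ^+ 2 + B 0%N t ^+ 2) <= J' t.
  have h1 := sqr_ge0 (A 0%N t); have h2 := sqr_ge0 (B 0%N t).
  have h3 := sqr_ge0 (A 1%N t); have h4 := sqr_ge0 (B 1%N t).
  have h5 := sqr_ge0 (A 2%N t + k ^+ 2 * A 0%N t); have h6 := sqr_ge0 (B 2%N t + k ^+ 2 * B 0%N t).
  have rt := r_ge t; have k2 : 0 <= k ^+ 2 by exact: sqr_ge0.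
  rewrite /J' -[leLHS]mulrA; apply: ler_wpM2l; first exact: sqr_ge0.
  rewrite -[leLHS]addr0; apply: lerD; last first.
    apply: mulr_ge0; first exact: ltW.
    apply: addr_ge0; first exact: addr_ge0.
    by apply: mulr_ge0; [exact: mulr_ge0|exact: addr_ge0].
  rewrite -[leLHS]mulrA; apply: ler_pM.
  - by apply: mulr_ge0; [apply: mulr_ge0 => //; exact: ltW|exact: ltW].
  - by apply: mulr_ge0 => //; exact: addr_ge0.
  - by apply: ler_wpM2l => //; apply: mulr_ge0 => //; exact: ltW.
  - by rewrite lerDl addr_ge0.
have J'ge0 t : 0 <= J' t.
  apply: le_trans (J'0 t); rewrite mulr_ge0//; last by rewrite addr_ge0 ?sqr_ge0.
  by rewrite mulr_ge0 ?sqr_ge0// !mulr_ge0// ?sqr_ge0// ltW.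
clearbody J'.
have Jmono t u : t <= u -> u < 0 -> J t <= J u.
  move=> tu u0; apply: (ndecr_der tu (f' := J')) => [v /andP[_ vu]|v _].
    by apply: dJ; exact: le_lt_trans vu u0.
  exact: J'ge0.
have Jlim : J t @[t --> 0^'-] --> (0 : R).
  have crl : r t @[t --> 0^'-] --> r 0 by apply: cvg_at_left_filter; exact: cr.
  have [cA0 cB0] := cAB 0%N isT; have [cA1 cB1] := cAB 1%N isT.
  have [cA2 cB2] := cAB 2%N isT; have [cA3 cB3] := cAB 3%N isT.
  have cc1 : c1 t @[t --> 0^'-] --> c1 0 := limB (limD (limB (limM (limZ crl) cA1) (limM (limZ crl) cB1))
    (limZ (limB (limZ cA1) (limZ cB1)))) (limZ (limB (limZ cA3) (limZ cB3))).
  have cd1 : d1 t @[t --> 0^'-] --> d1 0 := limB (limD (limD (limM (limZ crl) cB1) (limM (limZ crl) cA1))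
    (limZ (limD (limZ cB1) (limZ cA1)))) (limZ (limD (limZ cB3) (limZ cA3))).
  have cc2 : c2 t @[t --> 0^'-] --> c2 0 :=
    limZ (limB (limZ (limD cA2 (limZ cA0))) (limZ (limD cB2 (limZ cB0)))).
  have cd2 : d2 t @[t --> 0^'-] --> d2 0 :=
    limZ (limD (limZ (limD cB2 (limZ cB0))) (limZ (limD cA2 (limZ cA0)))).
  have E : y * (d1 0 * A 0%N 0 - c1 0 * B 0%N 0 + (d2 0 * A 1%N 0 - c2 0 * B 1%N 0)) = 0.
    have e1 : c1 0 = - (gam * rp * A 0%N 0) by apply/eqP; rewrite -subr_eq0 opprK bc1.
    have e2 : d1 0 = - (gam * rp * B 0%N 0) by apply/eqP; rewrite -subr_eq0 opprK bd1.
    by rewrite e1 e2 bc2 bd2; ring.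
  have H : J t @[t --> 0^'-] --> y * (d1 0 * A 0%N 0 - c1 0 * B 0%N 0 + (d2 0 * A 1%N 0 - c2 0 * B 1%N 0)) :=
    (limZ (limD (limB (limM cd1 cA0) (limM cc1 cB0)) (limB (limM cd2 cA1) (limM cc2 cB1)))).
  by rewrite E in H.
have Jle0 t : t < 0 -> J t <= 0.
  move=> t0; apply: (cvgr_to_ge Jlim); near=> u; apply: Jmono; last by near: u; exact: nbhs_left_lt.
  by near: u; exact: nbhs_left_ge.
pose N t := \sum_(i < 4) A i t ^+ 2 + \sum_(i < 4) B i t ^+ 2.
have iN : leb.-integrable D (EFin \o N).
  have mD : measurable (D : set (measurableTypeR R)) by exact: measurable_itv.
  have iA := integrable_sumsq (fun i : 'I_4 => (LAB i (ltn_ord i)).1).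
  have iB := integrable_sumsq (fun i : 'I_4 => (LAB i (ltn_ord i)).2).
  by apply: eq_integrable (integrableD mD iA iB).
have domA j : (j < 4)%N -> dom N (A j).
  move=> j4; have [C hC] := dom_basis (fun i : 'I_4 => A i) (Ordinal j4).
  exists 1 => t t0; rewrite mul1r /N (bigD1 (Ordinal j4))//= -addrA lerDl.
  by rewrite addr_ge0// sumr_ge0// => i _; exact: sqr_ge0.
have domB' j : (j < 4)%N -> dom N (B j).
  move=> j4; exists 1 => t t0; rewrite mul1r /N (bigD1 (P := xpredT) (F := fun i : 'I_4 => B i t ^+ 2) (Ordinal j4))//=.
  by rewrite addrCA lerDl addr_ge0// sumr_ge0// => i _; exact: sqr_ge0.
have domr f c : dom N f -> dom N (fun t => c * r t * f t).
  apply: (domM (B := `|c| * rp)) => t _; rewrite normrM ler_wpM2l//.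
  by rewrite ger0_norm ?r_le//; exact: le_trans (ltW rm0) (r_ge t).
have dc1 : dom N c1.
  apply: domB; [apply: domD; [apply: domB; apply: domr; [exact: domA|exact: domB']|]|];
    by apply: domZ; apply: domB; apply: domZ; (exact: domA || exact: domB').
have dd1 : dom N d1.
  apply: domB; [apply: domD; [apply: domD; apply: domr; [exact: domB'|exact: domA]|]|];
    by apply: domZ; apply: domD; apply: domZ; (exact: domA || exact: domB').
have dc2 : dom N c2.
  by apply: domZ; apply: domB; apply: domZ; apply: domD; try (by exact: domA || exact: domB'); apply: domZ; (exact: domA || exact: domB').
have dd2 : dom N d2.
  by apply: domZ; apply: domD; apply: domZ; apply: domD; try (by exact: domA || exact: domB'); apply: domZ; (exact: domA || exact: domB').
have [C hC] : exists C, forall t, t < 0 -> `|J t| <= C * N t.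
  have [C1 h1] := dom_prod dd1 (domA 0%N isT); have [C2 h2] := dom_prod dc1 (domB' 0%N isT).
  have [C3 h3] := dom_prod dd2 (domA 1%N isT); have [C4 h4] := dom_prod dc2 (domB' 1%N isT).
  exists (`|y| * (C1 + C2 + (C3 + C4))) => t t0; rewrite normrM -[leRHS]mulrA.
  apply: ler_wpM2l => //.
  rewrite [leRHS]mulrDl [(C1 + _) * _]mulrDl [(C3 + _) * _]mulrDl; apply: le_trans (ler_normD _ _) _; apply: lerD.
    by apply: le_trans (ler_normB _ _) _; apply: lerD; [exact: h1|exact: h2].
  by apply: le_trans (ler_normB _ _) _; apply: lerD; [exact: h3|exact: h4].
(* [J] is nondecreasing with limit 0 at 0, so it is nonpositive; a negative value would bound it
   away from 0 on a whole left half-line, against integrability. *)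
have J0 t : t < 0 -> J t = 0.
  move=> t0; apply/le_anti/andP; split; first exact: Jle0.
  rewrite leNgt; apply/negP => Jt; apply: (@integrable_not_ge _ N t (- J t) C iN); first by rewrite oppr_gt0.
  move=> u ut u0; apply: le_trans (hC u u0); rewrite -normrN; apply: le_trans (ler_norm _).
  by rewrite lerN2 Jmono// ltW.
apply: ntn; have := J'0 tn; have -> : J' tn = 0.
  apply: der_unique (dJ tn tn0) _; apply: (der_near (der_cst 0 tn)); near=> t; rewrite J0//.
  by near: t; exact: lt_nbhsl.
have p0 : 0 < y ^+ 2 * (2 * x * rm * k ^+ 2) by rewrite mulr_gt0 ?exprn_even_gt0//= !mulr_gt0// exprn_gt0.
rewrite pmulr_rle0// => h; have h1 := sqr_ge0 (A 0%N tn); have h2 := sqr_ge0 (B 0%N tn).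
by split; apply/eqP; rewrite -sqrf_eq0; lra.
Unshelve. all: by end_near. Qed.

Lemma ccontinuous_left (f : R -> R[i]) : ccontinuous_halfline f ->
  [/\ forall x, x < 0 -> {for x, continuous (fun t => complex.Re (f t))},
      forall x, x < 0 -> {for x, continuous (fun t => complex.Im (f t))},
      complex.Re (f t) @[t --> 0^'-] --> complex.Re (f 0) &
      complex.Im (f t) @[t --> 0^'-] --> complex.Im (f 0)].
Proof.
by move=> [/continuous_within_itvNycP[h1 h2] /continuous_within_itvNycP[h3 h4]]; split.
Qed.

(** The fourth derivative and the flux are only weak derivatives, but the combination of them in the
    equation equals a continuous function almost everywhere; by [wder_classical] the corresponding
    combination of phi''' and rho phi' is classically differentiable. Realness of the value then
    separates real and imaginary parts. *)
Lemma characteristic_value_chr (kv : R * R) (z : R[i]) : wavenumber kv = k ->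
  characteristic_value g mu rp rho kv z ->
  exists2 lam, z = real_complex R lam & chr a g mu k rm rp r s lam.
Proof.
case: z => x y kvE [/= x0 [phi [w [flux [[w0 wj wf] [[tn [tn0 phn]] [ae [bc1 [bc2 _]]]]]]]]].
rewrite kvE {kv kvE} in ae bc1 bc2.
subst phi; have mu0 := mu_gt0; have kk := k_gt0.
pose A j t := complex.Re (w j t); pose B j t := complex.Im (w j t).
have LAB j : (j < 4)%N -> L2 leb D (A j) /\ L2 leb D (B j).
  by move=> /wj[[[h _ _] [h' _ _]] _].
have wE j t : w j t = Complex (A j t) (B j t) by rewrite /A /B; case: (w j t).
have cl j : (j < 4)%N -> _ := fun j4 => ccontinuous_left (wj j j4).2.
have cAB j : (j < 4)%N -> A j t @[t --> 0^'-] --> A j 0 /\ B j t @[t --> 0^'-] --> B j 0.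
  by move=> /cl[].
have cA j t : (j < 4)%N -> t < 0 -> {for t, continuous (A j)} by move=> /cl[h _ _ _] /h.
have cB j t : (j < 4)%N -> t < 0 -> {for t, continuous (B j)} by move=> /cl[_ h _ _] /h.
have wd j : (j < 4)%N -> wder (A j) (A j.+1) /\ wder (B j) (B j.+1).
  by move=> /wj[[h h'] _]; split; exact: weak_wder.
have dAB j : (j < 3)%N -> forall t : R, t < 0 ->
    is_derive t 1 (A j) (A j.+1 t) /\ is_derive t 1 (B j) (B j.+1 t).
  move=> j3 t t0; have j4 := ltnW j3; have [h1 h2] := wd j j4; split.
    apply: (wder_classical h1) t0 => [u|u|]; [exact: cA|exact: cA|exact: aeW].
  apply: (wder_classical h2) t0 => [u|u|]; [exact: cB|exact: cB|exact: aeW].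
pose fa t := complex.Re (flux t); pose fb t := complex.Im (flux t).
have fE t : flux t = Complex (fa t) (fb t) by rewrite /fa /fb; case: (flux t).
have [wfa wfb] : wder (fun t => rho t * A 1%N t) fa /\ wder (fun t => rho t * B 1%N t) fb.
  have [/weak_wder h1 /weak_wder h2] := wf; split.
    by move: h1; congr wder; apply/funext => t; rewrite wE/= mul0r subr0.
  by move: h2; congr wder; apply/funext => t; rewrite wE/= mul0r addr0.
have [A34 B34] := wd 3%N isT.
pose gA t := A 0%N t * (g * k ^+ 2 * s t) - k ^+ 2 * r t * ((x ^+ 2 - y ^+ 2) * A 0%N t - 2 * x * y * B 0%N t)
    + mu * (2 * k ^+ 2 * (x * A 2%N t - y * B 2%N t) - k ^+ 4 * (x * A 0%N t - y * B 0%N t)).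
pose gB t := B 0%N t * (g * k ^+ 2 * s t) - k ^+ 2 * r t * ((x ^+ 2 - y ^+ 2) * B 0%N t + 2 * x * y * A 0%N t)
    + mu * (2 * k ^+ 2 * (x * B 2%N t + y * A 2%N t) - k ^+ 4 * (x * B 0%N t + y * A 0%N t)).
(* Real and imaginary parts of z mu phi''' - z^2 rho phi'; [gA] and [gB] collect the remaining,
   continuous terms of the equation. *)
have w1 := wder_lin 1 1 (wder_lin (mu * x) (- (mu * y)) A34 B34)
  (wder_lin (- (x ^+ 2 - y ^+ 2)) (2 * x * y) wfa wfb).
have w2 := wder_lin 1 1 (wder_lin (mu * y) (mu * x) A34 B34)
  (wder_lin (- (2 * x * y)) (- (x ^+ 2 - y ^+ 2)) wfa wfb).
have aeAB : {ae leb, forall t : R, t < 0 ->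
    1 * (mu * x * A 4%N t + - (mu * y) * B 4%N t) + 1 * (- (x ^+ 2 - y ^+ 2) * fa t + 2 * x * y * fb t) = gA t /\
    1 * (mu * y * A 4%N t + mu * x * B 4%N t) + 1 * (- (2 * x * y) * fa t + - (x ^+ 2 - y ^+ 2) * fb t) = gB t}.
  apply: filterS ae; first exact: (ae_filter_ringOfSetsType leb).
  move=> t H t0; move: (H t0); rewrite !wE fE => {}H.
  have [h1 h2] := complex_momentum erefl erefl erefl erefl erefl erefl H.
  by rewrite /gA /gB (ext_r_lt0 _ t0) (ext_s_lt0 _ t0); split; lra.
have cr := ext_r_continuous rhoP; have cs := ext_s_continuous rhoP.
have crt t : {for t, continuous r} by exact: cr.
have cst t : {for t, continuous s} by exact: cs.
have crho t : t < 0 -> {for t, continuous rho} by move=> t0; exact: der_continuous (der_rho rhoP t0).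
have fD (t : R) (f h : R -> R) : {for t, continuous f} -> {for t, continuous h} -> {for t, continuous (fun u => f u + h u)} by move=> cf ch; exact: cvgD.
have fB (t : R) (f h : R -> R) : {for t, continuous f} -> {for t, continuous h} -> {for t, continuous (fun u => f u - h u)} by move=> cf ch; exact: cvgB.
have fM (t : R) (f h : R -> R) : {for t, continuous f} -> {for t, continuous h} -> {for t, continuous (fun u => f u * h u)} by move=> cf ch; exact: cvgM.
have fZ (t c : R) (f : R -> R) : {for t, continuous f} -> {for t, continuous (fun u => c * f u)} by move=> cf; apply: (fM _ (fun=> c)) => //; exact: cvg_cst.
have ex t (t0 : t < 0) := (cA 0%N t isT t0, cB 0%N t isT t0, cA 1%N t isT t0, cB 1%N t isT t0, (cA 2%N t isT t0, cB 2%N t isT t0, cA 3%N t isT t0, cB 3%N t isT t0)).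
have dG1 (t : R) : t < 0 -> is_derive t 1 (fun u => 1 * (mu * x * A 3%N u + - (mu * y) * B 3%N u) +
    1 * (- (x ^+ 2 - y ^+ 2) * (rho u * A 1%N u) + 2 * x * y * (rho u * B 1%N u))) (gA t).
  move=> t0; apply: (wder_classical w1) t0 => [u u0|u u0|].
  - have [[[[cA0 cB0] cA1] cB1] [[[cA2 cB2] cA3] cB3]] := ex u u0.
    apply: (fD); apply: (fZ); apply: (fD); apply: (fZ) => //; apply: (fM) => //; exact: crho.
  - have [[[[cA0 cB0] cA1] cB1] [[[cA2 cB2] cA3] cB3]] := ex u u0.
    apply: (fD); [apply: (fB)|apply: (fZ); apply: (fB); apply: (fZ)].
    + by apply: (fM) => //; exact: (fZ).
    + by apply: (fM); [exact: (fZ)|apply: (fB); exact: (fZ)].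
    + by apply: (fB); exact: (fZ).
    + by apply: (fB); exact: (fZ).
  - by apply: filterS aeAB; [exact: (ae_filter_ringOfSetsType leb)|move=> u H /H[]].
have dG2 (t : R) : t < 0 -> is_derive t 1 (fun u => 1 * (mu * y * A 3%N u + mu * x * B 3%N u) +
    1 * (- (2 * x * y) * (rho u * A 1%N u) + - (x ^+ 2 - y ^+ 2) * (rho u * B 1%N u))) (gB t).
  move=> t0; apply: (wder_classical w2) t0 => [u u0|u u0|].
  - have [[[[cA0 cB0] cA1] cB1] [[[cA2 cB2] cA3] cB3]] := ex u u0.
    apply: (fD); apply: (fZ); apply: (fD); apply: (fZ) => //; apply: (fM) => //; exact: crho.
  - have [[[[cA0 cB0] cA1] cB1] [[[cA2 cB2] cA3] cB3]] := ex u u0.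
    apply: (fD); [apply: (fB)|apply: (fZ); apply: (fB); apply: (fZ)].
    + by apply: (fM) => //; exact: (fZ).
    + by apply: (fM); [exact: (fZ)|apply: (fD); exact: (fZ)].
    + by apply: (fD); exact: (fZ).
    + by apply: (fD); exact: (fZ).
  - by apply: filterS aeAB; [exact: (ae_filter_ringOfSetsType leb)|move=> u H /H[]].
have near_lt (t : R) : t < 0 -> \forall u \near t, u < 0 by move=> t0; exact: lt_nbhsl.
have [bA bB] : k ^+ 2 * A 0%N 0 + A 2%N 0 = 0 /\ k ^+ 2 * B 0%N 0 + B 2%N 0 = 0.
  move: bc1; rewrite !wE !exprS expr0 mulr1 => /eqP; rewrite eq_complex/= => /andP[/eqP h1 /eqP h2].
  by split; lra.
have [qA qB] : - (mu * (x * A 3%N 0 - y * B 3%N 0)) + 3 * mu * k ^+ 2 * (x * A 1%N 0 - y * B 1%N 0)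
    + rp * ((x ^+ 2 - y ^+ 2) * A 1%N 0 - 2 * x * y * B 1%N 0) + g * k ^+ 2 * rp * A 0%N 0 = 0 /\
  - (mu * (x * B 3%N 0 + y * A 3%N 0)) + 3 * mu * k ^+ 2 * (x * B 1%N 0 + y * A 1%N 0)
    + rp * ((x ^+ 2 - y ^+ 2) * B 1%N 0 + 2 * x * y * A 1%N 0) + g * k ^+ 2 * rp * B 0%N 0 = 0.
  move: bc2; rewrite !wE => bc2.
  exact: (complex_bc2 erefl erefl erefl erefl erefl bc2).
have rE0 := ext_r0 rhoP.
have y0 : y = 0.
  apply: (@real_eigenvalue x y A B x0 LAB cAB dAB).
  - move=> t t0; have [dA1 dB1] := dAB 1%N isT t t0.
    have near_t := near_lt t t0; split.
    + apply: der_eq (der_near (derB (derZ (3 * mu * k ^+ 2) (derB (derZ x dA1) (derZ y dB1))) (dG1 t t0)) _) _; last by rewrite /gA; ring.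
      by near=> u; rewrite ext_r_lt0; [ring|near: u].
    + apply: der_eq (der_near (derB (derZ (3 * mu * k ^+ 2) (derD (derZ x dB1) (derZ y dA1))) (dG2 t t0)) _) _; last by rewrite /gB; ring.
      by near=> u; rewrite ext_r_lt0; [ring|near: u].
  - by rewrite /= rE0 -[RHS]qA; ring.
  - by rewrite /= rE0 -[RHS]qB; ring.
  - by rewrite /= [A 2%N 0 + _]addrC bA [B 2%N 0 + _]addrC bB; ring.
  - by rewrite /= [A 2%N 0 + _]addrC bA [B 2%N 0 + _]addrC bB; ring.
  - exists tn => //= -[h1 h2]; move/eqP: phn; apply; rewrite wE h1 h2.
    by apply/eqP; rewrite eq_complex/= !eqxx.
subst y; exists x => //.
(* With a real value, the real and imaginary parts solve the problem separately, and one of them is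
   nonzero at [tn]. *)
have red (V : nat -> R -> R) (sg : (V = A) \/ (V = B)) : V 0%N tn != 0 -> chr a g mu k rm rp r s x.
  move=> Vn; have dV j : (j < 3)%N -> forall t : R, t < 0 -> is_derive t 1 (V j) (V j.+1 t).
    by case: sg => -> j3 t /(dAB _ j3)[].
  apply: (@real_solution_chr R a g mu k rm rp rho a_gt0 mu_gt0 k_gt0 rhoP x V x0).
  - by case: sg => -> j /LAB[].
  - by case: sg => -> j /cAB[].
  - move=> t t0; have near_t := near_lt t t0; have dV1 := dV 1%N isT t t0.
    have dG : is_derive t 1 (fun u => x * mu * V 3%N u - x ^+ 2 * (rho u * V 1%N u))
       (V 0%N t * (g * k ^+ 2 * s t) - k ^+ 2 * r t * (x ^+ 2 * V 0%N t)
        + mu * (2 * k ^+ 2 * (x * V 2%N t) - k ^+ 4 * (x * V 0%N t))).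
      case: sg => ->.
        apply: der_eq (der_near (dG1 t t0) _) _; last by rewrite /gA; ring.
        by near=> u; ring.
      apply: der_eq (der_near (dG2 t t0) _) _; last by rewrite /gB; ring.
      by near=> u; ring.
    apply: der_eq (der_near (derB (derZ (3 * x * mu * k ^+ 2) dV1) dG) _) _; last by ring.
    by near=> u; rewrite ext_r_lt0; [ring|near: u].
  - by case: sg => ->.
  - case: sg => ->; [rewrite -[RHS]qA|rewrite -[RHS]qB]; ring.
  - by exists tn.
have [A0|A0] := eqVneq (A 0%N tn) 0; last by apply: (red A) A0; left.
apply: (red B); first by right.
apply/eqP => B0; move/eqP: phn; apply; rewrite wE A0 B0.
by apply/eqP; rewrite eq_complex/= !eqxx.
Unshelve. all: by end_near. Qed.

End RealEigenvalue.

(** * Smoothness and exponential decay *)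

Section HalfSmooth.
Context {R : realType}.
Implicit Types (f h : R -> R) (b c : R).

(** Regularity up to 0 and decay at rate [b] of all derivatives, tracked together. Rates add under
    products, and rate 0 covers the coefficients, which are merely bounded. *)
Fixpoint hs n b f : Prop :=
  [/\ exists C, forall x, x < 0 -> `|f x| <= C * expR (b * x),
      cvg (f x @[x --> 0^'-]) &
      if n is m.+1 then exists2 f', (forall x : R, x < 0 -> is_derive x 1 f (f' x)) & hs m b f'
      else True].

Lemma hs_bound n b f : hs n b f -> exists C, forall x, x < 0 -> `|f x| <= C * expR (b * x).
Proof. by case: n => [|n] []. Qed.

Lemma hs_lim n b f : hs n b f -> cvg (f x @[x --> 0^'-]).
Proof. by case: n => [|n] []. Qed.

Lemma hsW n b f : hs n.+1 b f -> hs n b f.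
Proof.
elim: n f => [|n IH] f [h1 h2 [f' df hf]]; split => //.
by exists f' => //; exact: IH.
Qed.

Lemma near0_left (x : R) : x < 0 -> \forall y \near x, y < 0.
Proof. by move=> x0; exact: lt_nbhsl. Qed.

Lemma hs_ext n b f h : (forall x, x < 0 -> f x = h x) -> hs n b f -> hs n b h.
Proof.
move=> fh hf; have [[C hC] cf] : (exists C, forall x, x < 0 -> `|f x| <= C * expR (b * x)) /\ cvg (f x @[x --> 0^'-]).
  by split; [exact: hs_bound hf|exact: hs_lim hf].
have H1 : exists C, forall x, x < 0 -> `|h x| <= C * expR (b * x).
  by exists C => x x0; rewrite -fh// hC.
have H2 : cvg (h x @[x --> 0^'-]).
  have [/(_ cf)[l hl] _] := cvg_ex (f x @[x --> 0^'-]); apply/cvg_ex; exists l.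
  apply: cvg_trans hl; apply: near_eq_cvg; near=> y; apply: fh.
  by near: y; exact: nbhs_left_lt.
case: n hf => [|n] hf; first exact: (And3 H1 H2 I).
split; [exact: H1|exact: H2|]; have [_ _ hd] := hf.
have [f' df hf'] := hd; exists f'; last exact: hf'.
move=> x x0.
apply: (der_near (df x x0)); near=> y; apply: fh; near: y; exact: near0_left.
Unshelve. all: by end_near. Qed.

Lemma hs_derive1 n b f : hs n.+1 b f -> hs n b (derive1 f).
Proof. by move=> [_ _ [f' df]]; apply: hs_ext => x x0; rewrite (der1E (df x x0)). Qed.

Lemma hs_der n b f (x : R) : hs n.+1 b f -> x < 0 -> is_derive x 1 f (derive1 f x).
Proof. by move=> [_ _ [f' df _]] x0; rewrite (der1E (df x x0)); exact: df. Qed.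

Lemma hs_continuous n b f (x : R) : hs n.+1 b f -> x < 0 -> {for x, continuous f}.
Proof. by move=> hf x0; exact: der_continuous (hs_der hf x0). Qed.

Lemma hsD n b f h : hs n b f -> hs n b h -> hs n b (fun x => f x + h x).
Proof.
elim: n f h => [|n IH] f h [[C hC] cf df] [[C' hC'] ch dh]; split; try exact: is_cvgD;
  try by exists (C + C') => x x0; rewrite mulrDl (le_trans (ler_normD _ _))// lerD ?hC ?hC'.
  by [].
have [f' df' hf] := df; have [h' dh' hh] := dh.
exists (fun x => f' x + h' x); last exact: IH.
by move=> x x0; apply: derD; [exact: df'|exact: dh'].
Qed.

Lemma hs_cst n c : hs n 0 (fun=> c).
Proof.
have h d : exists C, forall x : R, x < 0 -> `|d| <= C * expR (0 * x).
  by exists `|d| => x _; rewrite mul0r expR0 mulr1.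
elim: n c => [|n IH] c; split => //; try exact: is_cvg_cst.
exists (fun=> 0) => [x _|]; [exact: der_cst|exact: IH].
Qed.

Lemma hsM n b b' f h : hs n b f -> hs n b' h -> hs n (b + b') (fun x => f x * h x).
Proof.
have bd (u v : R -> R) : (exists C, forall x, x < 0 -> `|u x| <= C * expR (b * x)) ->
    (exists C, forall x, x < 0 -> `|v x| <= C * expR (b' * x)) ->
    exists C, forall x, x < 0 -> `|u x * v x| <= C * expR ((b + b') * x).
  move=> [C hC] [C' hC']; exists (C * C') => x x0.
  rewrite normrM mulrDl expRD mulrACA; apply: ler_pM => //; [exact: hC|exact: hC'].
elim: n f h => [|n IH] f h hf hh; split; try (apply: is_cvgM; [exact: hs_lim hf|exact: hs_lim hh]);
  try (apply: bd; [exact: hs_bound hf|exact: hs_bound hh]).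
  by [].
exists (fun x => derive1 f x * h x + f x * derive1 h x).
  by move=> x x0; apply: derM; [exact: hs_der hf x0|exact: hs_der hh x0].
apply: hsD; [apply: IH (hsW hh); exact: hs_derive1|apply: IH; [exact: hsW|exact: hs_derive1]].
Qed.

Lemma hsZ n b c f : hs n b f -> hs n b (fun x => c * f x).
Proof. by move=> hf; have := hsM (hs_cst n c) hf; rewrite add0r. Qed.

Lemma hsB n b f h : hs n b f -> hs n b h -> hs n b (fun x => f x - h x).
Proof.
move=> hf /(hsZ (-1)) hh; apply: hs_ext (hsD hf hh) => x _; by rewrite mulN1r.
Qed.

Lemma hs_sum n b m (F : 'I_m -> R -> R) : 0 = b \/ (0 < m)%N -> (forall i, hs n b (F i)) ->
  hs n b (fun x => \sum_i F i x).
Proof.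
elim: m F => [|m IH] F mb hF.
  by case: mb => [<-|//]; apply: hs_ext (hs_cst n 0) => x _; rewrite big_ord0.
case: m IH F mb hF => [|m] IH F mb hF.
  by apply: hs_ext (hF ord0) => x _; rewrite big_ord_recl big_ord0 addr0.
apply: hs_ext (hsD (hF ord0) (IH (fun i => F (lift ord0 i)) _ (fun i => hF _))); last by right.
by move=> x _; rewrite [RHS]big_ord_recl.
Qed.

Lemma hs_Ny n b f : 0 < b -> hs n b f -> f x @[x --> -oo] --> (0 : R).
Proof.
move=> b0 hf; have [C hC] := hs_bound hf.
have e0 : C * expR (b * x) @[x --> -oo] --> (0 : R).
  rewrite -[X in _ --> X](mulr0 C); apply: cvgM; first exact: cvg_cst.
  apply/cvgrPdist_lt => e e0; near=> x; rewrite sub0r normrN ger0_norm ?expR_ge0//.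
  rewrite -ltr_ln ?posrE ?expR_gt0// expRK -ltr_pdivlMl//.
  near: x; exact: nbhs_ninfty_lt (num_real _).
apply/norm_cvg0P; apply: (squeeze_cvgr _ (cvg_cst _) e0); near=> x.
rewrite normr_ge0 hC//; near: x; exact: nbhs_ninfty_lt (num_real _).
Unshelve. all: by end_near. Qed.

End HalfSmooth.

Section ProfileSmooth.
Context {R : realType}.
Variables (a g mu k rm rp : R) (rho : R -> R).
Hypotheses (a_gt0 : 0 < a) (g_gt0 : 0 < g) (mu_gt0 : 0 < mu) (k_gt0 : 0 < k)
  (rhoP : density_assumption a rm rp rho).
Local Notation r := (ext_r rho).
Local Notation s := (ext_s rho).
Local Notation decay := (decay mu k rm).

Lemma continuous_bounded_seg (f : R -> R) p q : p <= q -> continuous f ->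
  exists C, forall x, p <= x <= q -> `|f x| <= C.
Proof.
move=> pq cf; have cn : continuous (fun x => `|f x|).
  by move=> x; apply: (@continuous_comp _ _ _ f (fun y => `|y|)); [exact: cf|exact: norm_continuous].
have [c _ hc] := EVT_max pq (continuous_subspaceT cn).
by exists `|f c| => x xpq; apply: hc; rewrite in_itv.
Qed.

Lemma hs_rho n : hs n 0 rho.
Proof.
have [dr [cr _]] := density_smooth rhoP.
have dz j (x : R) : x < - a -> derive1n j.+1 rho x = 0.
  elim: j x => [|j IH] x xa; rewrite derive1nS.
    have x0 : x < 0 by apply: lt_trans xa _; rewrite oppr_lt0.
    by rewrite -(ext_s_lt0 _ x0); exact: (ext_s_lt_a a_gt0 rhoP xa).
  apply: der1E; apply: (der_near (der_cst 0 x)); near=> y; rewrite IH//.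
  by near: y; exact: lt_nbhsl.
suff H j : hs n 0 (derive1n j rho) by exact: (H 0%N).
elim: n j => [|n IH] j.
  split => //.
  pose l := lim (derive1n j rho x @[x --> 0^'-]).
  pose f (x : R) := if x < 0 then derive1n j rho x else l.
  have cf : continuous f.
    apply: continuous_ext0 => [x x0|x x0|].
    - have dj : is_derive x 1 (derive1n j rho) (derive1 (derive1n j rho) x).
        by apply: derivable_der; exact: dr.
      apply: (@der_continuous _ _ _ (derive1 (derive1n j rho) x)).
      apply: (der_near dj); near=> y; rewrite /f ifT//; near: y; exact: near0_left.
    - by rewrite /f ltxx ltNge x0.
    - rewrite {2}/f ltxx; apply: cvg_trans (cr j); apply: near_eq_cvg; near=> y.
      by rewrite /f ifT//; near: y; exact: nbhs_left_lt.
  have na0 : - a <= 0 by rewrite oppr_le0 ltW.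
  have [C hC] := continuous_bounded_seg na0 cf.
  (* [C] bounds the derivative on [-a, 0[; below -a every derivative vanishes and rho itself is
     [rm]. *)
  exists (Num.max C rm) => x x0; rewrite mul0r expR0 mulr1 le_max.
  have [xa|xa] := leP (- a) x.
    by apply/orP; left; have := hC x; rewrite /f x0 xa (ltW x0) => ->.
  apply/orP; right; have rm0 := density_minus_gt0 rhoP.
  case: {cf f hC C l} j => [|j]; first by rewrite /= (density_minus rhoP) ?(ltW xa)// gtr0_norm.
  by rewrite dz// normr0 ltW.
split; [exact: hs_bound (IH j)|exact: hs_lim (IH j)|].
exists (derive1n j.+1 rho); last exact: IH.
by move=> x x0; rewrite derive1nS; apply: derivable_der; exact: dr.
Unshelve. all: by end_near. Qed.

Lemma zero_left (u : R -> R) c : continuous u -> (forall t, t < c -> u t = 0) -> u c = 0.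
Proof.
move=> cu hu; apply/esym; apply: (cvg_unique (@Rhausdorff R) _ (cvg_at_left_filter (cu c))).
by apply: cvg_near_cst; near=> y; apply: hu; near: y; exact: nbhs_left_lt.
Unshelve. all: by end_near. Qed.

Lemma exp_solution (u : R -> R) kap c x : (forall y : R, y <= c -> is_derive y 1 u (kap * u y)) ->
  x <= c -> u x = u c * expR (kap * (x - c)).
Proof.
move=> du xc; have H := @eq_der0 R (fun y => u y * expR (- kap * y))
  (fun y => kap * u y * expR (- kap * y) + u y * (- kap * expR (- kap * y))) x c xc.
have h : u x * expR (- kap * x) = u c * expR (- kap * c).
  apply: H => y /andP[_ yc]; last by ring.
  by apply: derM; [exact: du|exact: der_expR].
rewrite -[LHS]mulr1 -expR0 -(addNr (kap * x)) expRD mulrA -mulNr h -mulrA -expRD.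
by congr (_ * expR _); ring.
Qed.

(** The argument of [real_solution_chr] read backwards: [bc_left] makes the two growing components
    vanish at -a, hence on all of ]-oo, -a]. The momenta there are combinations of the positions,
    and the slower of the two remaining rates is [k]. *)
Lemma chr_decay (lam : R) Y : 0 < lam -> ham g mu k r s lam (fun=> 0) Y -> bc_left a mu k rm lam Y ->
  forall i, (i < 4)%N -> exists C, forall x, x < 0 -> `|Y i x| <= C * expR (k * x).
Proof.
move=> l0 hY [b2 b3] i i4; have rm0 := density_minus_gt0 rhoP.
have kk := k_gt0; have mu0 := mu_gt0; have aa := a_gt0.
have m0 := decay_gt mu_gt0 k_gt0 rm0 l0; have m2 := decay_sqr k mu_gt0 rm0 l0.
set m := decay lam in m0 m2 b2 b3.
have rmE : rm = mu / lam * (m ^+ 2 - k ^+ 2) by rewrite m2; field; rewrite !gt_eqF.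
have lm0 : 0 < lam * mu by rewrite mulr_gt0.
have cY j : (j < 4)%N -> continuous (Y j) by move=> j4; exact: (ham_continuous j4 hY).
have rt t : t <= - a -> r t = rm by exact: (ext_r_le_a a_gt0 rhoP).
have st t : t <= - a -> s t = 0.
  rewrite le_eqVlt => /orP[/eqP ->|]; last exact: (ext_s_lt_a a_gt0 rhoP).
  by apply: zero_left (ext_s_continuous rhoP) _ => y; exact: (ext_s_lt_a a_gt0 rhoP).
pose u1 t := Y 2%N t + k * Y 3%N t - 2 * (lam * mu) * k ^+ 2 * Y 1%N t
   - lam * mu * k * (k ^+ 2 + m ^+ 2) * Y 0%N t.
pose u2 t := Y 2%N t + m * Y 3%N t - lam * mu * (m ^+ 2 + k ^+ 2) * Y 1%N t
   - 2 * (lam * mu) * k ^+ 2 * m * Y 0%N t.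
have du1 (t : R) : t <= - a -> is_derive t 1 u1 (- k * u1 t).
  move=> ta; have [h0 h1 h2 h3] := hY t.
  apply: der_eq (derB (derB (derD h2 (derZ k h3)) (derZ _ h1)) (derZ _ h0)) _.
  rewrite rt// st// /u1 rmE; field; rewrite !gt_eqF//.
have du2 (t : R) : t <= - a -> is_derive t 1 u2 (- m * u2 t).
  move=> ta; have [h0 h1 h2 h3] := hY t.
  apply: der_eq (derB (derB (derD h2 (derZ m h3)) (derZ _ h1)) (derZ _ h0)) _.
  rewrite rt// st// /u2 rmE; field; rewrite !gt_eqF//.
have z1 t : t <= - a -> u1 t = 0.
  by move=> ta; rewrite (exp_solution du1 ta) [u1 (- a)](_ : _ = 0) ?mul0r// /u1 b2 b3; ring.
have z2 t : t <= - a -> u2 t = 0.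
  by move=> ta; rewrite (exp_solution du2 ta) [u2 (- a)](_ : _ = 0) ?mul0r// /u2 b2 b3; ring.
have mk0 : m - k != 0 by rewrite subr_eq0 gt_eqF.
have Y3E t : t <= - a -> Y 3%N t = lam * mu * (- (k * (m - k)) * Y 0%N t + (m + k) * Y 1%N t).
  by move=> ta; apply: (mulfI mk0); have := z1 t ta; have := z2 t ta; rewrite /u1 /u2; lra.
have Y2E t : t <= - a -> Y 2%N t = lam * mu * (k * m * (m + k) * Y 0%N t - k * (m - k) * Y 1%N t).
  by move=> ta; have := z1 t ta; rewrite /u1 Y3E//; lra.
(* These combinations diagonalise the remaining 2 by 2 system: subtracting k phi leaves the exp(m t)
   part, subtracting m phi the exp(k t) part. *)
pose v t := Y 1%N t - k * Y 0%N t; pose w t := Y 1%N t - m * Y 0%N t.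
have dv (t : R) : t <= - a -> is_derive t 1 v (m * v t).
  move=> ta; have [h0 h1 _ _] := hY t; apply: der_eq (derB h1 (derZ k h0)) _.
  rewrite /v Y3E//; field; rewrite !gt_eqF//.
have dw (t : R) : t <= - a -> is_derive t 1 w (k * w t).
  move=> ta; have [h0 h1 _ _] := hY t; apply: der_eq (derB h1 (derZ m h0)) _.
  rewrite /w Y3E//; field; rewrite !gt_eqF//.
have bv t : t <= - a -> `|v t| <= `|v (- a)| * expR (k * (t + a)).
  move=> ta; rewrite (exp_solution dv ta) normrM ler_wpM2l// ger0_norm ?expR_ge0// opprK ler_expR.
  have : 0 <= (m - k) * - (t + a) by rewrite mulr_ge0//; lra.
  by lra.
have bw t : t <= - a -> `|w t| <= `|w (- a)| * expR (k * (t + a)).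
  by move=> ta; rewrite (exp_solution dw ta) normrM ler_wpM2l// ger0_norm ?expR_ge0// opprK.
have Y0E t : Y 0%N t = (m - k)^-1 * v t - (m - k)^-1 * w t by rewrite /v /w; field.
have Y1E t : Y 1%N t = m / (m - k) * v t - k / (m - k) * w t by rewrite /v /w; field.
have bd (al be : R) : exists C, forall t, t <= - a -> `|al * v t - be * w t| <= C * expR (k * (t + a)).
  exists (`|al| * `|v (- a)| + `|be| * `|w (- a)|) => t ta; rewrite mulrDl.
  rewrite (le_trans (ler_normB _ _))// !normrM -!mulrA lerD// ler_wpM2l//; [exact: bv|exact: bw].
have [C hC] : exists C, forall t, t <= - a -> `|Y i t| <= C * expR (k * (t + a)).
  case: i i4 => [|[|[|[|//]]]] _.
  - have [C hC] := bd (m - k)^-1 (m - k)^-1; by exists C => t /hC; rewrite -Y0E.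
  - have [C hC] := bd (m / (m - k)) (k / (m - k)); by exists C => t /hC; rewrite -Y1E.
  - have [C hC] := bd (lam * mu * (k * m * (m + k) * (m - k)^-1 - k * (m - k) * (m / (m - k))))
      (lam * mu * (k * m * (m + k) * (m - k)^-1 - k * (m - k) * (k / (m - k)))).
    exists C => t ta; have := hC t ta; congr (`|_| <= _); rewrite Y2E// Y0E Y1E; ring.
  - have [C hC] := bd (lam * mu * (- (k * (m - k)) * (m - k)^-1 + (m + k) * (m / (m - k))))
      (lam * mu * (- (k * (m - k)) * (m - k)^-1 + (m + k) * (k / (m - k)))).
    exists C => t ta; have := hC t ta; congr (`|_| <= _); rewrite Y3E// Y0E Y1E; ring.
have na0 : - a <= 0 by lra.
have [C' hC'] := continuous_bounded_seg na0 (cY i i4).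
have C'0 : 0 <= C' by apply: le_trans (hC' 0 _); rewrite ?na0 ?lexx.
exists (Num.max (C * expR (k * a)) (C' * expR (k * a))) => x x0.
have [xa|xa] := leP x (- a).
  apply: le_trans (hC x xa) _; rewrite mulrDr expRD mulrCA mulrC ler_wpM2r ?expR_ge0//.
  by rewrite mulrC le_max lexx.
apply: (@le_trans _ _ C'); first by apply: hC'; rewrite !ltW.
apply: (@le_trans _ _ (C' * expR (k * a) * expR (k * x))); last by rewrite ler_wpM2r ?expR_ge0// le_max lexx orbT.
rewrite -mulrA -expRD ler_peMr// -expR0 ler_expR -mulrDr mulr_ge0//; lra.
Unshelve. all: by end_near. Qed.

(** Bootstrap: the system writes each derivative as a combination of the components with
    coefficients of rate 0, so one order is gained per step and the decay rate is kept. *)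
Lemma chr_hs (lam : R) Y : 0 < lam -> ham g mu k r s lam (fun=> 0) Y -> bc_left a mu k rm lam Y ->
  forall n i, (i < 4)%N -> hs n k (Y i).
Proof.
move=> l0 hY bY n i i4; have dk := chr_decay l0 hY bY.
have cY j : (j < 4)%N -> continuous (Y j) by move=> j4; exact: (ham_continuous j4 hY).
have lY j : (j < 4)%N -> cvg (Y j x @[x --> 0^'-]).
  by move=> j4; apply/cvg_ex; exists (Y j 0); apply: cvg_at_left_filter; exact: cY.
elim: n i i4 => [|n IH] i i4; split; [exact: dk|exact: lY|by []|exact: dk|exact: lY|].
have hr : hs n 0 r by apply: hs_ext (hs_rho n) => x x0; rewrite ext_r_lt0.
have hss : hs n 0 s by apply: hs_ext (hs_derive1 (hs_rho n.+1)) => x x0; rewrite ext_s_lt0.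
have /hamP h := hY; exists (fun x => \sum_(j < 4) coef g mu k r s lam i j x * Y j x).
  by move=> x x0; apply: der_eq (h (Ordinal i4) x) _; rewrite oppr0 if_same addr0.
apply: hs_sum => [|j]; first by right.
have hc : hs n 0 (coef g mu k r s lam i j).
  case: i i4 => [|[|[|[|//]]]] _; case: j => [[|[|[|[|//]]]] hj] /=; rewrite /coef; try exact: hs_cst.
  - by apply: hsB; exact: hsZ.
  - by apply: hsD; [exact: hsZ|exact: hs_cst].
by have := hsM hc (IH j (ltn_ord j)); rewrite add0r.
Qed.

End ProfileSmooth.

Section ExponentialDecay.
Context {R : realType}.
Local Notation leb := (@lebesgue_measure R).
Local Notation D := (`]-oo, 0[%classic : set R).
Implicit Types (f h : R -> R) (b : R).

Lemma integrable_expR b : 0 < b -> leb.-integrable D (EFin \o (fun x => expR (b * x))).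
Proof.
move=> b0; have cexp c : continuous (fun x : R => expR (c * x)).
  by move=> x; apply: (der_continuous (der_expR c x)).
have mD : measurable (D : set (measurableTypeR R)) by exact: measurable_itv.
have mD' : measurable (`]-oo, - 0] : set (measurableTypeR R)) by exact: measurable_itv.
have H : (\int[leb]_(x in `]-oo, (- 0)%R]) (expR (b * x))%:E < +oo)%E.
  rewrite (@ge0_integration_by_substitutionNy R (fun x => expR (b * x)) 0); first last.
  - by move=> x _; exact: expR_ge0.
  - exact: continuous_subspaceT.
  have e x : ((fun x0 : R => expR (b * x0)) \o -%R) x = expR (- b * x) by rewrite /= mulrN mulNr.
  under eq_integral do rewrite e.
  have dF (x : R) : is_derive x 1 (fun x => - b^-1 * expR (- b * x)) (expR (- b * x)).
    by apply: der_eq (derZ (- b^-1) (der_expR (- b) x)) _; rewrite mulrA mulrNN mulVf ?mul1r// gt_eqF.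
  rewrite (@ge0_continuous_FTC2y R _ (fun x => - b^-1 * expR (- b * x)) 0 0)//.
  - by rewrite -EFinB ltry.
  - exact: continuous_subspaceT.
  - rewrite -[X in _ --> X](mulr0 (- b^-1)); apply: cvgM; first exact: cvg_cst.
    apply/cvgrPdist_lt => e' e0; near=> x; rewrite sub0r normrN ger0_norm ?expR_ge0//.
    rewrite -ltr_ln ?posrE ?expR_gt0// expRK mulNr ltrNl -ltr_pdivrMl//.
    by near: x; exact: nbhs_pinfty_gt (num_real _).
  - by apply: cvg_at_right_filter; exact: der_continuous (dF 0).
  - by move=> x _; apply: der1E.
have i0 : leb.-integrable (`]-oo, - 0]) (EFin \o (fun x => expR (b * x))).
  apply/integrableP; split.
    by apply/measurable_EFinP; apply: measurable_funTS; exact: continuous_measurable_fun.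
  apply: le_lt_trans H; apply: ge0_le_integral => //.
  - by apply: measurableT_comp => //; apply/measurable_EFinP; apply: measurable_funTS; exact: continuous_measurable_fun.
  - by apply/measurable_EFinP; apply: measurable_funTS; exact: continuous_measurable_fun.
  - by move=> x _; rewrite /= ger0_norm ?expR_ge0.
apply: integrableS i0 => //; rewrite oppr0; move=> x /=; rewrite !in_itv/=; exact: ltW.
Unshelve. all: by end_near. Qed.

Lemma hs_measurable n b f : hs n.+1 b f -> measurable_fun D f.
Proof.
move=> hf; apply: open_continuous_measurable_fun; first exact: interval_open.
by move=> x; rewrite inE/= in_itv/= => x0; exact: hs_continuous hf x0.
Qed.

Lemma hs_L2 n b f : 0 < b -> hs n.+1 b f -> L2 leb D f.
Proof.
move=> b0 hf; have mf := hs_measurable hf; split => //.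
have mD : measurable (D : set (measurableTypeR R)) by exact: measurable_itv.
have [C hC] := hs_bound hf; have b2 : 0 < 2 * b by rewrite mulr_gt0.
have C0 : 0 <= C.
  rewrite -(pmulr_lge0 _ (expR_gt0 (b * -1))); by apply: le_trans (hC (-1) _).
have i := integrableZl mD (C ^+ 2) (integrable_expR b2).
apply: le_integrable i => //.
  by apply/measurable_EFinP; apply: measurable_funX.
move=> x; rewrite /= in_itv/= => x0; rewrite lee_fin.
rewrite ger0_norm ?sqr_ge0// ger0_norm ?mulr_ge0 ?sqr_ge0 ?expR_ge0//.
rewrite -mulrA mulr_natl mulr2n expRD -expr2 -exprMn -(real_normK (num_real (f x))).
by rewrite ler_pXn2r ?nnegrE ?mulr_ge0 ?expR_ge0// hC.
Qed.

Lemma hs_weak b f h : 0 < b -> hs 1 b f -> hs 1 b h ->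
  (forall x : R, x < 0 -> is_derive x 1 f (h x)) -> weak_derivative f h.
Proof.
move=> b0 hf hh df; have Lf := hs_L2 b0 hf; have Lh := hs_L2 b0 hh; split => // theta th.
have [d0 c0 c1 [p [q [pq q0 z]]]] := test_halflineP th.
have mD : measurable (D : set (measurableTypeR R)) by exact: measurable_itv.
have i1 : leb.-integrable D (EFin \o (fun x => f x * derive1 theta x)).
  by apply: (integrable_L2_test (p := p) Lf q0 c1) => x /z[].
have i2 : leb.-integrable D (EFin \o (fun x => h x * theta x)).
  by apply: (integrable_L2_test (p := p) Lh q0 c0) => x /z[].
apply/eqP; rewrite -addr_eq0 -RintegralD//; apply/eqP.
pose G x := h (Num.min x q) * theta x + f (Num.min x q) * derive1 theta x.
have cG : continuous G.
  by apply: ctD; apply: ctM => //; apply: continuous_minr => x xq;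
    [apply: (hs_continuous hh)|apply: (hs_continuous hf)]; exact: le_lt_trans xq q0.
rewrite (_ : Rintegral _ _ _ = \int[leb]_(x in D) G x); last first.
  apply: eq_Rintegral => x _; rewrite /G addrC.
  have [xq|/ltW xq] := leP x q => //.
  by have [-> ->] := z x (or_intror xq); rewrite !mulr0.
rewrite (Rint_support pq q0 cG); last by move=> x /z; rewrite /G => -[-> ->]; rewrite !mulr0 addr0.
have dF (x : R) : p <= x <= q -> is_derive x 1 (fun x => f x * theta x) (G x).
  move=> /andP[px xq]; rewrite /G (min_idPl xq); apply: derM.
  by apply: df; exact: le_lt_trans xq q0.
have -> := itg_FTC (ltW pq) cG dF.
by have [-> _] := z p (or_introl (lexx p)); have [-> _] := z q (or_intror (lexx q)); rewrite !mulr0 subr0.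
Qed.

End ExponentialDecay.

Section RealValue.
Context {R : realType}.
Variables (a g mu k rm rp : R) (rho : R -> R).
Hypotheses (a_gt0 : 0 < a) (g_gt0 : 0 < g) (mu_gt0 : 0 < mu) (k_gt0 : 0 < k)
  (rhoP : density_assumption a rm rp rho).
Local Notation leb := (@lebesgue_measure R).
Local Notation r := (ext_r rho).
Local Notation s := (ext_s rho).
Local Notation gam := (g * k ^+ 2).

(* phi, phi', ..., phi'''' recovered from the phase space variables of [ham]. *)
Definition eigen_der (lam : R) (Y : nat -> R -> R) (j : nat) (x : R) : R :=
  let w2 := Y 3%N x / (lam * mu) - k ^+ 2 * Y 0%N x in
  match j with
  | 0 => Y 0%N x | 1 => Y 1%N x | 2 => w2
  | 3 => (lam ^+ 2 * r x * Y 1%N x + 3 * (lam * mu) * k ^+ 2 * Y 1%N x - Y 2%N x) / (lam * mu)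
  | _ => (lam ^+ 2 * (s x * Y 1%N x + r x * w2) + 3 * (lam * mu) * k ^+ 2 * w2
      - ((lam ^+ 2 * k ^+ 2 * r x - gam * s x) * Y 0%N x + k ^+ 2 * Y 3%N x)) / (lam * mu)
  end.

Lemma eigen_der_der (lam : R) Y : 0 < lam -> ham g mu k r s lam (fun=> 0) Y ->
  forall j, (j < 4)%N -> forall x : R, x < 0 -> is_derive x 1 (eigen_der lam Y j) (eigen_der lam Y j.+1 x).
Proof.
move=> l0 hY j j4 x x0; have [h0 h1 h2 h3] := hY x.
have lm0 : lam * mu != 0 by rewrite mulf_neq0// gt_eqF.
have dv (f : R -> R) (d : R) : is_derive x 1 f d -> is_derive x 1 (fun y => f y / (lam * mu)) (d / (lam * mu)).
  by move=> df; apply: der_eq (derM df (der_cst _ x)) _; rewrite mulr0 addr0.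
have dr := der_ext_r rhoP x0.
case: j j4 => [|[|[|[|//]]]] _.
- exact: h0.
- exact: h1.
- apply: der_eq (derB (dv _ _ h3) (derZ (k ^+ 2) h0)) _; rewrite /eigen_der; field.
  by move: lm0; rewrite mulf_eq0 negb_or => /andP[-> ->].
- apply: der_eq (dv _ _ (derB (derD (derM (derZ (lam ^+ 2) dr) h1) (derZ (3 * (lam * mu) * k ^+ 2) h1)) h2)) _.
  rewrite /eigen_der; congr (_ / _); ring.
Qed.

Lemma eigen_der_hs (lam : R) Y : 0 < lam -> ham g mu k r s lam (fun=> 0) Y -> bc_left a mu k rm lam Y ->
  forall n j, (j <= 4)%N -> hs n k (eigen_der lam Y j).
Proof.
move=> l0 hY bY n j j4; have Ys := chr_hs a_gt0 mu_gt0 k_gt0 rhoP l0 hY bY.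
elim: j j4 n => [|j IH] j4 n; first exact: (Ys n 0%N).
apply: hs_ext (hs_derive1 (IH (ltnW j4) n.+1)) => x x0.
by apply: der1E; exact: (eigen_der_der l0 hY).
Qed.

Lemma eigen_der_continuous (lam : R) Y j : ham g mu k r s lam (fun=> 0) Y -> (j < 4)%N ->
  continuous (eigen_der lam Y j).
Proof.
move=> hY; have cY i : (i < 4)%N -> continuous (Y i) by move=> i4; exact: (ham_continuous i4 hY).
have cr := ext_r_continuous rhoP.
case: j => [|[|[|[|//]]]] _; rewrite /eigen_der/=.
- exact: cY.
- exact: cY.
- by apply: ctB; apply: ctM; try exact: ct_cst; exact: cY.
- apply: ctM; last exact: ct_cst; apply: ctB; last exact: cY.
  by apply: ctD; apply: ctM; try exact: cY; [apply: ctM => //; exact: ct_cst|exact: ct_cst].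
Qed.

Lemma eigen_der_equation (lam : R) Y x : 0 < lam -> x < 0 ->
  let w := eigen_der lam Y in
  lam ^+ 2 * (k ^+ 2 * rho x * w 0%N x - (derive1 rho x * w 1%N x + rho x * w 2%N x))
   + lam * mu * (w 4%N x - 2 * k ^+ 2 * w 2%N x + k ^+ 4 * w 0%N x)
   = g * k ^+ 2 * derive1 rho x * w 0%N x.
Proof.
move=> l0 x0 /=; rewrite -(ext_r_lt0 rho x0) -(ext_s_lt0 rho x0) /eigen_der; field.
by rewrite !gt_eqF.
Qed.

Lemma eigen_der_bc (lam : R) Y : 0 < lam -> bc_right g k rp Y ->
  let w := eigen_der lam Y in
  k ^+ 2 * w 0%N 0 + w 2%N 0 = 0 /\
  - (lam * mu * w 3%N 0) + (3 * lam * mu * k ^+ 2 + lam ^+ 2 * rp) * w 1%N 0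
    + g * k ^+ 2 * rp * w 0%N 0 = 0.
Proof.
move=> l0 [br1 br2]; rewrite /eigen_der br1; split; first by ring.
by rewrite (ext_r0 rhoP) -[RHS]br2; field; rewrite !gt_eqF.
Qed.

(** The point given by [chr] may lie in the artificial region x >= 0. Were phi zero on x < 0, the
    system would make the other components vanish there one after the other, and uniqueness would
    give Y = 0. *)
Lemma chr_nontrivial (lam : R) Y : 0 < lam -> ham g mu k r s lam (fun=> 0) Y -> (exists x, Y 0%N x != 0) ->
  exists2 x, x < 0 & Y 0%N x != 0.
Proof.
move=> l0 hY [x xn]; apply: contrapT => N.
have Z t : t < 0 -> Y 0%N t = 0.
  by move=> t0; apply/eqP; apply: contrapT => /negP tn; apply: N; exists t.
have dz (f : R -> R) (t d : R) : (forall u, u < 0 -> f u = 0) -> t < 0 -> is_derive t 1 f d -> d = 0.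
  move=> fz t0 df; apply: der_unique df _; apply: (der_near (der_cst 0 t)); near=> u.
  by rewrite fz//; near: u; exact: near0_left.
have lm0 : lam * mu != 0 by rewrite mulf_neq0// gt_eqF.
have Z1 t : t < 0 -> Y 1%N t = 0 by move=> t0; have [h _ _ _] := hY t; exact: dz h.
have Z3 t : t < 0 -> Y 3%N t = 0.
  move=> t0; have [_ h _ _] := hY t; have := dz _ _ _ Z1 t0 h.
  by rewrite Z// mulr0 subr0 => /eqP; rewrite mulf_eq0 invr_eq0 (negPf lm0) orbF => /eqP.
have Z2 t : t < 0 -> Y 2%N t = 0.
  move=> t0; have [_ _ _ h] := hY t; have := dz _ _ _ Z3 t0 h.
  by rewrite Z1// mulr0 sub0r => /eqP; rewrite oppr_eq0 => /eqP.
have [S sS] := ext_s_bounded a_gt0 rhoP.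
move/eqP: xn; apply; apply: (@ham_unique R g mu k rm rp S r s _ _ _ _ _ lam Y (-1) hY) => //.
- exact: density_minus_gt0 rhoP.
- exact: (ext_r_ge a_gt0 rhoP).
- exact: ext_r_le rhoP.
- exact: ext_s_ge0 rhoP.
have n10 : (-1 : R) < 0 by rewrite oppr_lt0.
by case=> [|[|[|[|//]]]] _; [exact: Z|exact: Z1|exact: Z2|exact: Z3].
Unshelve. all: by end_near. Qed.

Lemma real_complexM (x : R) (z : R[i]) : real_complex R x * z = Complex (x * complex.Re z) (x * complex.Im z).
Proof. by case: z => c d; apply/eqP; rewrite eq_complex/= !mul0r subr0 addr0 !eqxx. Qed.

Lemma chr_characteristic_value (kv : R * R) (lam : R) : wavenumber kv = k ->
  chr a g mu k rm rp r s lam -> characteristic_value g mu rp rho kv (real_complex R lam).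
Proof.
move=> kvE [l0 [Y [hY bY br nY]]].
(* Capping the order at 4 makes the jet total in [j] while keeping the smoothness and decay of every
   entry. *)
pose w j := eigen_der lam Y (minn j 4).
have wder j (x : R) : (j < 4)%N -> x < 0 -> is_derive x 1 (w j) (w j.+1 x).
  by move=> j4 x0; rewrite /w (minn_idPl (ltnW j4)) (minn_idPl j4); exact: eigen_der_der.
have whs n j : hs n k (w j) by apply: eigen_der_hs => //; exact: geq_minr.
have w0 n : hs n k (fun=> 0 : R).
  by apply: hs_ext (hsZ 0 (whs n 0%N)) => x _; rewrite mul0r.
have cw j : (j < 4)%N -> continuous (w j).
  by move=> j4; rewrite /w (minn_idPl (ltnW j4)); exact: eigen_der_continuous.
split; first by [].
pose W j x := real_complex R (w j x).
pose fl x := s x * w 1%N x + r x * w 2%N x.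
have hr n : hs n 0 rho by exact: (hs_rho a_gt0 rhoP).
have hfl : hs 1 k fl.
  have hs1 := hsM (hs_derive1 (hr 2%N)) (whs 1%N 1%N); have hs2 := hsM (hr 1%N) (whs 1%N 2%N).
  rewrite add0r in hs1 hs2; apply: hs_ext (hsD hs1 hs2) => x x0.
  by rewrite /fl ext_r_lt0// ext_s_lt0.
have z0 : weak_derivative (fun=> 0 : R) (fun=> 0).
  by apply: (hs_weak k_gt0) => // x _; exact: der_cst.
exists (W 0%N), W, (fun x => real_complex R (fl x)); split; [split|split; [|split; [|split; [|split; [|split]]]]].
- by [].
- move=> j j4; split; split => //=.
  + by apply: (hs_weak k_gt0) => // x; exact: wder.
  + by apply: continuous_subspaceT; exact: cw.
  + by apply: continuous_subspaceT => x; exact: cvg_cst.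
- split.
  + have := @hs_weak R k (fun x => rho x * w 1%N x) fl k_gt0; rewrite (_ : (fun x => complex.Re _) = (fun x => rho x * w 1%N x)).
      apply => //; first by have := hsM (hr 1%N) (whs 1%N 1%N); rewrite add0r.
      move=> x x0; apply: der_eq (derM (der_rho rhoP x0) (wder 1%N x isT x0)) _.
      by rewrite /fl ext_r_lt0.
    by apply/funext => x; rewrite real_complexM.
  + rewrite (_ : (fun x => complex.Im _) = (fun=> 0))//.
    by apply/funext => x; rewrite real_complexM/= mulr0.
- have [x x0 xn] := chr_nontrivial l0 hY nY; exists x; split => //.
  by rewrite /W fmorph_eq0.
- apply: aeW => x x0; rewrite kvE /W -!rmorphXn -[2 : R[i]](rmorph_nat (real_complex R)).
  rewrite -!(rmorphM, rmorphB, rmorphD) /=; congr (real_complex R _).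
  by rewrite -(eigen_der_equation Y l0 x0) /fl /w ext_r_lt0// ext_s_lt0.
- rewrite kvE /W -rmorphXn -!(rmorphM, rmorphD) -[RHS](rmorph0 (real_complex R)); congr (real_complex R _).
  exact: (eigen_der_bc l0 br).1.
- rewrite kvE /W -!rmorphXn -[3 : R[i]](rmorph_nat (real_complex R)).
  rewrite -!(rmorphM, rmorphN, rmorphD) -[RHS](rmorph0 (real_complex R)); congr (real_complex R _).
  exact: (eigen_der_bc l0 br).2.
- exact: (hs_Ny k_gt0 (whs 0%N 0%N)).
- exact: cvg_cst.
Qed.

Lemma characteristic_sequence_ex (kv : R * R) : wavenumber kv = k ->
  exists lam : nat -> R, characteristic_sequence g mu rp rho kv lam /\
    forall n, chr a g mu k rm rp r s (lam n).
Proof.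
move=> kvE; have [S sS] := ext_s_bounded a_gt0 rhoP.
have [lam [l0 ld lc lP]] := @chr_sequence R a g mu k rm rp S r s a_gt0 g_gt0 mu_gt0 k_gt0
  (density_minus_gt0 rhoP) (ext_r_continuous rhoP) (ext_s_continuous rhoP)
  (ext_r_ge a_gt0 rhoP) (ext_r_le rhoP) (ext_s_ge0 rhoP) sS (ext_s_dense rhoP).
exists lam; split; last by move=> n; apply/lP; exists n.
split => // z; split.
  move=> /(characteristic_value_chr a_gt0 mu_gt0 k_gt0 rhoP kvE) [x -> /lP[n ->]].
  by exists n.
by move=> [n ->]; apply: chr_characteristic_value kvE _; apply/lP; exists n.
Qed.

End RealValue.

(** * Waves and their Sobolev regularity *)

Section PartialDerivatives.
Context {R : realType}.
Implicit Types (f h : R * R * R -> R) (x : R * R * R) (i : 'I_3).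

Lemma near_eq_differentiable (V : normedModType R) (f h : V -> R) (x : V) :
  (\near x, f x = h x) -> differentiable f x -> differentiable h x.
Proof.
move=> fh df; have [c e] := (diff_locallyP x f).1 df.
have fhx : f x = h x by exact: nbhs_singleton fh.
have e' : h \o shift x = cst (h x) + 'd f x +o_ (0 : V) id.
  apply/eqaddoP => _/posnumP[eps]; move/eqaddoP : e => /(_ _ [gt0 of eps%:num]) e.
  have fh' : \forall z \near (0 : V), f (z + x) = h (z + x).
    by move: fh; rewrite (near_shift 0) /= subr0.
  near=> z; have : (f \o shift x - (cst (f x) + 'd f x)) z = (h \o shift x - (cst (h x) + 'd f x)) z.
    have fz : f (z + x) = h (z + x) by near: z.
    by rewrite /= !fctE /= fz fhx.
  by move=> <-; near: z.
have E := diff_unique c e'.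
apply/diff_locallyP; rewrite E; split => //.
Unshelve. all: by end_near. Qed.

Definition coord3 i x : R := if i == 0 then x.1.1 else if i == 1 then x.1.2 else x.2.

(** [upd i x] parametrises the coordinate line through [x] in direction [i], which reduces partial
    derivatives, and later the integrals over the cell, to one real variable. *)
Definition upd i x (t : R) : R * R * R :=
  if i == 0 then (t, x.1.2, x.2) else if i == 1 then (x.1.1, t, x.2) else (x.1.1, x.1.2, t).

Lemma ord3E i : [\/ i = 0, i = 1 | i = 2].
Proof. by case: i => [[|[|[|//]]]] hi; [apply: Or31|apply: Or32|apply: Or33]; apply: val_inj. Qed.

Lemma edir_upd i x (h t : R) : h *: edir i + upd i x t = upd i x (h + t).
Proof.
by have [->|->|->] := ord3E i; rewrite /edir /upd/=; congr (_, _, _);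
  rewrite /= ?eqxx /GRing.scale/= ?mulr1 ?mulr0 ?add0r.
Qed.

Lemma upd_coord3 i x : upd i x (coord3 i x) = x.
Proof. by have [->|->|->] := ord3E i; case: x => [[]]. Qed.

Lemma pdiff_upd i f x (t a : R) : is_derive t 1 (fun u => f (upd i x u)) a ->
  is_derive (upd i x t) (edir i) f a.
Proof.
move=> df; pose p (u : R) := f (upd i x (u + t)).
have dp : is_derive (0 : R) 1 p a.
  have df0 : is_derive (0 + t) 1 (fun u => f (upd i x u)) a by rewrite add0r.
  have := @der_comp R (fun u => f (upd i x u)) (fun u => u + t) 0 a (1 + 0) df0 (derD (der_id 0) (der_cst t 0)).
  by rewrite addr0 mulr1.
have E : (fun h : R => h^-1 *: ((f \o shift (upd i x t)) (h *: edir i) - f (upd i x t))) =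
    (fun h : R => h^-1 *: ((p \o shift 0) (h *: (1 : R)) - p 0)).
  by apply/funext => h; rewrite /p/= edir_upd /GRing.scale/= mulr1 addr0 add0r.
case: dp => dp1 dp2; apply: DeriveDef; rewrite /derivable /derive E; [exact: dp1|exact: dp2].
Qed.

Lemma pdiffE i f x (a : R) : is_derive (coord3 i x) 1 (fun u => f (upd i x u)) a -> pdiff i f x = a.
Proof. by move=> /pdiff_upd; rewrite upd_coord3 => df; rewrite /pdiff (@derive_val _ _ _ _ _ _ _ df). Qed.

Lemma upd_pdiff i f x (t : R) : differentiable f (upd i x t) ->
  is_derive t 1 (fun u => f (upd i x u)) (pdiff i f (upd i x t)).
Proof.
move=> df; have [d1 _] : is_derive (upd i x t) (edir i) f (pdiff i f (upd i x t)).
  by apply: DeriveDef => //; exact: diff_derivable.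
pose p (u : R) := f (upd i x (u + t)).
have E : (fun h : R => h^-1 *: ((f \o shift (upd i x t)) (h *: edir i) - f (upd i x t))) =
    (fun h : R => h^-1 *: ((p \o shift 0) (h *: (1 : R)) - p 0)).
  by apply/funext => h; rewrite /p/= edir_upd /GRing.scale/= mulr1 addr0 add0r.
have dp : is_derive (0 : R) 1 p (pdiff i f (upd i x t)).
  by apply: DeriveDef; rewrite /derivable /pdiff /derive -E.
have dp0 : is_derive (t - t) 1 p (pdiff i f (upd i x t)) by rewrite subrr.
have := @der_comp R p (fun u => u - t) t _ (1 - 0) dp0 (derB (der_id t) (der_cst t t)); rewrite subr0 mulr1.
by congr is_derive; apply/funext => u; rewrite /p subrK.
Qed.

Lemma open_Omega : open (@Omega R).
Proof.
rewrite (_ : Omega = snd @^-1` `]-oo, 0[%classic); last first.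
  by apply/seteqP; split => x /=; rewrite /Omega/= in_itv.
apply: open_comp; last exact: interval_open.
by move=> x _; exact: cvg_snd.
Qed.

Lemma near_Omega x : Omega x -> \near x, Omega x.
Proof. by move=> xO; apply: open_nbhs_nbhs; split; [exact: open_Omega|]. Qed.

Lemma pdiff_near i f h x : Omega x -> (forall y, Omega y -> f y = h y) -> pdiff i f x = pdiff i h x.
Proof.
move=> xO fh; apply: near_eq_derive; near=> y; apply: fh; near: y; exact: near_Omega.
Unshelve. all: by end_near. Qed.

Lemma pdiffZ i f x (e : R) : differentiable f x -> pdiff i (fun y => e * f y) x = e * pdiff i f x.
Proof. by move=> df; rewrite /pdiff -[RHS]/(e *: _) -deriveZ//; exact: diff_derivable. Qed.

End PartialDerivatives.

Section Waves.
Context {R : realType}.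
Variables (kv : R * R) (b : R).
Hypothesis b_gt0 : 0 < b.
Implicit Types (f h : R * R * R -> R) (x : R * R * R) (F : R -> R).

(** With a boolean, differentiation negates it and contributes the sign [(-1) ^+ c], so iterated
    derivatives of waves need no case analysis. *)
Definition trig (c : bool) : R -> R := if c then cos else sin.

Lemma der_trig c (t : R) : is_derive t 1 (trig c) ((-1) ^+ c * trig (~~ c) t).
Proof.
case: c => /=; last by apply: der_eq (is_derive_sin t) _; rewrite mul1r.
by apply: der_eq (is_derive_cos t) _; rewrite mulN1r.
Qed.

Lemma trig_le1 c t : `|trig c t| <= 1.
Proof. by case: c; rewrite ler_norml /= ?cos_geN1 ?cos_le1 ?sin_geN1 ?sin_le1. Qed.

(** The class of separated functions containing all fields of the modes. It is stable under every
    partial derivative, so regularity and integrability are proved once for the class. *)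
Definition wave c F f := (forall n, hs n b F) /\
  forall x, Omega x -> f x = trig c (phase kv x.1) * F x.2.

Definition dprofile (i : 'I_3) (c : bool) F : R -> R :=
  if i == 0 then fun t => (-1) ^+ c * kv.1 * F t
  else if i == 1 then fun t => (-1) ^+ c * kv.2 * F t else derive1 F.

Definition dtrig (i : 'I_3) (c : bool) := if i == 2 then c else ~~ c.

Lemma waveZ c F f l : wave c F f -> wave c (fun t => l * F t) (fun x => l * f x).
Proof. by move=> [hF E]; split => [n|x xO]; [exact: hsZ|rewrite E//; ring]. Qed.

Lemma wave_pdiff i c F f : wave c F f -> wave (dtrig i c) (dprofile i c F) (pdiff i f).
Proof.
move=> [hF E]; split => [n|x xO].
  by have [->|->|->] := ord3E i; rewrite /dprofile/=; [exact: hsZ|exact: hsZ|exact: hs_derive1].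
rewrite (pdiff_near i xO E); apply: pdiffE.
have dph (u v t : R) : is_derive t 1 (fun s => u * s + v) u.
  by apply: der_eq (derD (derZ u (der_id t)) (der_cst v t)) _; rewrite mulr1 addr0.
have [->|->|->] := ord3E i; rewrite /upd /coord3 /dprofile /dtrig /phase/=.
- apply: der_eq (derM (@der_comp R (trig c) (fun s => kv.1 * s + kv.2 * x.1.2) _ _ _ (der_trig c _) (dph _ _ _)) (der_cst _ _)) _; ring.
- have dph' (t : R) : is_derive t 1 (fun s => kv.1 * x.1.1 + kv.2 * s) kv.2.
    by have := dph kv.2 (kv.1 * x.1.1) t; under eq_fun do rewrite addrC.
  apply: der_eq (derM (@der_comp R (trig c) (fun s => kv.1 * x.1.1 + kv.2 * s) _ _ _ (der_trig c _) (dph' _)) (der_cst _ _)) _; ring.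
- apply: der_eq (derZ _ (hs_der (hF 1%N) xO)) _; ring.
Qed.

Fixpoint dtrigs l c := if l is i :: l' then dtrig i (dtrigs l' c) else c.
Fixpoint dprofiles l c F := if l is i :: l' then dprofile i (dtrigs l' c) (dprofiles l' c F) else F.

Lemma wave_pdiffs l c F f : wave c F f -> wave (dtrigs l c) (dprofiles l c F) (pdiffs l f).
Proof. by move=> w; elim: l => //= i l; exact: wave_pdiff. Qed.

Lemma differentiable_fst (V W : normedModType R) (x : V * W) : differentiable (fst : V * W -> V) x.
Proof. have lin : linear (fst : V * W -> V) by [].
pose p : {linear (V * W)%type -> V} := HB.pack (fst : V * W -> V) (GRing.isLinear.Build R (V * W)%type V *:%R fst lin).
by apply: (@linear_differentiable _ _ _ p) => y; exact: cvg_fst. Qed.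

Lemma differentiable_snd (V W : normedModType R) (x : V * W) : differentiable (snd : V * W -> W) x.
Proof. have lin : linear (snd : V * W -> W) by [].
pose p : {linear (V * W)%type -> W} := HB.pack (snd : V * W -> W) (GRing.isLinear.Build R (V * W)%type W *:%R snd lin).
by apply: (@linear_differentiable _ _ _ p) => y; exact: cvg_snd. Qed.

Lemma wave_differentiable c F f x : wave c F f -> Omega x -> differentiable f x.
Proof.
move=> [hF E] xO; apply: (@near_eq_differentiable R _ (fun x => trig c (phase kv x.1) * F x.2)).
  by near=> y; rewrite E//; near: y; exact: near_Omega.
have d1 : differentiable (fun y : R * R * R => y.1.1) x.
  by apply: (@differentiable_comp _ _ _ _ fst fst); exact: differentiable_fst.
have d2 : differentiable (fun y : R * R * R => y.1.2) x.
  by apply: (@differentiable_comp _ _ _ _ fst snd); [exact: differentiable_fst|exact: differentiable_snd].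
have d3 : differentiable (fun y : R * R * R => phase kv y.1) x.
  by apply: differentiableD; apply: differentiableM => //; exact: differentiable_cst.
apply: differentiableM.
  apply: (@differentiable_comp _ _ _ _ (fun y : R * R * R => phase kv y.1) (trig c)) => //.
  by apply/derivable1_diffP; case: (der_trig c (phase kv x.1)).
apply: (@differentiable_comp _ _ _ _ snd F); first exact: differentiable_snd.
by apply/derivable1_diffP; case: (hs_der (hF 1%N) xO).
Unshelve. all: by end_near. Qed.

Lemma wave_lim c F f xh l : wave c F f -> F z @[z --> 0^'-] --> l ->
  f (xh, z) @[z --> 0^'-] --> trig c (phase kv xh) * l.
Proof.
move=> [hF E] Fl; apply: cvg_trans (limZ (c := trig c (phase kv xh)) Fl).
apply: near_eq_cvg; near=> z; rewrite E//.
by rewrite /Omega/=; near: z; exact: nbhs_left_lt.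
Unshelve. all: by end_near. Qed.

Lemma wave_smooth c F f : wave c F f -> smooth_Omega f.
Proof.
move=> w l; have w' := wave_pdiffs l w; split=> [x xO|xh].
  exact: wave_differentiable w' xO.
have [hF _] := w'; have [/(_ (hs_lim (hF 0%N)))[m hm] _] := cvg_ex (dprofiles l c F z @[z --> 0^'-]).
by apply/cvg_ex; exists (trig (dtrigs l c) (phase kv xh) * m); exact: wave_lim w' hm.
Qed.

Variable L : R.
Hypotheses (L_gt0 : 0 < L) (kL : frequency L kv).

Lemma trig_periodic c (t : R) (m : int) : trig c (t + m%:~R * (2 * pi)) = trig c t.
Proof.
have H (n : nat) u : trig c (u + n%:R * (2 * pi)) = trig c u.
  have -> : n%:R * (2 * pi) = pi *+ 2 *+ n :> R by rewrite !mulr_natl.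
  case: c => /=; apply: periodicn;
   [exact: cosD2pi|exact: sinD2pi].
case: m => n; first exact: H.
by rewrite NegzE -{2}(subrK ((n.+1)%:R * (2 * pi)) t) H mulrNz mulNr.
Qed.

Lemma phase_periodic c m1 m2 xh : trig c (phase kv (shift_h L m1 m2 xh)) = trig c (phase kv xh).
Proof.
have [n1 [n2 ->]] := kL; rewrite /phase /shift_h/=.
have L0 : L != 0 by rewrite gt_eqF.
rewrite -[RHS](trig_periodic c _ (n1 * m1 + n2 * m2)); congr trig.
by rewrite rmorphD !rmorphM /=; field.
Qed.

Lemma wave_periodic c F f : wave c F f -> periodic_on L Omega f.
Proof. by move=> [hF E] m1 m2 x xO; rewrite !E//= phase_periodic. Qed.

Lemma wave_regular c F f (h : R -> R) : (forall t : R, derivable h t 1) -> wave c F f ->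
  regular_field L (fun t x => h t * f x).
Proof.
move=> dh w; split => [t|t|t x _].
- exact: wave_smooth (waveZ (h t) w).
- exact: wave_periodic (waveZ (h t) w).
- by apply: derivableM => //; exact: derivable_cst.
Qed.

End Waves.

(** * Measurability and integration over the periodicity cell *)

Section Caratheodory.
Context {R : realType} {d : measure_display} {T : measurableType d}.

(* [f] is the limit of the functions [f (x, floor (n y) / n)]. *)
Lemma measurable_caratheodory (f : T * measurableTypeR R -> R) :
  (forall y, measurable_fun setT (fun x => f (x, y))) ->
  (forall x, continuous (fun y : R => f (x, y))) -> measurable_fun setT f.
Proof.
move=> mf cf.
pose fl n (y : R) : R := (Num.floor (n.+1%:R * y))%:~R / n.+1%:R.
pose h n (z : T * measurableTypeR R) : R := f (z.1, fl n z.2).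
apply: (measurable_fun_cvg (h := h)); last first.
  move=> [x y] _; apply: (@cvg_comp _ _ _ (fun n => fl n y) (fun t => f (x, t)) _ (nbhs y)); last exact: cf.
  apply/cvgrPdist_lt => e e0; near=> n.
  have n0 : (0 : R) < n.+1%:R by rewrite ltr0n.
  have /andP[h1 h2] := floor_itv (n.+1%:R * y); rewrite intrD in h2.
  have E : y - fl n y = (n.+1%:R * y - (Num.floor (n.+1%:R * y))%:~R) / n.+1%:R.
    by rewrite /fl; field; rewrite gt_eqF.
  rewrite E ger0_norm; last by rewrite divr_ge0 ?subr_ge0// ltW.
  rewrite ltr_pdivrMr//; apply: (@lt_trans _ _ 1); first by rewrite ltrBlDl.
  rewrite mulrC -ltr_pdivrMr// mul1r.
  have : e^-1 < n%:R by near: n; exact: nbhs_infty_gtr.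
  by move=> /lt_trans; apply; rewrite ltr_nat.
move=> n _ B mB; rewrite setTI.
pose A (m : int) : set (measurableTypeR R) := [set y | Num.floor (n.+1%:R * y) = m].
have n0 : (0 : R) < n.+1%:R by rewrite ltr0n.
have -> : h n @^-1` B = \bigcup_(m : int) (((fun x => f (x, m%:~R / n.+1%:R)) @^-1` B) `*` A m).
  apply/seteqP; split => [[x y] /= hB|[x y] /= [m _ [/= hB mE]]].
    by exists (Num.floor (n.+1%:R * y)).
  by rewrite /h /fl/= mE.
apply: countable_bigcupT_measurable => [|m]; first exact: countableP.
apply: measurableX.
  by rewrite -[X in measurable X]setTI; exact: mf.
have -> : A m = `[m%:~R / n.+1%:R, (m + 1)%:~R / n.+1%:R[%classic.
  apply/seteqP; split => y /=; rewrite in_itv/= ler_pdivrMr// ltr_pdivlMr// ![y * _]mulrC.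
    by move=> <-; exact: floor_itv.
  by move=> hy; exact: floor_def.
exact: measurable_itv.
Unshelve. all: by end_near. Qed.

End Caratheodory.

Section IteratedIntegrals.
Context {R : realType} d1 d2 (T1 : measurableType d1) (T2 : measurableType d2).
Variables (m1 : {sigma_finite_measure set T1 -> \bar R})
  (m2 : {sigma_finite_measure set T2 -> \bar R}).
Variable f : T1 * T2 -> \bar R.
Hypothesis fi : (m1 \x m2)%E.-integrable setT f.

Lemma zero_iterated1 : (forall x, m2.-integrable setT (fun y => f (x, y)) ->
  (\int[m2]_y f (x, y) = 0)%E) -> (\int[m1 \x m2]_z f z = 0)%E.
Proof.
move=> f0; rewrite -integral12_prod_meas1//.
rewrite (ae_eq_integral (cst 0%E))//; first by rewrite integral0.
  exact: (measurable_fubini_F fi).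
apply: filterS (ae_integrable1 fi).
by move=> x /f0 + _.
Qed.

Lemma zero_iterated2 : (forall y, m1.-integrable setT (fun x => f (x, y)) ->
  (\int[m1]_x f (x, y) = 0)%E) -> (\int[m1 \x m2]_z f z = 0)%E.
Proof.
move=> f0; rewrite -integral21_prod_meas1//.
rewrite (ae_eq_integral (cst 0%E))//; first by rewrite integral0.
  exact: (measurable_fubini_G fi).
apply: filterS (ae_integrable2 fi).
by move=> x /f0 + _.
Qed.

End IteratedIntegrals.

Section IntegrableProduct.
Context {R : realType} d1 d2 (T1 : measurableType d1) (T2 : measurableType d2).
Variables (m1 : {sigma_finite_measure set T1 -> \bar R})
  (m2 : {sigma_finite_measure set T2 -> \bar R}).

Lemma integrable_setX_snd (A : set T1) (B : set T2) (f : T2 -> \bar R) :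
  measurable A -> measurable B -> (m1 A < +oo)%E -> m2.-integrable B f ->
  (m1 \x m2)%E.-integrable (A `*` B) (fun z => f z.2).
Proof.
move=> mA mB A_fin /integrableP[mf f_fin].
have mAB : measurable (A `*` B) by exact: measurableX.
have mfB : measurable_fun (A `*` B) (fun z => f z.2).
  apply: (@measurable_comp _ _ _ _ _ _ B) => //.
    by move=> _ [z [_ zB] <-].
  exact: (measurable_funTS measurable_snd).
apply/(integrable_mkcond _ mAB).
have mr : measurable_fun setT ((fun z : T1 * T2 => f z.2) \_ (A `*` B)).
  exact/(measurable_restrictT _ mAB).
apply/(@integrable12ltyP _ _ _ _ _ m1 m2 _ mr).
pose c := (\int[m2]_(y in B) `|f y|)%E.
have c0 : (0 <= c)%E by exact: integral_ge0.
have E x : (\int[m2]_y `|((fun z : T1 * T2 => f z.2) \_ (A `*` B)) (x, y)| = (fun=> c) \_ A x)%E.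
  rewrite patchE; have [xA|xA] := boolP (x \in A).
    rewrite /c [RHS]integral_mkcond; apply: eq_integral => y _; rewrite !patchE.
    have -> : ((x, y) \in A `*` B) = (y \in B).
      by apply/idP/idP; rewrite !inE /=; [case|move: xA; rewrite inE].
    by case: ifP => // _; rewrite abse0.
  apply: integral0_eq => y _; rewrite patchE ifF ?abse0//.
  by apply/negbTE; move: xA; apply: contra; rewrite !inE; case.
under eq_integral do rewrite E.
rewrite -integral_mkcond integral_cst// lte_mul_pinfty//.
by rewrite ge0_fin_numE.
Qed.

End IntegrableProduct.

Section SigmaFiniteProduct.
Context {R : realType} (d1 d2 : measure_display) (T1 : measurableType d1) (T2 : measurableType d2).
Variables (m1 : {sigma_finite_measure set T1 -> \bar R})
  (m2 : {sigma_finite_measure set T2 -> \bar R}).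

(* An alias of [m1 \x m2]: the library only infers the sigma-finiteness of
   products of subprobabilities. *)
Definition sigma_prod : set (T1 * T2) -> \bar R := (m1 \x m2)%E.

HB.instance Definition _ := Measure.copy sigma_prod (m1 \x m2)%E.

Lemma sigma_finite_prod : sigma_finite setT sigma_prod.
Proof.
have /sigma_finiteP[F [TF ndF Foo]] := sigma_finiteT m1.
have /sigma_finiteP[G [TG ndG Goo]] := sigma_finiteT m2.
exists (fun n => F n `*` G n).
  rewrite -setXTT TF TG; apply/seteqP; split => [[x y] /= [[n _ Fx] [k _ Gy]]|[x y] [n _ [/= Fx Gy]]].
    exists (maxn n k) => //; split => /=.
      by move: x Fx; exact/subsetPset/ndF/leq_maxl.
    by move: y Gy; exact/subsetPset/ndG/leq_maxr.
  by split; exists n.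
move=> n; have [mF Fn] := Foo n; have [mG Gn] := Goo n; split; first exact: measurableX.
rewrite /sigma_prod product_measure1E//.
by rewrite lte_mul_pinfty// ge0_fin_numE.
Qed.

HB.instance Definition _ := Measure_isSigmaFinite.Build _ _ _ sigma_prod sigma_finite_prod.

End SigmaFiniteProduct.

Section Cell.
Context {R : realType}.
Variable (L : R).
Hypothesis L_gt0 : 0 < L.
Local Notation leb := (@lebesgue_measure R).
Local Notation leb3 := ((leb \x leb) \x leb)%E.
Local Notation D := (`]-oo, 0[%classic : set R).
Local Notation RT := (measurableTypeR R).
Local Notation P := (2 * pi * L).
Local Notation I := (`[0, P]%classic : set RT).

Lemma period_gt0 : 0 < P.
Proof. by rewrite !mulr_gt0 ?pi_gt0. Qed.

Lemma cellE : cell L = (I `*` I) `*` (D : set RT).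
Proof.
apply/seteqP; split => [[[x y] z]|[[x y] z]] /=; rewrite /cell/= !in_itv/=.
  by case.
by move=> [[]].
Qed.

Lemma measurable_cell : measurable (cell L : set (RT * RT * RT)).
Proof. by rewrite cellE; apply: measurableX; [apply: measurableX|]; exact: measurable_itv. Qed.

(** Measurability for the product sigma-algebra, obtained by adding one variable at a time with
    [measurable_caratheodory]. *)
Lemma continuous_measurable3 (th : R * R * R -> R) : continuous th ->
  measurable_fun (setT : set (RT * RT * RT)) th.
Proof.
move=> cth; apply: measurable_caratheodory => [z|x] /=; last first.
  move=> z; apply: (@continuous_comp _ _ _ (fun z : R => (x, z) : R * R * R) th); last exact: cth.
  exact: (cvg_pair (F := nbhs z) (f := fun=> x) (g := id) (cvg_cst x) cvg_id).
apply: measurable_caratheodory => [y|x] /=; last first.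
  move=> y; apply: (@continuous_comp _ _ _ (fun y : R => ((x, y), z) : R * R * R) th); last exact: cth.
  exact: (cvg_pair (F := nbhs y) (f := fun y => (x, y)) (g := fun=> z)
    (cvg_pair (F := nbhs y) (f := fun=> x) (g := id) (cvg_cst x) cvg_id) (cvg_cst z)).
apply: continuous_measurable_fun => x.
apply: (@continuous_comp _ _ _ (fun x : R => ((x, y), z) : R * R * R) th); last exact: cth.
exact: (cvg_pair (F := nbhs x) (f := fun x => (x, y)) (g := fun=> z)
  (cvg_pair (F := nbhs x) (f := id) (g := fun=> y) cvg_id (cvg_cst y)) (cvg_cst z)).
Qed.

Lemma integrable_cell_expR b : 0 < b ->
  leb3.-integrable (cell L) (fun x => (expR (b * x.2))%:E).
Proof.
move=> b0; have mI : measurable I by exact: measurable_itv.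
rewrite cellE.
have mII : measurable (I `*` I) by exact: measurableX.
have mD : measurable (D : set RT) by exact: measurable_itv.
have fin : (sigma_prod leb leb (I `*` I) < +oo)%E.
  rewrite /sigma_prod product_measure1E//= lebesgue_measure_itv/= lte_fin period_gt0.
  by rewrite -EFinB -EFinM ltry.
exact: (integrable_setX_snd (m1 := sigma_prod leb leb) (m2 := leb) mII mD fin (integrable_expR b0)).
Qed.

(** A coordinate line misses the cell, or crosses it along a full period, or follows the vertical
    half-line. Boundary terms of an integration by parts cancel by periodicity in the second case
    and by compact support in the third. *)
Lemma cell_upd (i : 'I_3) (x : R * R * R) : exists2 A : set RT,
  forall t, cell L (upd i x t) <-> A t &
  [\/ A = set0, A = I /\ (forall t, Omega (upd i x t) /\
      exists m1 m2, upd i x (t + P) = (shift_h L m1 m2 (upd i x t).1, (upd i x t).2)) |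
      A = D /\ forall t, (upd i x t).2 = t].
Proof.
have sub A' (Q : Prop) : (forall t, cell L (upd i x t) <-> Q /\ A' t) ->
    exists2 A : set RT, (forall t, cell L (upd i x t) <-> A t) & A = set0 \/ Q /\ A = A'.
  move=> h; have [q|nq] := pselect Q.
    by exists A'; [move=> t; rewrite h; split => [[]|]|right].
  by exists set0; [move=> t; rewrite h; split => // -[]|left].
have [e|e|e] := ord3E i; subst i.
- have [|A hA h] := sub I (0 <= x.1.2 <= P /\ x.2 < 0).
    by move=> t; rewrite /cell /upd/= in_itv/=; split => [[]|[[]]].
  exists A => //; case: h => [->|[[_ x0] ->]]; [exact: Or31|apply: Or32; split => // t; split => //].
  by exists 1%:Z, 0; rewrite /shift_h /upd/= mul1r mul0r addr0.
- have [|A hA h] := sub I (0 <= x.1.1 <= P /\ x.2 < 0).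
    by move=> t; rewrite /cell /upd/= in_itv/=; split => [[]|[[]]].
  exists A => //; case: h => [->|[[_ x0] ->]]; [exact: Or31|apply: Or32; split => // t; split => //].
  by exists 0, 1%:Z; rewrite /shift_h /upd/= mul1r mul0r addr0.
- have [|A hA h] := sub D (0 <= x.1.1 <= P /\ 0 <= x.1.2 <= P).
    by move=> t; rewrite /cell /upd/= in_itv/=; split => [[]|[[]]].
  by exists A => //; case: h => [->|[_ ->]]; [exact: Or31|apply: Or33].
Qed.

End Cell.

Section IntegrationByParts.
Context {R : realType}.
Variables (kv : R * R) (b L : R).
Hypotheses (b_gt0 : 0 < b) (L_gt0 : 0 < L) (kL : frequency L kv).
Local Notation leb := (@lebesgue_measure R).
Local Notation leb3 := ((leb \x leb) \x leb)%E.
Local Notation D := (`]-oo, 0[%classic : set R).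
Local Notation RT := (measurableTypeR R).
Local Notation P := (2 * pi * L).
Local Notation wave := (wave kv b).
Implicit Types (f th : R * R * R -> R) (F : R -> R) (i : 'I_3).

Lemma wave_measurable c F f : wave c F f -> measurable_fun (cell L : set (RT * RT * RT)) f.
Proof.
move=> [hF E]; apply: (@eq_measurable_fun _ _ _ _ _ (fun x : RT * RT * RT => trig c (phase kv x.1) * F x.2)).
  by move=> x; rewrite inE => -[_ _ x0]; rewrite E.
apply: measurable_funM.
  apply: measurable_funTS; apply: (@measurableT_comp _ _ _ _ _ _ (trig c)).
    by apply: continuous_measurable_fun => t; exact: (der_continuous (der_trig c t)).
  by apply: measurable_funD; apply: measurable_funM => //; (apply: measurableT_comp => //).
apply: (@measurable_comp _ _ _ _ _ _ (D : set RT) F); last exact: (measurable_funTS measurable_snd).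
- exact: measurable_itv.
- by move=> _ [x [_ _ x0] <-]; rewrite /= in_itv.
- exact: hs_measurable (hF 1%N).
Qed.

Lemma wave_bound c F f : wave c F f -> exists C, forall x, Omega x -> `|f x| <= C * expR (b * x.2).
Proof.
move=> [hF E]; have [C hC] := hs_bound (hF 0%N); exists C => x xO.
rewrite E// normrM -[leRHS]mul1r; apply: ler_pM => //; [exact: trig_le1|exact: hC].
Qed.

Lemma cell_Omega x : cell L x -> Omega x.
Proof. by case. Qed.

Lemma integrable_cell_bound (f : R * R * R -> R) (C c : R) : 0 < c ->
  measurable_fun (cell L : set (RT * RT * RT)) f ->
  (forall x, cell L x -> `|f x| <= C * expR (c * x.2)) ->
  leb3.-integrable (cell L) (EFin \o f).
Proof.
move=> c0 mf hf; have mc := measurable_cell L.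
have i := integrableZl mc C (integrable_cell_expR L_gt0 c0).
apply: le_integrable i => //; first exact/measurable_EFinP.
move=> x xc; rewrite /= lee_fin; apply: le_trans (hf x xc) _; exact: ler_norm.
Qed.

Lemma wave_L2 c F f : wave c F f -> L2 leb3 (cell L) f.
Proof.
move=> w; have mf := wave_measurable w; split=> //.
have [C hC] := wave_bound w.
apply: (@integrable_cell_bound (fun x => f x ^+ 2) (C ^+ 2) (2 * b)); first by rewrite mulr_gt0.
  exact: measurable_funX.
move=> x /cell_Omega xO; rewrite ger0_norm ?sqr_ge0//.
rewrite -mulrA mulr_natl mulr2n expRD -expr2 -exprMn -(real_normK (num_real (f x))).
by rewrite ler_pXn2r ?nnegrE ?hC//; exact: le_trans (hC x xO).
Qed.

Lemma test_continuous th : test_Omega L th -> continuous th.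
Proof. by move=> [dth _ _] x; exact: differentiable_continuous (dth [::] x). Qed.

Lemma test_bounded th : test_Omega L th -> exists C, forall x, cell L x -> `|th x| <= C.
Proof.
move=> tth; have cth := test_continuous tth; have [_ _ [p [q [q0 supp]]]] := tth.
pose K : set (R * R * R) := (`[0, P] `*` `[0, P]) `*` `[p, q].
have cK : compact K by do 2! (apply: compact_setX; last exact: segment_compact); exact: segment_compact.
have /compact_bounded [M [_ hM]] : compact (th @` K).
  by apply: continuous_compact => //; exact: continuous_subspaceT.
exists (Num.max (M + 1) 0) => x [x1 x2 x3]; rewrite le_max.
have [->|t0] := eqVneq (th x) 0; first by rewrite normr0 lexx orbT.
apply/orP; left; apply: (hM (M + 1)); first by rewrite ltrDl.
by exists x => //; split; [split|]; rewrite /= in_itv//=; exact: supp.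
Qed.

Lemma wave_test_integrable c F f th : wave c F f -> test_Omega L th ->
  leb3.-integrable (cell L) (EFin \o (fun x => f x * th x)).
Proof.
move=> w t; have [C hC] := wave_bound w; have [M hM] := test_bounded t.
apply: (@integrable_cell_bound _ (M * C) b b_gt0).
  apply: measurable_funM; first exact: wave_measurable w.
  apply: measurable_funTS; exact: continuous_measurable3 (test_continuous t).
move=> x xc; rewrite normrM mulrC -mulrA; apply: ler_pM => //; [exact: hM|exact/hC/cell_Omega].
Qed.

Lemma test_pdiff i th : test_Omega L th -> test_Omega L (pdiff i th).
Proof.
move=> [dth pth [p [q [q0 supp]]]]; split.
- move=> l x; have := dth (rcons l i) x; by rewrite /pdiffs foldr_rcons.
- move=> m1 m2 x _; rewrite /pdiff /derive; 
  rewrite (_ : (fun h : R => h^-1 *: ((th \o shift (shift_h L m1 m2 x.1, x.2)) (h *: edir i) - th (shift_h L m1 m2 x.1, x.2))) =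
    (fun h => h^-1 *: ((th \o shift x) (h *: edir i) - th x)))//; apply/funext => h /=.
  rewrite -[in RHS](pth m1 m2 x I) -[in RHS](pth m1 m2 (h *: edir i + x) I); congr (_ *: (th _ - _)).
  by rewrite /shift_h/=; congr (_, _, _); rewrite /= addrA.
- exists p, q; split => // x; apply: contraNT => xpq.
  have E : \near x, th x = 0.
    have oS : open [set y : R * R * R | y.2 < p \/ q < y.2].
      have -> : [set y : R * R * R | y.2 < p \/ q < y.2] = snd @^-1` (`]-oo, p[ `|` `]q, +oo[).
        by apply/seteqP; split => y /=; rewrite !in_itv/= andbT.
      apply: open_comp; first by move=> y _; exact: cvg_snd.
      by apply: openU; exact: interval_open.
    have xS : [set y : R * R * R | y.2 < p \/ q < y.2] x.
      by move: xpq; rewrite negb_and -!ltNge => /orP[]; [left|right].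
    have := open_nbhs_nbhs (conj oS xS); apply: filterS => y yS.
    apply/eqP; apply: contraT => /supp /andP[h1 h2]; case: yS => /=; [rewrite ltNge h1|rewrite ltNge h2]; by [].
  by rewrite /pdiff (near_eq_derive (edir i) E) derive_cst.
Qed.

Lemma wave_ibp i c F f th : wave c F f -> test_Omega L th ->
  \int[leb3]_(x in cell L) (f x * pdiff i th x) = - \int[leb3]_(x in cell L) (pdiff i f x * th x).
Proof.
move=> w t; have mc := measurable_cell L.
have w' := wave_pdiff i w; have t' := test_pdiff i t.
have i1 := wave_test_integrable w t'; have i2 := wave_test_integrable w' t.
apply/eqP; rewrite -addr_eq0 -RintegralD//; apply/eqP.
pose G x := pdiff i f x * th x + f x * pdiff i th x.
have iG : leb3.-integrable (cell L) (EFin \o G) := integrableD mc i2 i1.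
rewrite (_ : Rintegral _ _ _ = \int[leb3]_(x in cell L) G x); last first.
  by apply: eq_Rintegral => x _; rewrite /G addrC.
rewrite /Rintegral integral_mkcond.
suff -> : (\int[leb3]_x ((fun x => (G x)%:E) \_ (cell L)) x = 0)%E by [].
have {}iG : leb3.-integrable setT ((fun x => (G x)%:E) \_ (cell L)).
  exact/(integrable_mkcond _ mc).
have [[dth pth _] [dth' _ _]] := (t, t').
have dG x u : Omega (upd i x u) -> is_derive u 1 (fun u => f (upd i x u) * th (upd i x u)) (G (upd i x u)).
  move=> xO; apply: derM; last exact: upd_pdiff (dth [::] _).
  exact: upd_pdiff (wave_differentiable w xO).
have cG x u : Omega (upd i x u) -> {for u, continuous (fun u => G (upd i x u))}.
  move=> xO; have c1 := der_continuous (upd_pdiff (wave_differentiable w xO)).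
  have c2 := der_continuous (upd_pdiff (wave_differentiable w' xO)).
  have c3 := der_continuous (upd_pdiff (i := i) (dth [::] (upd i x u))).
  have c4 := der_continuous (upd_pdiff (i := i) (dth' [::] (upd i x u))).
  by apply: cvgD; apply: cvgM.
(* [G] is the derivative of [f * th] along direction [i]. Integrating first in that direction, by
   Fubini, reduces the claim to single lines. *)
suff line x : (\int[leb]_u ((fun x => (G x)%:E) \_ (cell L)) (upd i x u) = 0)%E.
  have [e|e|e] := ord3E i; rewrite e in line.
  - apply: (@zero_iterated2 _ _ _ _ _ (sigma_prod leb leb) leb _ iG) => z izz.
    apply: (@zero_iterated2 _ _ _ _ _ leb leb _ izz) => y _; exact: (line (0, y, z)).
  - apply: (@zero_iterated2 _ _ _ _ _ (sigma_prod leb leb) leb _ iG) => z izz.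
    apply: (@zero_iterated1 _ _ _ _ _ leb leb _ izz) => y _; exact: (line (y, 0, z)).
  - apply: (@zero_iterated1 _ _ _ _ _ (sigma_prod leb leb) leb _ iG) => -[y z] _; exact: (line (y, z, 0)).
have [A hA hc] := cell_upd L i x.
have -> : (\int[leb]_u ((fun x => (G x)%:E) \_ (cell L)) (upd i x u))%E =
    (\int[leb]_(u in A) (G (upd i x u))%:E)%E.
  rewrite [RHS]integral_mkcond; apply: eq_integral => u _; rewrite !patchE.
  have -> // : (upd i x u \in cell L) = (u \in A).
  by apply/idP/idP; rewrite !inE => /hA.
have P0 := period_gt0 L_gt0.
case: hc => [->|[-> per]|[-> xO]]; first exact: integral_set0.
- have cGx : continuous (fun u => G (upd i x u)) by move=> u; apply: cG; exact: (per u).1.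
  have iI := continuous_integrable_seg 0 P cGx.
  have mI : measurable (`[0, P] : set RT) by exact: measurable_itv.
  have := Rint_seg P0 cGx; have -> := itg_FTC (ltW P0) cGx (fun u _ => dG x u (per u).1).
  have [m1 [m2 E]] := (per 0).2; rewrite add0r in E.
  rewrite E (wave_periodic L_gt0 kL w _ _ (per 0).1) (pth m1 m2) // subrr /Rintegral => /eqP.
  by rewrite fine_eq0 ?integrable_fin_num// => /eqP.
- have [_ _ [p1 [q1 [q10 supp1]]]] := t; have [_ _ [p2 [q2 [q20 supp2]]]] := t'.
  (* The interval from [p'] to [q'] strictly contains the supports of [th] and of its derivative; as
     [q'] stays below 0, truncating at [q'] gives a function continuous on the whole line. *)
  pose q := Num.max q1 q2; have q0 : q < 0 by rewrite gt_max q10.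
  pose q' := q / 2; have q'0 : q' < 0 by rewrite /q'; lra.
  have qq' : q < q' by rewrite /q'; lra.
  pose p' := Num.min (Num.min p1 p2) q - 1.
  have [p'1 p'2 p'q] : [/\ p' < p1, p' < p2 & p' < q].
    have hm v : Num.min (Num.min p1 p2) q <= v -> p' < v.
      by move=> hv; rewrite /p' ltrBlDr; apply: le_lt_trans hv _; rewrite ltrDl.
    by split; apply: (hm); rewrite !ge_min lexx ?orbT.
  have pq' : p' < q' by exact: lt_trans qq'.
  have z u : u <= p' \/ q' <= u -> th (upd i x u) = 0 /\ pdiff i th (upd i x u) = 0.
    move=> hu; split; apply/eqP; apply: contraT; [move=> /supp1|move=> /supp2]; rewrite xO => /andP[h1 h2].
      case: hu => hu; first by have := lt_le_trans p'1 (le_trans h1 hu); rewrite ltxx.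
      have : q < q by apply: lt_le_trans qq' _; apply: le_trans hu _; rewrite (le_trans h2)// le_max lexx.
      by rewrite ltxx.
    case: hu => hu; first by have := lt_le_trans p'2 (le_trans h1 hu); rewrite ltxx.
    have : q < q by apply: lt_le_trans qq' _; apply: le_trans hu _; rewrite (le_trans h2)// le_max lexx orbT.
    by rewrite ltxx.
  have Gz u : u <= p' \/ q' <= u -> G (upd i x u) = 0.
    by move=> /z[z1 z2]; rewrite /G z1 z2 !mulr0 addr0.
  pose H u := G (upd i x (Num.min u q')).
  have HE u : H u = G (upd i x u).
    rewrite /H; have [//|/ltW uq] := leP u q'.
    by rewrite !Gz//; right.
  have cH : continuous H.
    by apply: (@continuous_minr R (fun u => G (upd i x u)) q') => u uq; apply: cG; rewrite /Omega/= xO; exact: le_lt_trans uq q'0.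
  have Hz u : u <= p' \/ q' <= u -> H u = 0 by move=> hu; rewrite HE Gz.
  have mD : measurable (D : set RT) by exact: measurable_itv.
  have dH (u : R) : p' <= u <= q' -> is_derive u 1 (fun u => f (upd i x u) * th (upd i x u)) (H u).
    by move=> /andP[_ uq]; rewrite HE; apply: dG; rewrite /Omega/= xO; exact: le_lt_trans uq q'0.
  have := Rint_support pq' q'0 cH Hz; have -> := itg_FTC (ltW pq') cH dH.
  have [-> _] := z p' (or_introl (lexx p')); have [-> _] := z q' (or_intror (lexx q')).
  rewrite !mulr0 subrr /Rintegral => /eqP.
  rewrite fine_eq0 ?integrable_fin_num//; last exact: integrable_support q'0 cH Hz.
  by move=> /eqP <-; apply: eq_integral => u _; rewrite HE.
Qed.

(** Each integration by parts moves the outermost derivative of the test function onto the wave;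
    that the result is again a wave keeps the induction going. *)
Lemma wave_weak l : forall c F f, wave c F f -> exists h, weak_pdiffs L l f h /\ exists c' F', wave c' F' h.
Proof.
elim: l => [|i l IH] c F f w.
  exists f; split; last by exists c, F.
  split; [exact: wave_L2 w|exact: wave_L2 w|move=> th _].
  by rewrite /= expr0 mul1r.
have [h [[_ Lh hE] [c' [F' wh]]]] := IH _ _ _ (wave_pdiff i w).
exists h; split; last by exists c', F'.
split=> //; first exact: wave_L2 w.
move=> th t; have tl : test_Omega L (pdiffs l th).
  by elim: l {IH h Lh hE c' F' wh} => //= j l; exact: test_pdiff.
by rewrite /= (wave_ibp i w tl) hE// exprS mulN1r mulNr.
Qed.

Lemma wave_Hinfty c F f : wave c F f -> Hinfty L f.
Proof.
move=> w m; split; first exact: (wave_periodic L_gt0 kL w).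
by move=> l _; have [h [hw _]] := wave_weak l w; exists h.
Qed.

End IntegrationByParts.

Local Arguments eigen_der : simpl never.
Local Arguments trig : simpl never.

(** * Normal modes *)

Section NormalMode.
Context {R : realType}.
Variables (a g mu L rm rp : R) (rho : R -> R) (kv : R * R).
Hypotheses (a_gt0 : 0 < a) (g_gt0 : 0 < g) (mu_gt0 : 0 < mu) (L_gt0 : 0 < L)
  (rhoP : density_assumption a rm rp rho) (kL : frequency L kv).
Local Notation k := (wavenumber kv).
Hypothesis k_gt0 : 0 < k.
Local Notation r := (ext_r rho).
Local Notation s := (ext_s rho).
Variables (lam : R) (Y : nat -> R -> R).
Hypotheses (lam_gt0 : 0 < lam) (hY : ham g mu k r s lam (fun=> 0) Y)
  (bY : bc_left a mu k rm lam Y) (brY : bc_right g k rp Y) (Y_neq0 : exists x, Y 0%N x != 0).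
Local Notation w := (eigen_der g mu k rho lam Y).
Local Notation wave := (wave kv k).
Implicit Types (x : R * R * R) (i : 'I_3) (F : R -> R).

(** The horizontal velocity is taken parallel to the wave vector; the divergence condition then
    fixes its amplitude as - phi' / k^2. *)
Definition mode_h (kj : R) (t : R) : R := - (kj / k ^+ 2) * w 1%N t.
(** The pressure is solved from the horizontal momentum balance, where both components give the same
    profile. *)
Definition mode_q (t : R) : R :=
  - (k ^+ 2)^-1 * (lam * (rho t * w 1%N t) - mu * (w 3%N t - k ^+ 2 * w 1%N t)).
Definition mode_zeta (t : R) : R := - lam^-1 * (derive1 rho t * w 0%N t).

Definition mode_u i x : R :=
  if i == 0 then trig false (phase kv x.1) * mode_h kv.1 x.2
  else if i == 1 then trig false (phase kv x.1) * mode_h kv.2 x.2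
  else trig true (phase kv x.1) * w 0%N x.2.

Definition mode : fields R := Fields
  (fun x => trig true (phase kv x.1) * mode_zeta x.2)
  (fun x => \col_i mode_u i x)
  (fun x => trig true (phase kv x.1) * mode_q x.2)
  (fun xh => lam^-1 * (trig true (phase kv xh) * w 0%N 0)).

Lemma sqr_wavenumber : k ^+ 2 = kv.1 ^+ 2 + kv.2 ^+ 2.
Proof. by rewrite sqr_sqrtr// addr_ge0 ?sqr_ge0. Qed.

Lemma w_hs n j : (j <= 4)%N -> hs n k (w j).
Proof. by move=> j4; exact: (eigen_der_hs a_gt0 mu_gt0 k_gt0 rhoP lam_gt0 hY bY). Qed.

Lemma w_der j (t : R) : (j < 4)%N -> t < 0 -> is_derive t 1 (w j) (w j.+1 t).
Proof. by move=> j4 t0; exact: (eigen_der_der mu_gt0 rhoP lam_gt0 hY). Qed.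

Lemma w_lim j : (j < 4)%N -> w j t @[t --> 0^'-] --> w j 0.
Proof.
by move=> j4; apply: cvg_at_left_filter; exact: (eigen_der_continuous rhoP hY j4).
Qed.

Lemma der1_left F (h : R -> R) (t d : R) : (forall u, u < 0 -> F u = h u) -> t < 0 ->
  is_derive t 1 h d -> derive1 F t = d.
Proof.
move=> Fh t0 dh; apply: der1E; apply: (der_near dh); near=> u; rewrite Fh//.
by near: u; exact: near0_left.
Unshelve. all: by end_near. Qed.

Lemma lim_left F (h : R -> R) (l m : R) : h t @[t --> 0^'-] --> l ->
  (forall u, u < 0 -> F u = h u) -> l = m -> F t @[t --> 0^'-] --> m.
Proof.
move=> hl Fh <-; apply: cvg_trans hl; apply: near_eq_cvg; near=> u; rewrite Fh//.
Unshelve. all: by end_near. Qed.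

Lemma rho_hs n : hs n 0 rho.
Proof. exact: (hs_rho a_gt0 rhoP). Qed.

Lemma mode_h_hs kj n : hs n k (mode_h kj).
Proof. by apply: hsZ; exact: w_hs. Qed.

Lemma mode_q_hs n : hs n k mode_q.
Proof.
have h1 := hsM (rho_hs n) (w_hs n (j := 1) isT); rewrite add0r in h1.
apply: hsZ; apply: hsB; apply: hsZ => //.
by apply: hsB; [exact: w_hs|apply: hsZ; exact: w_hs].
Qed.

Lemma mode_zeta_hs n : hs n k mode_zeta.
Proof.
have h1 := hsM (hs_derive1 (rho_hs n.+1)) (w_hs n (j := 0) isT); rewrite add0r in h1.
exact: hsZ.
Qed.

Definition u_trig i := i == 2.
Definition u_profile i : R -> R :=
  if i == 0 then mode_h kv.1 else if i == 1 then mode_h kv.2 else w 0%N.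

Lemma wave_u i : wave (u_trig i) (u_profile i) (mode_u i).
Proof.
split=> [n|x _]; have [->|->|->] := ord3E i => //; rewrite /u_profile/=;
  [exact: mode_h_hs|exact: mode_h_hs|exact: w_hs].
Qed.

Lemma wave_q : wave true mode_q (f_q mode).
Proof. by split => // n; exact: mode_q_hs. Qed.

Lemma wave_zeta : wave true mode_zeta (f_zeta mode).
Proof. by split => // n; exact: mode_zeta_hs. Qed.

Lemma vcomp_mode (c : R) i : vcomp (fun x => c *: f_u mode x) i = (fun x => c * mode_u i x).
Proof. by apply/funext => x; rewrite /vcomp !mxE. Qed.

Lemma vcomp_mode1 i : vcomp (f_u mode) i = mode_u i.
Proof. by apply/funext => x; rewrite /vcomp !mxE. Qed.

Lemma sum3 (F : 'I_3 -> R) : \sum_i F i = F 0 + F 1 + F 2.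
Proof.
rewrite !big_ord_recl big_ord0 addr0 addrA.
by congr (F _ + F _ + F _); apply: val_inj.
Qed.

Lemma wave_laplacian c F f x : wave c F f -> Omega x ->
  \sum_(j < 3) pdiff j (pdiff j f) x =
  trig c (phase kv x.1) * (derive1 (derive1 F) x.2 - k ^+ 2 * F x.2).
Proof.
move=> wf xO; rewrite sum3.
have [_ ->//] := wave_pdiff 0 (wave_pdiff 0 wf); have [_ ->//] := wave_pdiff 1 (wave_pdiff 1 wf).
have [_ ->//] := wave_pdiff 2 (wave_pdiff 2 wf).
by rewrite sqr_wavenumber /dprofile /dtrig/=; case: c {wf} => /=; ring.
Qed.

Lemma mode_h_der kj (t : R) : t < 0 -> derive1 (mode_h kj) t = - (kj / k ^+ 2) * w 2%N t.
Proof. by move=> t0; apply: der1E; apply: derZ; exact: w_der. Qed.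

Lemma mode_h_der2 kj (t : R) : t < 0 -> derive1 (derive1 (mode_h kj)) t = - (kj / k ^+ 2) * w 3%N t.
Proof. by move=> t0; apply: (der1_left (mode_h_der kj) t0); apply: derZ; exact: w_der. Qed.

Lemma w0_der2 (t : R) : t < 0 -> derive1 (derive1 (w 0%N)) t = w 2%N t.
Proof.
move=> t0; apply: (der1_left (h := w 1%N)) => [u u0|//|]; last exact: w_der.
by apply: der1E; exact: w_der.
Qed.

Lemma mode_q_der (t : R) : t < 0 -> derive1 mode_q t =
  - (k ^+ 2)^-1 * (lam * (derive1 rho t * w 1%N t + rho t * w 2%N t)
     - mu * (w 4%N t - k ^+ 2 * w 2%N t)).
Proof.
move=> t0; have dr := der_rho rhoP t0; rewrite ext_s_lt0// in dr.
have d1 := w_der (j := 1) isT t0; have d3 := w_der (j := 3) isT t0.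
apply: der1E; apply: derZ.
exact: (derB (derZ lam (derM dr d1)) (derZ mu (derB d3 (derZ (k ^+ 2) d1)))).
Qed.

Lemma k2_neq0 : k ^+ 2 != 0.
Proof. by rewrite expf_neq0// gt_eqF. Qed.

Let z02 : (0 == 2 :> 'I_3) = false. Proof. by []. Qed.
Let z12 : (1 == 2 :> 'I_3) = false. Proof. by []. Qed.

Lemma mode_momentum i x : Omega x ->
  rho x.2 * (lam * mode_u i x) + pdiff i (f_q mode) x
  - mu * \sum_(j < 3) pdiff j (pdiff j (mode_u i)) x + g * f_zeta mode x * (i == 2)%:R = 0.
Proof.
move=> xO; have x0 : x.2 < 0 by [].
rewrite (wave_laplacian (wave_u i) xO).
have [_ ->//] := wave_pdiff i wave_q; have [_ ->//] := wave_zeta.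
have k2 := k2_neq0; have k2E := sqr_wavenumber.
have [e|e|e] := ord3E i; subst i; rewrite /mode_u /u_trig /u_profile /dprofile /dtrig ?eqxx ?z02 ?z12/=.
- rewrite mode_h_der2// /mode_h /mode_q.
  by move: (k ^+ 2) k2 => K K0; field.
- rewrite mode_h_der2// /mode_h /mode_q.
  by move: (k ^+ 2) k2 => K K0; field.
- rewrite w0_der2// mode_q_der// /mode_zeta.
  have := eigen_der_equation g k rho mu_gt0 Y lam_gt0 x0 => /=.
  set X := lam ^+ 2 * _ + _; set Z := g * _ * _ * _ => XZ.
  have l0 : lam != 0 by rewrite gt_eqF.
  (* After elimination of the pressure, the vertical momentum balance is the eigenvalue equation
     divided by lam k^2. *)
  have E : trig true (phase kv x.1) * ((X - Z) / (lam * k ^+ 2)) = 0 by rewrite XZ subrr mul0r mulr0.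
  rewrite -[RHS]E /X /Z; rewrite [k ^+ 4](exprM k 2 2); move: (k ^+ 2) k2 => K K0.
  by field; rewrite K0 l0.
Qed.

Lemma mode_div x : Omega x -> \sum_(i < 3) pdiff i (mode_u i) x = 0.
Proof.
move=> xO; rewrite sum3.
have [_ ->//] := wave_pdiff 0 (wave_u 0); have [_ ->//] := wave_pdiff 1 (wave_u 1).
have [_ ->//] := wave_pdiff 2 (wave_u 2).
rewrite /u_trig /u_profile /dprofile /dtrig ?eqxx ?z02 ?z12/= (der1E (w_der (j := 0) isT xO)) /mode_h.
by rewrite -[RHS](mulr0 (trig true (phase kv x.1))) -(subrr (w 1 x.2)) sqr_wavenumber; field;
  rewrite -sqr_wavenumber k2_neq0.
Qed.

Lemma mode_q_lim : mode_q t @[t --> 0^'-] -->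
  - (k ^+ 2)^-1 * (lam * (rp * w 1%N 0) - mu * (w 3%N 0 - k ^+ 2 * w 1%N 0)).
Proof.
have rl : rho t @[t --> 0^'-] --> rp.
  by rewrite -(density_plus rhoP); have [_ [_ ]] := density_smooth rhoP.
exact: (limZ (limB (limZ (limM rl (w_lim (j := 1) isT)))
  (limZ (limB (w_lim (j := 3) isT) (limZ (w_lim (j := 1) isT)))))).
Qed.

Lemma cvg_col_left (M : R -> 'cV[R]_3) :
  (forall i, M t i 0 @[t --> 0^'-] --> (0 : R)) -> M t @[t --> 0^'-] --> (0 : 'cV[R]_3).
Proof.
move=> Mi; apply/cvgrPdist_le => /= e e0; near=> t.
rewrite /Num.Def.normr/= mx_normrE (bigmax_le _ (ltW e0))//= => -[i j] _.
rewrite !mxE/= (ord1 j).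
move: i; near: t; apply: filter_forall => /= i.
have /cvgrPdist_le/(_ _ e0) := Mi i; exact: filterS.
Unshelve. all: by end_near. Qed.

Lemma mul_e3 (M : 'M[R]_3) i : (M *m e3) i 0 = M i 2.
Proof. by rewrite mxE sum3 /e3 !mxE/= !mulr0 !add0r mulr1. Qed.

Lemma mode_stress (e : R) xh i :
  (((e * f_q mode (xh, z) - g * rp * (e * f_eta mode xh))%:M
    - mu *: strain (fun x => e *: f_u mode x) (xh, z)) *m e3) i 0 @[z --> 0^'-] --> (0 : R).
Proof.
have [bc1 bc2] := eigen_der_bc mu_gt0 rhoP lam_gt0 brY.
have k2 := k2_neq0.
have W j := waveZ e (wave_u j).
have E z : z < 0 -> (((e * f_q mode (xh, z) - g * rp * (e * f_eta mode xh))%:M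
    - mu *: strain (fun x => e *: f_u mode x) (xh, z)) *m e3) i 0 =
   (e * f_q mode (xh, z) - g * rp * (e * f_eta mode xh)) * (i == 2)%:R
   - mu * (pdiff 2 (fun x => e * mode_u i x) (xh, z) + pdiff i (fun x => e * mode_u 2 x) (xh, z)).
  by move=> _; rewrite mul_e3 !mxE !vcomp_mode; case: (i == 2); rewrite ?mulr1n ?mulr0n ?mulr1 ?mulr0.
have h0 F c f l : wave c F f -> F t @[t --> 0^'-] --> l -> f (xh, z) @[z --> 0^'-] --> trig c (phase kv xh) * l.
  by move=> wf Fl; exact: wave_lim wf Fl.
have dl kj : derive1 (fun t => e * mode_h kj t) t @[t --> 0^'-] --> e * (- (kj / k ^+ 2) * w 2%N 0).
  apply: (lim_left (limZ (c := e) (limZ (c := - (kj / k ^+ 2)) (w_lim (j := 2) isT)))) => // u u0.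
  by apply: der1E; apply: derZ; apply: derZ; exact: w_der.
have d0 : derive1 (fun t => e * w 0%N t) t @[t --> 0^'-] --> e * w 1%N 0.
  apply: (lim_left (limZ (c := e) (w_lim (j := 1) isT))) => // u u0.
  by apply: der1E; apply: derZ; exact: w_der.
have wl0 := w_lim (j := 0) isT.
have w20 : w 2%N 0 = - (k ^+ 2 * w 0%N 0) by apply/eqP; rewrite -addr_eq0 addrC bc1.
have [ei|ei|ei] := ord3E i; subst i.
- have l1 := h0 _ _ _ _ (wave_pdiff 2 (W 0)) (dl kv.1).
  have l2 := h0 _ _ _ _ (wave_pdiff 0 (W 2)) (limZ (limZ wl0)).
  apply: (lim_left (limZ (c := - mu) (limD l1 l2))) => [u u0|].
    by rewrite E//= mulr0 add0r mulNr.
  by rewrite w20 /u_trig /dtrig eqxx ?z02 ?z12/=; move: (k ^+ 2) k2 => K K0; field.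
- have l1 := h0 _ _ _ _ (wave_pdiff 2 (W 1)) (dl kv.2).
  have l2 := h0 _ _ _ _ (wave_pdiff 1 (W 2)) (limZ (limZ wl0)).
  apply: (lim_left (limZ (c := - mu) (limD l1 l2))) => [u u0|].
    by rewrite E//= mulr0 add0r mulNr.
  by rewrite w20 /u_trig /dtrig eqxx ?z02 ?z12/=; move: (k ^+ 2) k2 => K K0; field.
- have l1 := h0 _ _ _ _ (wave_pdiff 2 (W 2)) d0.
  have l2 := limZ (c := e) (h0 _ _ _ _ wave_q mode_q_lim).
  have cc (c : R) : c @[_ --> (0 : R)^'-] --> c by exact: cvg_cst.
  apply: (lim_left (limB (limB l2 (cc (g * rp * (e * f_eta mode xh)))) (limZ (c := mu) (limD l1 l1)))) => [u u0|].
    by rewrite E//= mulr1.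
  have l0 : lam != 0 by rewrite gt_eqF.
  set X := - (lam * mu * w 3 0) + _ + _ in bc2.
  (* The normal stress is the third order boundary condition divided by - lam k^2; the tangential
     components above reduce to k^2 phi + phi'' = 0. *)
  have E' : - e * trig true (phase kv xh) * (X / (lam * k ^+ 2)) = 0 by rewrite bc2 mul0r mulr0.
  rewrite -[RHS]E' /X /u_trig /dtrig /mode eqxx/=; move: (k ^+ 2) k2 => K K0.
  by field; rewrite K0 l0.
Qed.

Lemma derivable_expR (t : R) : derivable (fun s => expR (lam * s)) t 1.
Proof. by case: (der_expR lam t). Qed.

Lemma derive1_expRZ (c t : R) : derive1 (fun s => expR (lam * s) * c) t = lam * (expR (lam * t) * c).
Proof.
have d := derM (der_expR lam t) (der_cst c t).
by rewrite (der1E d) mulr0 addr0 mulrA.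
Qed.

Lemma mode_eta_periodic : periodic_h L (f_eta mode).
Proof. by move=> m1 m2 xh; rewrite /= (phase_periodic L_gt0 kL). Qed.

Lemma wave_laplacianZ c F f (e : R) x : wave c F f -> Omega x ->
  \sum_(j < 3) pdiff j (pdiff j (fun y => e * f y)) x = e * \sum_(j < 3) pdiff j (pdiff j f) x.
Proof.
move=> wf xO; rewrite mulr_sumr; apply: eq_bigr => j _.
rewrite -(pdiffZ _ _ (wave_differentiable (wave_pdiff j wf) xO)); apply: pdiff_near => // y yO.
by rewrite (pdiffZ _ _ (wave_differentiable wf yO)).
Qed.

Lemma mode_normal : normal_mode g mu L rp rho lam mode.
Proof.
split=> //.
- have [t t0 tn] := chr_nontrivial a_gt0 mu_gt0 rhoP lam_gt0 hY Y_neq0.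
  move=> [/(_ ((0, 0), t) t0)[_ /colP/(_ 2) + _] _].
  rewrite !mxE /mode_u/= /phase /trig !mulr0 addr0 cos0 mul1r.
  by apply/eqP.
- split.
  split.
  + exact: (wave_regular L_gt0 kL derivable_expR wave_zeta).
  + move=> i; under eq_fun do rewrite vcomp_mode.
    exact: (wave_regular L_gt0 kL derivable_expR (wave_u i)).
  + exact: (wave_regular L_gt0 kL derivable_expR wave_q).
  + by move=> t m1 m2 xh; rewrite mode_eta_periodic.
  + by move=> t xh; apply: derivableM; [exact: derivable_expR|exact: derivable_cst].
  split.
  + move=> t x xO; rewrite derive1_expRZ vcomp_mode /mode_u /= /mode_zeta; field.
    by rewrite gt_eqF.
  + move=> t x xO; apply/colP => i.
    rewrite [RHS]mxE -[RHS](mulr0 (expR (lam * t))) -(mode_momentum i xO) !mxE.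
    have -> : (fun s0 => vcomp (fun x0 => expR (lam * s0) *: f_u mode x0) i x) =
        (fun s0 => expR (lam * s0) * mode_u i x) by apply/funext => s0; rewrite vcomp_mode.
    rewrite derive1_expRZ vcomp_mode.
    rewrite [in LHS](wave_laplacianZ (expR (lam * t)) (wave_u i) xO).
    rewrite (pdiffZ _ _ (wave_differentiable wave_q xO)).
    by rewrite andbT; ring.
  + move=> t x xO; rewrite /div; under eq_bigr do rewrite vcomp_mode.
    rewrite (eq_bigr (fun i => expR (lam * t) * pdiff i (mode_u i) x)); last first.
      by move=> i _; rewrite (pdiffZ _ _ (wave_differentiable (wave_u i) xO)).
    by rewrite -mulr_sumr mode_div// mulr0.
  + move=> t xh; rewrite derive1_expRZ vcomp_mode.
    have := wave_lim (xh := xh) (waveZ (expR (lam * t)) (wave_u 2)) (limZ (w_lim (j := 0) isT)).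
    congr (_ --> _); rewrite /=; field; by rewrite gt_eqF.
  + by move=> t xh; apply: cvg_col_left => i; exact: mode_stress.
Qed.

Lemma mode_horizontal : horizontal_form rho kv lam mode.
Proof.
exists (mode_h kv.1), (mode_h kv.2), (w 0%N), mode_q; split; [split|split].
- exact: (hs_Ny k_gt0 (mode_h_hs _ 0)).
- exact: (hs_Ny k_gt0 (mode_h_hs _ 0)).
- exact: (hs_Ny k_gt0 (w_hs 0 (j := 0) isT)).
- exact: (hs_Ny k_gt0 (mode_q_hs 0)).
- by move=> x xO; rewrite !vcomp_mode1; split => //; rewrite /= /mode_zeta /mode_u/=; ring.
- move=> xh; have := limZ (c := lam^-1) (wave_lim (xh := xh) (wave_u 2) (w_lim (j := 0) isT)).
  by rewrite vcomp_mode1.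
Qed.

End NormalMode.

Theorem proposition3p6 (R : realType) (g mu L a rho_minus rho_plus : R)
    (rho0 : R -> R) (g_gt0 : 0 < g) (mu_gt0 : 0 < mu) (L_gt0 : 0 < L)
    (a_gt0 : 0 < a) (rhoP : density_assumption a rho_minus rho_plus rho0)
    (k : R * R) (kL : frequency L k) (k_neq0 : k <> (0, 0)) :
  exists (lam : nat -> R) (V : nat -> fields R),
    characteristic_sequence g mu rho_plus rho0 k lam /\
    forall n : nat,
      [/\ normal_mode g mu L rho_plus rho0 (lam n) (V n),
          horizontal_form rho0 k (lam n) (V n),
          Hinfty L (f_zeta (V n)),
          forall i : 'I_3, Hinfty L (vcomp (f_u (V n)) i) &
          Hinfty L (f_q (V n))].
Proof.
have k0 : 0 < wavenumber k.
  rewrite sqrtr_gt0 lt_neqAle addr_ge0 ?sqr_ge0// andbT eq_sym paddr_eq0 ?sqr_ge0//.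
  rewrite !sqrf_eq0; apply/negP => /andP[/eqP k1 /eqP k2].
  by apply: k_neq0; rewrite [k]surjective_pairing k1 k2.
have [lam [chars chrs]] := characteristic_sequence_ex a_gt0 g_gt0 mu_gt0 k0 rhoP erefl.
have /choice[Y hY] : forall n, exists Y, [/\ ham g mu (wavenumber k) (ext_r rho0) (ext_s rho0) (lam n) (fun=> 0) Y,
    bc_left a mu (wavenumber k) rho_minus (lam n) Y, bc_right g (wavenumber k) rho_plus Y & exists x, Y 0%N x != 0].
  by move=> n; exact: (chrs n).2.
exists lam, (fun n => mode g mu rho0 k (lam n) (Y n)); split => // n.
have [l0 _ _ _] := chars; have {}l0 := l0 n; have [h1 h2 h3 h4] := hY n.
split.
- exact: (mode_normal a_gt0 mu_gt0 L_gt0 rhoP kL k0 l0 h1 h2 h3 h4).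
- exact: (mode_horizontal a_gt0 mu_gt0 rhoP k0 l0 h1 h2).
- exact: (wave_Hinfty k0 L_gt0 kL (wave_zeta a_gt0 mu_gt0 rhoP k0 l0 h1 h2)).
- by move=> i; rewrite vcomp_mode1; exact: (wave_Hinfty k0 L_gt0 kL (wave_u a_gt0 mu_gt0 rhoP k0 l0 h1 h2 i)).
- exact: (wave_Hinfty k0 L_gt0 kL (wave_q a_gt0 mu_gt0 rhoP k0 l0 h1 h2)).
Qed.
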